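(* The deterministic truly online paging algorithm DTO (described in the context) is very strongly competitive on every access graph: there exist absolute constants $b_1,b_2\ge0$ such that for every integer $k\ge1$ and every (undirected) access graph $G$, $$r_{\mathrm{DTO}}(G,k)\le b_1\, r^\infty(G,k)+b_2 .$$
   Context: Paging: there is a cache with $k$ page slots, initially empty, and a finite request sequence $\sigma$ of pages. If a requested page is not in the cache a fault occurs, the page is brought in, and if the cache is full the algorithm must evict a page; an online algorithm makes this choice knowing only the requests so far. $A(k,\sigma)$ is the number of faults of $A$ on $\sigma$ and $\mathrm{OPT}(k,\sigma)$ the minimum possible number of faults of any (offline) strategy. Access graph model: an access graph $G$ is an undirected graph whose vertices are the pages; $\mathrm{paths}(G)$ is the set of finite request sequences in which every two consecutive requests are equal or adjacent in $G$. The strict competitive ratio is $r_A(G,k)=\inf\{r:\forall\sigma\in\mathrm{paths}(G),\ A(k,\sigma)\le r\,\mathrm{OPT}(k,\sigma)\}$ and the asymptotic one is $r^\infty_A(G,k)=\inf\{r:\exists C\ge0\ \forall\sigma\in\mathrm{paths}(G),\ A(k,\sigma)\le r\,\mathrm{OPT}(k,\sigma)+C\}$. $r^\infty(G,k)$ is the infimum of $r^\infty_A(G,k)$ over all deterministic online algorithms $A$. Phases: $\sigma$ is partitioned into consecutive phases; the first starts at the beginning, and each phase ends at the end of $\sigma$ or just before the request to the $(k+1)$-st distinct page of that phase. A page is marked if requested in the current phase. A page is stale if it was requested in the previous phase and has not yet been requested or evicted in the current phase; it is a hole if it was requested in the previous phase, evicted during the current phase, and not yet requested in the current phase. Algorithm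 DTO$(k)$: it never evicts a marked page and evicts only on a fault with a full cache. At the start of each phase let $P$ be the set of pages requested in the previous phase (empty in the first phase), $G_P$ the graph on $P$ with an edge $uv$ ($u\neq v$) whenever $u,v$ were requested consecutively in the previous phase, and $G_0$ a spanning tree of $G_P$; graph notions below refer to $G_0$. Subphase I: with $C$ the set of vertices of $G_0$ of degree $\ne2$, on a fault evict a stale page in $C$; if none exists, proceed to Subphase II. Subphase II: let $C'$ be the set of holes at the beginning of Subphase II; for $v\in C'$ keep $A_v$, initially $\{v\}$; $v$ is alive as long as $A_v$ consists only of holes and some stale vertex is adjacent to $A_v$. On a fault choose an alive $v\in C'$, evict a stale vertex $w$ adjacent to $A_v$ and set $A_v\leftarrow A_v\cup\{w\}$; if no alive $v$ exists, proceed to Subphase III. Subphase III: on a fault choose a path $p$ in $G_0$ consisting of unmarked vertices, containing a stale page and maximal with respect to containment, and evict a stale page of $p$ closest to the midpoint of $p$ (the vertex or edge at equal distance from both endpoints). DTO is truly online: it does not receive $G$. *)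

(* Defs.v *)
From mathcomp Require Import all_boot all_order all_algebra finmap.
From mathcomp Require Import all_classical all_reals ereal.

Set Implicit Arguments.
Unset Strict Implicit.
Unset Printing Implicit Defensive.

Local Open Scope fset_scope.

Section Paging.
Variable V : choiceType.
Implicit Types (k : nat) (c : {fset V}) (x v w : V) (s : seq V).

(* The cache after serving a request to x from cache c, where v is the page
   designated for eviction; v is ignored unless an eviction is forced. *)
Definition serve k c x v : {fset V} :=
  if x \in c then c
  else if #|` c| < k then x |` c
  else x |` (c `\ v).

(* A schedule is a sequence of pairs (requested page, designated victim). *)
Fixpoint legal k c (t : seq (V * V)) : bool :=
  if t is (x, v) :: t' then
    [|| x \in c, #|` c| < k | v \in c] && legal k (serve k c x v) t'
  else true.

Fixpoint faults k c (t : seq (V * V)) : nat :=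
  if t is (x, v) :: t' then (x \notin c) + faults k (serve k c x v) t'
  else 0.

(* Offline: the designated victims may depend on the whole sequence s. *)
Definition offline_faults k s : set nat :=
  [set n | exists d : seq V,
    [/\ size d = size s, legal k fset0 (zip s d) & faults k fset0 (zip s d) = n]].

(* The minimum exists as soon as 0 < k; otherwise the value is irrelevant. *)
Definition OPT k s : nat :=
  xget 0 [set n | offline_faults k s n /\
                  forall m, offline_faults k s m -> n <= m].

(* A deterministic online algorithm, for a given cache size: the designated
   victim as a function of the requests so far, current request included. *)
Definition online := seq V -> V.

Definition schedule (A : online) s : seq (V * V) :=
  zip s [seq A (take i.+1 s) | i <- iota 0 (size s)].

Definition online_legal k (A : online) : Prop :=
  forall s, legal k fset0 (schedule A s).

Definition cost k (A : online) s : nat := faults k fset0 (schedule A s).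

(* An access graph is given by its adjacency relation on the pages. *)
Definition paths (G : rel V) : pred (seq V) :=
  sorted (fun u v => (u == v) || G u v).

Section Ratios.
Variable R : realType.
Local Open Scope ring_scope.

(* Ratios range over nonnegative reals, and the infima are taken in \bar R.
   Without 0 <= r the asymptotic ratio would be -oo on a graph with at most
   k vertices, where all costs are bounded. *)
Definition strict_ratio k (A : online) (G : rel V) : \bar R :=
  ereal_inf [set r%:E | r in [set r : R | 0 <= r /\
    forall s, s \in paths G -> (cost k A s)%:R <= r * (OPT k s)%:R]].

Definition asymptotic_ratio k (A : online) (G : rel V) : \bar R :=
  ereal_inf [set r%:E | r in [set r : R | 0 <= r /\
    exists2 C : R, 0 <= C &
      forall s, s \in paths G -> (cost k A s)%:R <= r * (OPT k s)%:R + C]].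

Definition graph_ratio k (G : rel V) : \bar R :=
  ereal_inf [set asymptotic_ratio k A G | A in [set A | online_legal k A]].

End Ratios.

(* G_P: consec s is the graph on the pages of s whose edges join distinct
   pages requested consecutively in s. *)
Definition consec s : rel V := fun u v =>
  (u != v) &&
  (((u, v) \in zip s (behead s)) || ((v, u) \in zip s (behead s))).

Definition spanning_tree s (T : rel V) : Prop :=
  [/\ symmetric T,
      subrel T (consec s),
      {in s &, forall u v, exists2 p, path T u p & last u p = v} &
      forall p, 2 < size p -> ~~ (cycle T p && uniq p)].

(* In Subphase II: the set C' and the family (A_v), relevant for v in C'. *)
Inductive subphase :=
  | SubI
  | SubII of {fset V} & (V -> {fset V})
  | SubIII.

Record state := State {
  cache : {fset V};
  evicted : {fset V};  (* pages evicted during the current phase *)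
  previous : seq V;    (* requests of the previous phase, [::] if none *)
  current : seq V;     (* requests of the current phase so far *)
  tree : rel V;        (* G_0, a spanning tree of consec previous *)
  stage : subphase
}.

Definition init_state : state :=
  State fset0 fset0 [::] [::] (fun _ _ => false) SubI.

Section Rules.
Variable st : state.

Definition marked v := v \in current st.
Definition stale v :=
  [&& v \in previous st, v \notin current st & v \notin evicted st].
Definition hole v :=
  [&& v \in previous st, v \in evicted st & v \notin current st].
Definition holes : {fset V} := [fset v in previous st | hole v].

Definition degree v := #|` [fset u in previous st | tree st v u] |.
Definition branch v := (v \in previous st) && (degree v != 2).

Definition adjacent (B : {fset V}) w : Prop :=
  exists2 u, u \in B & tree st u w.

Definition alive (B : {fset V}) : Prop :=
  (forall u, u \in B -> hole u) /\ (exists2 w, stale w & adjacent B w).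

Definition unmarked_path (p : seq V) : Prop :=
  [/\ p != [::], uniq p, sorted (tree st) p &
      {in p, forall v, v \in previous st /\ ~~ marked v}].

Definition maximal_path (p : seq V) : Prop :=
  [/\ unmarked_path p, has stale p &
      forall q, unmarked_path q -> {subset p <= q} -> {subset q <= p}].

(* With i and j the distances along p from v to the two endpoints, the
   distance from v to the midpoint of p is |i - j| / 2, minus 1 / 2 if the
   midpoint is an edge; so it is monotone in |i - j|. *)
Definition off_center (p : seq V) v : nat :=
  let i := index v p in let j := size p - i.+1 in (i - j) + (j - i).

(* evicts b w b': on a fault with a full cache that occurs in subphase b, page
   w may be evicted, leaving the algorithm in subphase b'. *)
Inductive evicts : subphase -> V -> subphase -> Prop :=
  | EvictI w :
      stale w -> branch w -> evicts SubI w SubI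
  | ProceedII w b :
      (forall u, stale u -> ~~ branch u) ->
      evicts (SubII holes (fun v => [fset v])) w b -> evicts SubI w b
  | EvictII (C' : {fset V}) (B : V -> {fset V}) v w :
      v \in C' -> alive (B v) -> stale w -> adjacent (B v) w ->
      evicts (SubII C' B) w
        (SubII C' (fun u => if u == v then w |` B v else B u))
  | ProceedIII (C' : {fset V}) (B : V -> {fset V}) w b :
      (forall v, v \in C' -> ~ alive (B v)) ->
      evicts SubIII w b -> evicts (SubII C' B) w b
  | EvictIII p w :
      maximal_path p -> w \in p -> stale w ->
      (forall u, u \in p -> stale u -> off_center p w <= off_center p u) ->
      evicts SubIII w SubIII.

End Rules.

Definition starts_phase k (st : state) x : bool :=
  (x \notin current st) && (k <= size (undup (current st))).

(* Phase bookkeeping, done before an eviction is decided; in particular the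
   requested page is already marked when a victim is chosen. *)
Definition mark k (st : state) x (st' : state) : Prop :=
  if starts_phase k st x then
    exists2 T, spanning_tree (current st) T &
      st' = State (cache st) fset0 (current st) [:: x] T SubI
  else
    st' = State (cache st) (evicted st) (previous st) (rcons (current st) x)
                (tree st) (stage st).

(* One step of DTO(k) on a request to x; w is the victim, if one is needed. *)
Definition dto_step k (st : state) x w (st' : state) : Prop :=
  exists2 st1, mark k st x st1 &
    let c' := serve k (cache st1) x w in
    if (x \in cache st1) || (#|` cache st1| < k) then
      st' = State c' (evicted st1) (previous st1) (current st1) (tree st1) (stage st1)
    else
      exists2 b, evicts st1 (stage st1) w b &
        st' = State c' (w |` evicted st1) (previous st1) (current st1) (tree st1) b.

(* The description of DTO leaves choices open (spanning tree, victim, v, path,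
   ties).  A is an instance of DTO(k) if some deterministic resolution of
   these choices, made from the requests so far, yields A. *)
Definition is_DTO k (A : online) : Prop :=
  exists2 S : seq V -> state, S [::] = init_state &
    forall s x, dto_step k (S s) x (A (rcons s x)) (S (rcons s x)).

End Paging.

(* Main.v *)
(** Fix a competitor with ratio at most q on G, and consider a phase of DTO with
    g new pages; P is the set of the k pages of the previous phase, T its
    spanning tree. Since OPT pays at least half of the total number of new pages,
    it is enough that DTO evicts O((q + 1) g) pages in the phase.

    The adversary gives two lower bounds on q. If k + 1 pages carry a tree with
    n leaves, then n <= q + 2: the pages that are not leaves are requested until
    the hole of the competitor is a leaf. If k + g pages consist of a connected
    core and of paths of lengths l_i ("vines") attached to it at both ends, then
    the sum of the numbers of halvings that bring l_i below g is O(q): a vine is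
    entered from the end where a half of it contains many holes, and that half
    is added to the core.

    A new page together with P has k + 1 pages, so T has O(q) vertices of degree
    other than 2, hence O(q) pages are evicted in Subphase I and O(q g) in
    Subphase II. At the start of Subphase III the stale pages lie in chains of
    unmarked vertices of degree 2, the gaps, whose ends are attached to a
    connected core. Marking a page of a gap splits it, and there are at most g
    holes. An eviction lowers a potential of order g times the number of
    halvings of each gap, as a page close to the middle of the gap is evicted;
    gaps shorter than 10 g are charged their stale pages. The potential grows
    only when the walk jumps into the interior of a gap, that is, along an edge
    of G outside T. Such an edge lets the adversary exchange the gap for better
    vines (if both sides are long), or gives a new leaf (if one side is short),
    so the total growth is O((q + 1) g) by the two lower bounds. *)

Require Import Defs.
From mathcomp Require Import all_boot all_order all_algebra finmap zify.
From mathcomp Require Import all_classical all_reals ereal.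

Set Implicit Arguments.
Unset Strict Implicit.
Unset Printing Implicit Defensive.

Local Open Scope fset_scope.
Local Open Scope nat_scope.

(** * Connected sets and vines *)

Section Connectivity.
Variable V : choiceType.
Implicit Types (R E : rel V) (K : {fset V}) (u v w x y : V) (p s : seq V).

(** The obstacle is the jumps along edges outside the tree: without them gaps would only be eaten
    from their ends, and the initial gaps could serve as vines throughout. To survive a jump, the
    adversary must be able to win back a gap that its core has swallowed. So the core is kept
    connected by edges that touch gaps only along the tree: without such a gap it falls into at most
    two pieces, and the jump together with one side of the gap joins them again, which frees the
    other side. The pages of the walk join the core only when a split with two long sides pays for
    it: this loses at most two levels and gains at least four, whence the threshold [10 * g]. Two
    inaccuracies of an eviction are absorbed by the potential. Up to [g] pages nearer to the
    midpoint may be holes, so sizes are diminished by [2 * g]. And the path may run on beyond an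
    unmarked end of an initial gap, which moves the midpoint away from the middle of the gap; such
    an end carries a flag, and the flag is lost in place of a level. All counting is in natural
    numbers: the ratio and the additive constant of the competitor are rounded up to [q] and
    [c0]. *)

Definition reach R K u v :=
  exists p, [/\ path R u p, last u p = v & {subset u :: p <= K}].

Definition conn R K := {in K &, forall u v, reach R K u v}.

Lemma reach_refl R K u : u \in K -> reach R K u u.
Proof. by move=> uK; exists [::]; split=> // z; rewrite inE => /eqP->. Qed.

Lemma reach_trans R K v u w : reach R K u v -> reach R K v w -> reach R K u w.
Proof.
move=> [p [pp lp sp]] [q [pq lq sq]]; exists (p ++ q).
rewrite cat_path pp lp pq last_cat lp lq; split=> // z.
rewrite inE mem_cat orbA -in_cons => /orP[/sp//|zq].
by apply: sq; rewrite inE zq orbT.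
Qed.

Lemma reach_step R K u v : u \in K -> v \in K -> R u v -> reach R K u v.
Proof.
move=> uK vK Ruv; exists [:: v]; rewrite /= Ruv; split=> // z.
by rewrite !inE => /orP[]/eqP->.
Qed.

Lemma reach_sym R K u v : symmetric R -> reach R K u v -> reach R K v u.
Proof.
move=> sR [p [pp <- sp]]; exists (rev (belast u p)).
rewrite rev_path (eq_path (e' := R)) ?pp => [|a b]; last exact: sR.
split=> //; first by case: p {pp sp} => //= a p; rewrite rev_cons last_rcons.
by move=> z; rewrite inE mem_rev => /orP[/eqP->|/mem_belast]; [apply: sp; rewrite mem_last|apply: sp].
Qed.

Lemma reach_sub R R' K K' u v :
  {subset K <= K'} -> {in K &, subrel R R'} -> reach R K u v -> reach R' K' u v.
Proof.
move=> sK sR [p [pp lp sp]]; exists p; split=> //; last by move=> z /sp/sK.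
elim: p u pp sp {lp} => //= a p IH u /andP[Rua pp] sp.
rewrite sR ?IH //; try by apply: sp; rewrite !inE eqxx ?orbT.
by move=> z zp; apply: sp; rewrite inE zp orbT.
Qed.

Lemma reach_in R K u v : reach R K u v -> u \in K /\ v \in K.
Proof.
move=> [p [_ <- sp]]; split; apply: sp; first by rewrite inE eqxx.
exact: mem_last.
Qed.

Lemma reach_path R K x s : path R x s -> {subset x :: s <= K} ->
  {in x :: s, forall v, reach R K x v}.
Proof.
move=> ps sK v; rewrite inE => /orP[/eqP->|vs].
  by apply: reach_refl; apply: sK; rewrite inE eqxx.
move: vs ps sK => /splitPr[s1 s2]; rewrite cat_path /= => /and3P[p1 R1 _] sK.
exists (rcons s1 v); rewrite rcons_path p1 R1 last_rcons; split=> // z zs.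
by apply: sK; move: zs; rewrite !inE mem_rcons mem_cat !inE => /or3P[] ->; rewrite ?orbT.
Qed.

Lemma conn_root R K x : symmetric R -> {in K, forall u, reach R K x u} -> conn R K.
Proof.
move=> sR h u v uK vK; apply: (@reach_trans _ _ x); last exact: h.
by apply: reach_sym => //; exact: h.
Qed.

Lemma conn_add R K K' : symmetric R -> conn R K -> K != fset0 ->
  {in K', forall u, exists2 v, v \in K & reach R (K `|` K') v u} -> conn R (K `|` K').
Proof.
move=> sR cK /fset0Pn[x xK] h; apply: (@conn_root _ _ x) => // u.
have mono a b : reach R K a b -> reach R (K `|` K') a b.
  by apply: reach_sub => // z zK; rewrite inE zK.
rewrite inE => /orP[uK|/h[v vK rvu]]; first exact/mono/cK.
by apply: reach_trans rvu; exact/mono/cK.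
Qed.

Lemma conn_relW R R' K : {in K &, subrel R R'} -> conn R K -> conn R' K.
Proof. by move=> h cK u v uK vK; apply: reach_sub (cK u v uK vK). Qed.

Lemma conn_add1 R K a v : symmetric R -> conn R K -> a \in K -> R a v ->
  conn R (v |` K).
Proof.
move=> sR cK aK Rav; rewrite fsetUC; apply: conn_add => //.
  by apply/fset0Pn; exists a.
move=> u; rewrite inE => /eqP->; exists a => //.
by apply: reach_step => //; rewrite !inE ?aK ?eqxx ?orbT.
Qed.

(** Paths between consecutive members of an enumeration of [K] are concatenated. The adversary uses
    such a tour to request its whole core. *)
Lemma conn_tour R K x : conn R K -> x \in K ->
  exists t, [/\ path R x t, {subset t <= K} & {subset K <= x :: t}].
Proof.
move=> cK xK.
suff [t [pt tK Kt]] : exists t, [/\ path R x t, {subset t <= K} &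
    {subset enum_fset K <= x :: t}] by exists t.
have : {subset enum_fset K <= K} by [].
elim: (enum_fset K) => [|v s IH] sK; first by exists [::].
have [|t [pt tK st]] := IH; first by move=> z zs; apply: sK; rewrite inE zs orbT.
have lK : last x t \in K.
  by have := mem_last x t; rewrite inE => /orP[/eqP->|/tK].
have vK : v \in K by apply: sK; rewrite inE eqxx.
have [p [pp lp sp]] := cK _ _ lK vK.
exists (t ++ p); rewrite cat_path pt pp; split=> //.
  move=> z; rewrite mem_cat => /orP[/tK//|zp].
  by apply: sp; rewrite inE zp orbT.
move=> z; rewrite inE => /orP[/eqP->|/st].
  have := mem_last (last x t) p; rewrite lp inE => /orP[/eqP->|vp].
    by rewrite -cat_cons mem_cat mem_last.
  by rewrite inE mem_cat vp !orbT.
by rewrite -cat_cons mem_cat => ->.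
Qed.

End Connectivity.

Section Vines.
Variable (V : choiceType) (E : rel V).
Hypothesis Esym : symmetric E.
Implicit Types (K : {fset V}) (D : seq (seq V)) (x y v b : V) (s : seq V).

Definition fset_of s : {fset V} := [fset v in s].

Lemma in_fset_of s v : (v \in fset_of s) = (v \in s).
Proof. by rewrite inE. Qed.

Lemma card_fset_of s : uniq s -> #|` fset_of s| = size s.
Proof. by move=> us; rewrite card_fseq undup_id. Qed.

(** The two attachments may coincide, so a single page with one neighbour in [K] is a vine. Leaves
    are treated in this way. *)
Definition vine K s := exists x y, [/\ x \in K, y \in K & path E x (rcons s y)].

Definition vstruct K D :=
  [/\ conn E K, uniq (flatten D), {in flatten D, forall v, v \notin K} &
      {in D, forall s, vine K s}].

Definition vverts K D := K `|` fset_of (flatten D).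

Lemma card_vverts K D : vstruct K D ->
  #|` vverts K D| = #|` K| + size (flatten D).
Proof.
move=> [_ u nK _]; rewrite cardfsU card_fset_of //.
suff -> : K `&` fset_of (flatten D) = fset0 by rewrite cardfs0 subn0.
apply/fsetP => v; rewrite !inE; apply/negP => /andP[vK vD].
by move: (nK _ vD); rewrite vK.
Qed.

Lemma perm_flatten D D' : perm_eq D D' -> perm_eq (flatten D) (flatten D').
Proof.
move=> pD; apply/permP => P; rewrite !count_flatten.
by rewrite !sumnE; apply/perm_big/perm_map.
Qed.

Lemma vstruct_perm K D D' : perm_eq D D' -> vstruct K D -> vstruct K D'.
Proof.
move=> pD [cK u nK vD]; have pf := perm_flatten pD; split=> //.
- by rewrite -(perm_uniq pf).
- by move=> v; rewrite -(perm_mem pf) => /nK.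
by move=> s; rewrite -(perm_mem pD) => /vD.
Qed.

Lemma vverts_perm K D D' : perm_eq D D' -> vverts K D = vverts K D'.
Proof.
by move=> /perm_flatten pf; apply/fsetP => v; rewrite !inE (perm_mem pf).
Qed.

Lemma path_rev_rcons x s y : path E y (rcons (rev s) x) = path E x (rcons s y).
Proof.
have -> : path E x (rcons s y) = path (fun a b => E b a) x (rcons s y).
  by apply: eq_path => a b; exact: Esym.
by rewrite -[RHS]rev_path last_rcons belast_rcons rev_cons.
Qed.

Lemma vstruct_rev K s D : vstruct K (s :: D) -> vstruct K (rev s :: D).
Proof.
move=> [cK u nK vD].
have pf : perm_eq (flatten (s :: D)) (flatten (rev s :: D)).
  by rewrite /= perm_cat2r perm_sym perm_rev.
split=> //; first by rewrite -(perm_uniq pf).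
  by move=> v; rewrite -(perm_mem pf) => /nK.
move=> s'; rewrite inE => /orP[/eqP->|s'D]; last by apply: vD; rewrite inE s'D orbT.
have [|x [y [xK yK pxy]]] := vD s; first by rewrite inE eqxx.
by exists y, x; rewrite path_rev_rcons.
Qed.

Lemma vine_sub K K' s : {subset K <= K'} -> vine K s -> vine K' s.
Proof. by move=> h [x [y [/h ? /h ? ?]]]; exists x, y. Qed.

(** Read backwards from its attachment [y], the part [s2] hangs on the core by itself. What remains
    is held at [x] and at the first page of [s2], or at [y] when [s2] is empty. *)
Lemma vstruct_absorb K s1 s2 D : vstruct K ((s1 ++ s2) :: D) ->
  vstruct (K `|` fset_of s2) (s1 :: D).
Proof.
move=> [cK u nK vD].
have subK : {subset K <= K `|` fset_of s2} by move=> v vK; rewrite inE vK.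
have [|x [y [xK yK]]] := vD (s1 ++ s2); first by rewrite inE eqxx.
rewrite rcons_cat cat_path => /andP[p1 p2].
have p2' : path E y (rcons (rev s2) (last x s1)) by rewrite path_rev_rcons.
have r2 : {in s2, forall u, reach E (K `|` fset_of s2) y u}.
  move=> v vs; apply: (@reach_path _ _ _ _ (rev s2)).
  - by move: p2'; rewrite rcons_path => /andP[].
  - by move=> z; rewrite !inE mem_rev => /orP[/eqP->|->]; rewrite ?yK ?orbT.
  by rewrite inE mem_rev vs orbT.
split.
- apply: conn_add => //; first by apply/fset0Pn; exists x.
  by move=> v; rewrite in_fset_of => /r2; exists y.
- have := u; rewrite /= -catA uniq_catCA cat_uniq => /and3P[_ _ u2].
  exact: u2.
- move=> v vD'; have vK : v \notin K.
    by apply: nK; move: vD'; rewrite /= !mem_cat => /orP[]->; rewrite ?orbT.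
  rewrite !inE (negbTE vK) /=.
  move: u; rewrite /= -catA uniq_catCA cat_uniq => /and3P[_ /hasPn h _].
  by apply: h.
move=> s; rewrite inE => /orP[/eqP->|sD]; last first.
  by apply: vine_sub subK _; apply: vD; rewrite inE sD orbT.
case: s2 p2 r2 {vD p2' u nK subK} => [|b s2] /= p2 r2.
  by exists x, y; rewrite rcons_path p1 !inE xK yK; case/andP: p2.
exists x, b; rewrite rcons_path p1 !inE xK eqxx ?orbT; split=> //.
by case/andP: p2.
Qed.

Lemma vverts_absorb K s1 s2 D :
  vverts (K `|` fset_of s2) (s1 :: D) = vverts K ((s1 ++ s2) :: D).
Proof.
apply/fsetP=> v; rewrite !inE /=.
by case: (v \in K) => //=; case: (v \in s1); case: (v \in s2) => //=; rewrite ?orbT.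
Qed.

Lemma vverts_rev K s D : vverts K (rev s :: D) = vverts K (s :: D).
Proof. by apply/fsetP=> v; rewrite !inE /= mem_rev. Qed.

Lemma vstruct_behead K s D : vstruct K (s :: D) -> vstruct (K `|` fset_of s) D.
Proof.
rewrite -[s]cat0s => /vstruct_absorb[cK u nK vD]; split=> //.
by move=> s' s'D; apply: vD; rewrite inE s'D orbT.
Qed.

Lemma vverts_behead K s D : vverts (K `|` fset_of s) D = vverts K (s :: D).
Proof. by apply/fsetP=> v; rewrite !inE /= orbA. Qed.

End Vines.

(** * Schedules and online algorithms *)

Section PagingBasics.
Variable V : choiceType.
Implicit Types (k n g : nat) (c X Y : {fset V}) (x v w : V) (s d : seq V) (t : seq (V * V)).

Definition after k c t := foldl (fun c xv => serve k c xv.1 xv.2) c t.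

Lemma after_cat k c t1 t2 : after k c (t1 ++ t2) = after k (after k c t1) t2.
Proof. exact: foldl_cat. Qed.

Lemma faults_cat k c t1 t2 :
  faults k c (t1 ++ t2) = faults k c t1 + faults k (after k c t1) t2.
Proof. by elim: t1 c => //= [[x v] t1 IH] c; rewrite IH addnA. Qed.

Lemma legal_cat k c t1 t2 :
  legal k c (t1 ++ t2) = legal k c t1 && legal k (after k c t1) t2.
Proof. by elim: t1 c => //= [[x v] t1 IH] c; rewrite IH andbA. Qed.

Lemma serve_in k c x v : x \in serve k c x v.
Proof. by rewrite /serve; case: ifP => // _; case: ifP => _; rewrite !inE eqxx. Qed.

Lemma serve_sub k c x v : serve k c x v `<=` x |` c.
Proof.
apply/fsubsetP=> z; rewrite /serve; case: ifP => _; first by rewrite !inE orbC => ->.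
by case: ifP => _ //; rewrite !inE => /orP[->//|/andP[_ ->]]; rewrite orbT.
Qed.

Lemma card_serve k c x v : 0 < k -> #|` c| <= k ->
  [|| x \in c, #|` c| < k | v \in c] -> #|` serve k c x v| <= k.
Proof.
move=> k0 ck; rewrite /serve; case: ifP => //= xc.
case: ifP => /= [clt _|nlt vc]; first by rewrite cardfsU1 xc; lia.
rewrite cardfsU1 !inE xc andbF /=.
by have := cardfsD1 v c; rewrite vc; lia.
Qed.

Lemma card_after k c t : 0 < k -> #|` c| <= k -> legal k c t -> #|` after k c t| <= k.
Proof.
move=> k0; elim: t c => //= [[x v] t IH] c ck /andP[h1 h2].
by apply: IH => //; exact: card_serve.
Qed.

Lemma after_sub k c t X : c `<=` X -> {subset unzip1 t <= X} -> after k c t `<=` X.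
Proof.
elim: t c => //= [[x v] t IH] c cX tX; apply: IH; last first.
  by move=> z zt; apply: tX; rewrite inE zt orbT.
apply: fsubset_trans (serve_sub _ _ _ _) _.
by rewrite fsubUset fsub1set cX andbT; apply: tX; rewrite inE eqxx.
Qed.

Lemma faults_ge k c t : #|` fset_of (unzip1 t) `\` c| <= faults k c t.
Proof.
elim: t c => [|[x v] t IH] c /=.
  suff -> : fset_of [::] `\` c = fset0 by rewrite cardfs0.
  by apply/fsetP => z; rewrite !inE andbF.
apply: leq_trans (_ : (x \notin c) + #|` fset_of (unzip1 t) `\` serve k c x v| <= _); last first.
  by rewrite leq_add2l.
case: (boolP (x \in c)) => xc /=.
  have -> : serve k c x v = c by rewrite /serve xc.
  rewrite add0n; apply: fsubset_leq_card; apply/fsubsetP => z; rewrite !inE.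
  by case/andP=> zc /orP[/eqP zx|->]; [rewrite zx xc in zc|rewrite zc].
have : fset_of (x :: unzip1 t) `\` c `<=` x |` (fset_of (unzip1 t) `\` serve k c x v).
  apply/fsubsetP => z; rewrite !inE => /andP[zc /orP[->//|zt]].
  case: eqVneq => //= zx; rewrite zt andbT; apply/negP => /(fsubsetP (serve_sub _ _ _ _)).
  by rewrite !inE (negbTE zc) (negbTE zx).
move=> /fsubset_leq_card /leq_trans; apply.
by rewrite cardfsU1 addnC; case: (_ \in _); lia.
Qed.

Lemma legal_ex k c s : 0 < k -> #|` c| <= k ->
  exists2 d, size d = size s & legal k c (zip s d).
Proof.
move=> k0; elim: s c => [|x s IH] c ck; first by exists [::].
have [v hv] : exists v, [|| x \in c, #|` c| < k | v \in c].
  case: (ltnP #|` c| k) => clt; first by exists x; rewrite orbT.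
  have : c != fset0 by rewrite -cardfs_gt0; lia.
  by case/fset0Pn => v vc; exists v; rewrite vc !orbT.
have [d sd ld] := IH _ (card_serve k0 ck hv).
by exists (v :: d); rewrite /= ?sd ?hv.
Qed.

Lemma OPT_spec k s : 0 < k -> exists d,
  [/\ size d = size s, legal k fset0 (zip s d), faults k fset0 (zip s d) = OPT k s &
   forall d', size d' = size s -> legal k fset0 (zip s d') ->
     OPT k s <= faults k fset0 (zip s d')].
Proof.
move=> k0; have [d sd ld] := @legal_ex k fset0 s k0 (leq0n _).
have h0 : exists n, `[< offline_faults k s n >].
  by exists (faults k fset0 (zip s d)); apply/asboolP; exists d.
have : [set n | offline_faults k s n /\ forall m, offline_faults k s m -> n <= m]%classic (OPT k s).
  apply: xgetPex; exists (ex_minn h0); case: ex_minnP => n /asboolP hn hmin.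
  by split=> // m hm; apply: hmin; apply/asboolP.
case=> [[d' [s' l' f']]] hmin; exists d'; split=> // d2 s2 l2.
by apply: hmin; exists d2.
Qed.

(* Never evicting a page of the segment costs at most one fault per missing page. *)
Lemma offline_segment k c s Y : 0 < k -> #|` c| <= k -> #|` Y| <= k -> {subset s <= Y} ->
  exists d, let c' := after k c (zip s d) in
  [/\ size d = size s, legal k c (zip s d),
      faults k c (zip s d) + #|` Y `\` c'| <= #|` Y `\` c|, #|` c'| <= k &
      #|` c'| = k \/ faults k c (zip s d) + #|` c| = #|` c'|].
Proof.
move=> k0 ck Yk; elim: s c ck => [|x s IH] c ck sY.
  by exists [::]; split=> //; right.
have sY' : {subset s <= Y} by move=> z zs; apply: sY; rewrite inE zs orbT.
have xY : x \in Y by apply: sY; rewrite inE eqxx.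
case: (boolP (x \in c)) => xc.
  have [d [h1 h2 h3 h4 h5]] := IH c ck sY'.
  have e v : serve k c x v = c by rewrite /serve xc.
  by exists (x :: d); rewrite /= !e xc /= add0n h1; split.
have [v [hv vY]] : exists v, (#|` c| < k) || (v \in c) /\ ((v \in c) ==> (v \notin Y)).
  case: (ltnP #|` c| k) => clt; first by exists x; rewrite (negbTE xc).
  have [e|/fset0Pn[v]] := eqVneq (c `\` Y) fset0; last first.
    by rewrite !inE => /andP[vY vc]; exists v; rewrite vc vY orbT.
  have cY : c `<=` Y `\ x.
    by rewrite fsubsetD1 xc andbT -fsetD_eq0 e.
  by have := fsubset_leq_card cY; have := cardfsD1 x Y; rewrite xY; lia.
set c1 := serve k c x v.
have c1k : #|` c1| <= k by apply: card_serve => //; rewrite (negbTE xc).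
have e1 : Y `\` c = x |` (Y `\` c1).
  apply/fsetP => z; rewrite /c1 /serve (negbTE xc) !inE.
  case: (eqVneq z x) => [->|zx] /=; first by rewrite xc xY.
  case: ifP => _; rewrite !inE (negbTE zx) //=.
  case: (eqVneq z v) => [->|//] /=.
  by case: (boolP (v \in c)) vY => /= vc; [move/negbTE-> |rewrite ?andbT].
have e2 : #|` Y `\` c| = #|` Y `\` c1|.+1.
  by rewrite e1 cardfsU1 !inE serve_in.
have e3 : #|` c1| = k \/ #|` c1| = #|` c|.+1.
  rewrite /c1 /serve (negbTE xc); case: ltnP hv => clt /= hv; rewrite cardfsU1 ?inE (negbTE xc) ?andbF.
    by right.
  by left; have := cardfsD1 v c; rewrite hv; lia.
have e4 : #|` c| <= #|` c1| by case: e3; lia.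
have [d [h1 h2 h3 h4 h5]] := IH c1 c1k sY'.
exists (v :: d); rewrite /= -/c1 (negbTE xc) /= h1 hv e2; split=> //; lia.
Qed.

(** The sizes of the caches on both sides telescope over successive segments, so filling the cache
    is paid once, with at most [k] faults. Once the cache is full, a segment costs at most [g], the
    number of pages of [X] that are missing from it. *)
Lemma offline_segment_in k g c s X : 0 < k -> #|` c| <= k -> c `<=` X ->
    #|` X| <= k + g -> #|` fset_of s| <= k -> {subset s <= X} ->
  exists d, let c' := after k c (zip s d) in
  [/\ size d = size s, legal k c (zip s d), c' `<=` X, #|` c'| <= k &
      faults k c (zip s d) + #|` c| <= g + #|` c'|].
Proof.
move=> k0 ck cX Xk sk sX.
have [|d [h1 h2 h3 h4 h5]] := @offline_segment k c s (fset_of s) k0 ck sk.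
  by move=> z; rewrite in_fset_of.
exists d; split=> //.
  by apply: after_sub => // z; rewrite unzip1_zip ?h1 // => /sX.
case: h5 => h5; last by lia.
have : fset_of s `\` c `<=` X `\` c.
  by apply: fsetSD; apply/fsubsetP => z; rewrite in_fset_of => /sX.
move=> /fsubset_leq_card; rewrite [#|` X `\` c|]cardfsD.
have -> : X `&` c = c by apply/fsetIidPr.
by have := fsubset_leq_card cX; lia.
Qed.

Definition onlcache k (A : online V) s := after k fset0 (schedule A s).

(** The schedule of [t] when [s] has been requested before; the victims depend on that history. *)
Definition rest (A : online V) (s t : seq V) := zip t [seq A (s ++ take i.+1 t) | i <- iota 0 (size t)].

Lemma schedule_cat (A : online V) (s t : seq V) : schedule A (s ++ t) = schedule A s ++ rest A s t.
Proof.
rewrite /schedule /rest size_cat iotaD map_cat zip_cat ?size_map ?size_iota //.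
congr (zip _ _ ++ zip _ _).
  apply/eq_in_map => i; rewrite mem_iota => /andP[_ hi].
  rewrite takel_cat //; lia.
rewrite add0n -[X in iota X _]addn0 iotaDl -map_comp; apply: eq_map => i /=.
by rewrite take_cat ltnNge -addnS leq_addr /= addKn.
Qed.

Lemma cost_cat k (A : online V) (s t : seq V) :
  cost k A (s ++ t) = cost k A s + faults k (onlcache k A s) (rest A s t).
Proof. by rewrite /cost schedule_cat faults_cat. Qed.

Lemma unzip1_rest (A : online V) (s t : seq V) : unzip1 (rest A s t) = t.
Proof. by rewrite unzip1_zip // size_map size_iota. Qed.

Lemma cost_ge k (A : online V) (s t : seq V) :
  cost k A s + #|` fset_of t `\` onlcache k A s| <= cost k A (s ++ t).
Proof.
rewrite cost_cat leq_add2l.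
by have := faults_ge k (onlcache k A s) (rest A s t); rewrite unzip1_rest.
Qed.

End PagingBasics.

(** * Repetition of a round of the adversary *)

Section Competitive.
Variables (V : choiceType) (G : rel V) (k : nat) (A : online V) (q c0 : nat).
Hypothesis k0 : 0 < k.
Hypothesis Alegal : online_legal k A.
Hypothesis comp : forall s, s \in paths G -> cost k A s <= q * OPT k s + c0.

(** One round forces [F] faults on the online algorithm and costs an offline strategy whose cache
    stays inside [X] only [g]. Enough repetitions outweigh [c0] and the cost of filling the
    cache. *)
Lemma online_phases (X : {fset V}) g F x0 : x0 \in X -> #|` X| <= k + g ->
  (forall s, s != [::] -> s \in paths G -> {subset s <= X} -> exists t,
     [/\ s ++ t \in paths G, {subset t <= X}, #|` fset_of t| <= k &
         cost k A s + F <= cost k A (s ++ t)]) ->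
  F <= q * g.
Proof.
move=> x0X Xk H.
have step n : exists s d, let c := after k fset0 (zip s d) in
   [/\ [/\ s != [::], s \in paths G & {subset s <= X}],
    size d = size s, legal k fset0 (zip s d), n * F <= cost k A s &
    [/\ c `<=` X, #|` c| <= k & faults k fset0 (zip s d) <= n * g + #|` c|]].
  elim: n => [|n [s [d [[s0 sG sX] sd ld nF [cX ck fd]]]]].
    exists [:: x0], [:: x0]; split=> //=.
    - by split=> // z; rewrite inE => /eqP->.
    - by rewrite k0.
    - by rewrite /serve inE cardfs0 k0 fsetU0; split; rewrite ?fsub1set ?cardfs1.
  have [t [stG tX tk Ft]] := H s s0 sG sX.
  have [d' [h1 h2 h3 h4 h5]] := offline_segment_in k0 ck cX Xk tk tX.
  exists (s ++ t), (d ++ d'); rewrite zip_cat // after_cat legal_cat ld h2 faults_cat.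
  split=> //; last 2 first.
  - by rewrite mulSn addnC (leq_trans _ Ft) // leq_add2r.
  - split=> //; rewrite mulSn; move: fd h5.
    move: (faults _ _ _) (faults _ _ _) #|` _| #|` _| (n * g) => a b a' b' ng.
    clear; lia.
  - split=> //; first by case: (s) s0.
    by move=> z; rewrite mem_cat => /orP[/sX|/tX].
  - by rewrite !size_cat sd h1.
rewrite leqNgt; apply/negP => qF.
(* If [F] exceeded [q * g], each round would leave a surplus of one fault; this number of rounds
   beats [q * k + c0], where [k] bounds the cost of filling the offline cache. *)
have [s [d [[s0 sG sX] sd ld nF [cX ck fd]]]] := step (q * k + c0).+1.
have [_ [_ _ _ /(_ d sd ld) hO]] := OPT_spec s k0.
have h1 := comp sG.
have h2 : q * OPT k s <= q * ((q * k + c0).+1 * g + k).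
  by rewrite leq_mul2l; apply/orP; right; lia.
have h3 : (q * k + c0).+1 * (q * g).+1 <= (q * k + c0).+1 * F by rewrite leq_mul2l qF orbT.
move: h2 h3; rewrite mulnDr mulnCA [_ * (q * g).+1]mulnS; lia.
Qed.

End Competitive.

(* The number of halvings that bring u below g. *)
Definition lev g u := if u < g then 0 else (trunc_log 2 (u %/ g)).+1.

Lemma lev_mono g u v : u <= v -> lev g u <= lev g v.
Proof.
move=> uv; rewrite /lev; case: (ltnP u g) => // gu.
case: (ltnP v g) => [|_]; first lia.
by rewrite ltnS leq_trunc_log // leq_div2r.
Qed.

Lemma lev_anti g h u : 0 < h -> h <= g -> lev g u <= lev h u.
Proof.
move=> h0 hg; rewrite /lev; case: (ltnP u g) => // gu.
case: (ltnP u h) => [|_]; first lia.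
by rewrite ltnS leq_trunc_log // leq_div2l.
Qed.

Lemma lev_half g u : 0 < g -> lev g u <= (lev g u./2).+1.
Proof.
move=> g0; rewrite /lev; case: (ltnP u g) => // gu.
case: (ltnP u./2 g) => hu.
  have : u %/ g < 2 by rewrite ltn_divLR // mul2n; lia.
  by case: (u %/ g) => [|[|]] // _; rewrite ?trunc_log0 ?trunc_log1.
have -> : u./2 %/ g = (u %/ g)./2 by rewrite -!divn2 -!divnMA mulnC.
have : 1 < u %/ g by rewrite leq_divRL // ; lia.
by move=> /trunc_log2S ->.
Qed.

Lemma lev_half_le g u v : 0 < g -> u./2 <= v -> lev g u <= (lev g v).+1.
Proof. by move=> g0 uv; apply: leq_trans (lev_half u g0) _; rewrite ltnS lev_mono. Qed.

Lemma lev_gt0 g u : (0 < lev g u) = (g <= u).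
Proof. by rewrite /lev leqNgt; case: (ltnP u g). Qed.

(** From level 4 on, a loss of two levels leaves at least half of the gain. *)
Lemma lev_ge4 g u : 0 < g -> 10 * g <= u -> 4 <= lev g u.
Proof.
move=> g0 gu; rewrite /lev; case: (ltnP u g) => [|_]; first lia.
have h : 10 <= u %/ g by rewrite leq_divRL.
by rewrite ltnS; apply: leq_trans (leq_trunc_log 2 h).
Qed.

Lemma lev11 : lev 1 1 = 1. Proof. by []. Qed.

(** * Lower bounds for competitive algorithms *)

Section VineBound.
Variables (V : choiceType) (G : rel V) (k : nat) (A : online V) (q c0 : nat).
Hypothesis Gsym : symmetric G.
Hypothesis k0 : 0 < k.
Hypothesis Alegal : online_legal k A.
Hypothesis comp : forall s, s \in paths G -> cost k A s <= q * OPT k s + c0.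

Definition step : rel V := fun u v => (u == v) || G u v.

Lemma step_sym : symmetric step.
Proof. by move=> u v; rewrite /step eq_sym Gsym. Qed.

Lemma step_refl u : step u u. Proof. by rewrite /step eqxx. Qed.

Lemma paths_cat x s t : s != [::] ->
  (s ++ t \in paths G) = (s \in paths G) && path step (last x s) t.
Proof. by case: s => [//|a s] _; rewrite -!topredE /= /paths /= cat_path. Qed.

Definition levs g (D : seq (seq V)) := \sum_(s <- D) lev g (size s).

Lemma levs_perm g D D' : perm_eq D D' -> levs g D = levs g D'.
Proof. exact: perm_big. Qed.

Lemma levs_cons g s D : levs g (s :: D) = lev g (size s) + levs g D.
Proof. by rewrite /levs big_cons. Qed.

Let notc (c : {fset V}) := [pred v | v \notin c].

Lemma count_holes (c : {fset V}) (L : seq V) : uniq L ->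
  size L <= count (notc c) L + #|` c|.
Proof.
move=> uL; rewrite -(count_predC (mem c) L) addnC.
have -> : count (predC (mem c)) L = count (notc c) L by apply: eq_count.
rewrite leq_add2l -size_filter; apply: uniq_leq_size; first exact: filter_uniq.
by move=> v; rewrite mem_filter => /andP[].
Qed.

Lemma count_le_card (c : {fset V}) (L t : seq V) : uniq L -> {subset L <= t} ->
  count (notc c) L <= #|` fset_of t `\` c|.
Proof.
move=> uL sL; rewrite -size_filter -card_fset_of ?filter_uniq //.
apply: fsubset_leq_card; apply/fsubsetP => v.
by rewrite in_fset_of mem_filter !inE => /andP[-> /sL].
Qed.

Lemma count_flatten_lt (P : pred V) D f :
  {in D, forall s, count P (take (size s)./2 s) < f /\ count P (drop (size s)./2 s) < f} ->
  count P (flatten D) <= 2 * size D * (f - 1).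
Proof.
elim: D => [|s D IH] // h.
have [|h1 h2] := h s; first by rewrite inE eqxx.
have /IH {IH} : {in D, forall s, count P (take (size s)./2 s) < f /\ count P (drop (size s)./2 s) < f}.
  by move=> s' s'D; apply: h; rewrite inE s'D orbT.
rewrite /= count_cat mulnS mulnDl => IH.
have : count P s = count P (take (size s)./2 s) + count P (drop (size s)./2 s).
  by rewrite -count_cat cat_take_drop.
move=> ->; apply: leq_add IH; move: h1 h2; move: (count _ _) (count _ _) => a b ha hb; clear -ha hb; lia.
Qed.

(** At least [g] pages are missing from the cache. With fewer than [f] of them in the core and in
    each half of a vine, their number would be below [g] by the second hypothesis. So a round costs
    [f] faults: either the core is toured, or a half of a vine with [f] missing pages is walked from
    its end and joins the core, at the price of one level. As long as a level is left, a vine of at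
    least [g] pages lies outside the core, so all requests stay within [k] pages. *)
Lemma vine_game g f n K D x s : 0 < g -> (2 * size D + 1) * (f - 1) < g ->
    vstruct step K D -> #|` vverts K D| = k + g -> n < levs g D ->
    s != [::] -> s \in paths G -> last x s \in K ->
  exists t Kf, [/\ s ++ t \in paths G, {subset t <= Kf},
     K `<=` Kf /\ Kf `<=` vverts K D,
     #|` Kf| <= k & cost k A s + f * n <= cost k A (s ++ t)].
Proof.
move=> g0; elim: n K D s => [|n IH] K D s fg st cardX nL s0 sG lK.
  exists [::], K; rewrite cats0 muln0 addn0; split=> //.
    by split=> //; apply/fsubsetP => v vK; rewrite !inE vK.
  have : has (fun s => g <= size s) D.
    apply: contraLR nL => /hasPn h; rewrite -leqNgt leqn0 /levs big_seq big1 // => s' s'D.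
    by apply/eqP; rewrite -leqn0 leqNgt lev_gt0 h.
  case/hasP => s' s'D gs'.
  move: cardX; rewrite (card_vverts st).
  rewrite (perm_size (perm_flatten (perm_to_rem s'D))) /= size_cat.
  by move: gs'; clear; lia.
pose c := onlcache k A s.
have ck : #|` c| <= k by apply: card_after.
have [cK uD nK vD] := st.
(* A prefix of a vine is a suffix of the reversed vine, hence the two alternatives for [D]. *)
have suffix (s1 s2 : seq V) D' : perm_eq D ((s1 ++ s2) :: D') \/ perm_eq D (rev (s1 ++ s2) :: D') ->
    (size (s1 ++ s2))./2 <= size s1 -> f <= count (notc c) s2 ->
    exists t Kf, [/\ s ++ t \in paths G, {subset t <= Kf},
     K `<=` Kf /\ Kf `<=` vverts K D,
     #|` Kf| <= k & cost k A s + f * n.+1 <= cost k A (s ++ t)].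
  move=> hperm hs hf.
  have [st' eX eL eS] : [/\ vstruct step K ((s1 ++ s2) :: D'),
      vverts K D = vverts K ((s1 ++ s2) :: D'),
      levs g D = levs g ((s1 ++ s2) :: D') & size D = (size D').+1].
    case: hperm => hp; first by rewrite (vverts_perm K hp) (levs_perm g hp) (perm_size hp); split=> //; exact: vstruct_perm hp st.
    rewrite (vverts_perm K hp) (levs_perm g hp) (perm_size hp) vverts_rev !levs_cons size_rev; split=> //.
    by rewrite -[s1 ++ s2]revK; apply: vstruct_rev (vstruct_perm hp st); exact: step_sym.
  have [_ u' _ v'] := st'.
  have [|x0 [y [xK yK]]] := v' (s1 ++ s2); first by rewrite inE eqxx.
  rewrite rcons_cat cat_path => /andP[_ p2].
  have py : path step y (rev s2).
    have : path step y (rcons (rev s2) (last x0 s1)) by rewrite (path_rev_rcons step_sym).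
    by rewrite rcons_path => /andP[].
  have [p [pp lp pK]] := cK _ _ lK yK.
  pose t := p ++ rev s2.
  have tK : {subset t <= K `|` fset_of s2}.
    move=> v; rewrite !inE mem_cat mem_rev => /orP[vp|->]; last by rewrite orbT.
    by rewrite pK // inE vp orbT.
  have stG : s ++ t \in paths G by rewrite (paths_cat x) // sG cat_path pp lp.
  have us2 : uniq s2 by move: u'; rewrite /= -catA uniq_catCA cat_uniq => /andP[].
  have ct : cost k A s + f <= cost k A (s ++ t).
    apply: leq_trans (cost_ge k A s t); rewrite leq_add2l.
    apply: leq_trans hf _; apply: count_le_card => // v.
    by rewrite mem_cat mem_rev orbC => ->.
  have st2 := vstruct_absorb step_sym st'.
  have [||||||| t' [Kf [h1 h2 [h3 h4] h5 h6]]] := IH (K `|` fset_of s2) (s1 :: D') (s ++ t).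
  - by rewrite eS in fg.
  - exact: st2.
  - by rewrite vverts_absorb -eX.
  - move: nL (lev_half_le g0 hs); rewrite eL !levs_cons.
    by move: (lev _ _) (lev _ _) (levs _ _) => a b d; clear; lia.
  - by case: (s) s0.
  - exact: stG.
  - rewrite last_cat /t last_cat lp !inE.
    by have := mem_last y (rev s2); rewrite inE mem_rev => /orP[/eqP->|->]; rewrite ?yK ?orbT.
  exists (t ++ t'), Kf; split; first by rewrite catA.
  - by move=> v; rewrite mem_cat => /orP[/tK/(fsubsetP h3)|/h2].
  - by split; [apply: fsubset_trans h3; exact: fsubsetUl|rewrite eX -vverts_absorb].
  - exact: h5.
  - rewrite catA mulnS; move: h6 ct; clear.
    by move: (cost _ _ _) (cost _ _ _) (cost _ _ _) => a b d; lia.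
case: (leqP f (count (notc c) (enum_fset K))) => fK.
  have [t [pt tK Kt]] := conn_tour cK lK.
  pose t1 := last x s :: t.
  have t1K : {subset t1 <= K} by move=> v; rewrite inE => /orP[/eqP->|/tK].
  have stG : s ++ t1 \in paths G by rewrite (paths_cat x) // sG /= step_refl.
  have ct : cost k A s + f <= cost k A (s ++ t1).
    apply: leq_trans (cost_ge k A s t1); rewrite leq_add2l.
    by apply: leq_trans fK _; apply: count_le_card.
  have [||||||| t' [Kf [h1 h2 [h3 h4] h5 h6]]] := IH K D (s ++ t1) => //.
  - exact: ltnW.
  - by case: (s) s0.
  - by rewrite last_cat /=; have := mem_last (last x s) t; exact: t1K.
  exists (t1 ++ t'), Kf; split; rewrite ?catA //.
  - by move=> v; rewrite mem_cat => /orP[/t1K/(fsubsetP h3)|/h2].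
  - rewrite mulnS; move: h6 ct; clear.
    by move: (cost _ _ _) (cost _ _ _) (cost _ _ _) => a b d; lia.
have [/hasP[s' s'D /orP h]|/hasPn h] := boolP (has (fun s' =>
    (f <= count (notc c) (take (size s')./2 s')) || (f <= count (notc c) (drop (size s')./2 s'))) D).
  have hp := perm_to_rem s'D; case: h => h.
    apply: (suffix (rev (drop (size s')./2 s')) (rev (take (size s')./2 s')) (rem s' D)).
    - by right; rewrite rev_cat !revK cat_take_drop.
    - by rewrite size_cat !size_rev size_take size_drop; move: (size s') => N; clear; case: ltnP; lia.
    - by rewrite count_rev.
  apply: (suffix (take (size s')./2 s') (drop (size s')./2 s') (rem s' D)) => //.
  - by left; rewrite cat_take_drop.
  - by rewrite cat_take_drop size_take; move: (size s') => N; clear; case: ltnP; lia.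
exfalso.
have h' : {in D, forall s, count (notc c) (take (size s)./2 s) < f /\ count (notc c) (drop (size s)./2 s) < f}.
  by move=> s' /h; rewrite negb_or -!ltnNge => /andP[].
have := count_flatten_lt h'.
have uL : uniq (enum_fset K ++ flatten D).
  rewrite cat_uniq fset_uniq uD andbT /=; apply/hasPn => v /nK; exact.
have := count_holes c uL; rewrite count_cat size_cat.
have hK : #|` K| + size (flatten D) = k + g by rewrite -(card_vverts st).
rewrite -[size (enum_fset K)]/#|` K| hK.
move: fg fK (count_flatten_lt h') ck; rewrite mulnDl mul1n.
move: (2 * _ * _) (count _ _) (count _ _) #|` _| => a b b' d; clear; lia.
Qed.

(** Of the two levels given up, one keeps a vine of [g] pages outside the core up to the end. The
    other is spent at the beginning when the current page lies inside a vine: that page and the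
    shorter side of it are absorbed by the core. *)
Theorem vine_bound g f K D : 0 < g -> (2 * size D + 1) * (f - 1) < g ->
    vstruct step K D -> K != fset0 -> #|` vverts K D| = k + g ->
  f * (levs g D - 2) <= q * g.
Proof.
move=> g0 fg st /fset0Pn[z zK] cardX.
apply: (@online_phases V G k A q c0 k0 comp (vverts K D) g _ z); rewrite ?cardX //.
  by rewrite !inE zK.
move=> s s0 sG sX.
have [lv|lv] := leqP (levs g D) 2.
  exists [::]; rewrite cats0; split=> //; first by rewrite card_fset_of.
  by rewrite (eqP lv) muln0 addn0.
have lX : last z s \in vverts K D.
  by apply: sX; case: (s) s0 => //= a l _; exact: mem_last.
have game K' D' : size D' = size D -> vstruct step K' D' -> vverts K' D' = vverts K D ->
   levs g D <= (levs g D').+1 -> last z s \in K' -> exists t,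
     [/\ s ++ t \in paths G, {subset t <= vverts K D}, #|` fset_of t| <= k
       & cost k A s + f * (levs g D - 2) <= cost k A (s ++ t)].
  move=> eS st' eX hL lK'.
  have [|||t [Kf [h1 h2 [h3 h4] h5 h6]]] := @vine_game g f (levs g D - 2) K' D' z s g0 _ st' _ _ s0 sG lK'.
  - by rewrite eS.
  - by rewrite eX.
  - by move: lv hL; clear; lia.
  exists t; split=> //.
  - by move=> v /h2; rewrite -eX; apply: (fsubsetP h4).
  - apply: leq_trans h5; apply: fsubset_leq_card; apply/fsubsetP => v.
    by rewrite in_fset_of => /h2.
have [lK|lK] := boolP (last z s \in K); first exact: (game K D).
have /flattenP[s' s'D ls'] : last z s \in flatten D.
  by move: lX; rewrite !inE (negbTE lK).
have hp := perm_to_rem s'D.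
have cut (s1 s2 : seq V) : (s' = s1 ++ last z s :: s2 \/ s' = rev (s1 ++ last z s :: s2)) ->
   size s2 <= size s1 -> exists t,
     [/\ s ++ t \in paths G, {subset t <= vverts K D}, #|` fset_of t| <= k
       & cost k A s + f * (levs g D - 2) <= cost k A (s ++ t)].
  move=> e hs.
  have [st' eX] : vstruct step K ((s1 ++ last z s :: s2) :: rem s' D) /\
      vverts K ((s1 ++ last z s :: s2) :: rem s' D) = vverts K D.
    have st1 := vstruct_perm hp st.
    case: e => e; first by rewrite -e (vverts_perm K hp).
    rewrite (vverts_perm K hp) -[s1 ++ _]revK -e vverts_rev; split=> //.
    by apply: vstruct_rev st1; exact: step_sym.
  apply: (game (K `|` fset_of (last z s :: s2)) (s1 :: rem s' D)).
  - by rewrite (perm_size hp).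
  - by move: st' => /(vstruct_absorb step_sym).
  - by rewrite vverts_absorb.
  - rewrite (levs_perm g hp) !levs_cons -addSn leq_add2r.
    apply: lev_half_le => //.
    have -> : size s' = size s1 + (size s2).+1 by case: e => ->; rewrite ?size_rev size_cat.
    by move: hs; move: (size _) (size _) => a b; clear; lia.
  - by rewrite !inE eqxx orbT.
have [s1 [s2 e]] : exists s1 s2, s' = s1 ++ last z s :: s2.
  by move: ls'; clear; case/splitPr => s1 s2; exists s1, s2.
have [h|h] := leqP (size s2) (size s1); first by apply: (cut s1 s2) => //; left.
apply: (cut (rev s2) (rev s1)); last by rewrite !size_rev ltnW.
by right; rewrite [LHS]e rev_cat rev_cons !revK cat_rcons.
Qed.

End VineBound.

(** * Trees with many leaves *)

Section Leafy.
Variables (V : choiceType) (E : rel V).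
Hypothesis Esym : symmetric E.
Implicit Types (W K : {fset V}) (a v y z : V) (n : nat) (s : seq V).

(* That is, W has a spanning tree with at least n leaves. *)
Definition leafy W n := exists K,
  [/\ K `<=` W, K != fset0, conn E K, {in W `\` K, forall v, exists2 u, u \in K & E u v} &
      n <= #|` W `\` K|].

Lemma leafy_conn W : W != fset0 -> conn E W -> leafy W 0.
Proof. by move=> W0 cW; exists W; split=> // v; rewrite fsetDv inE. Qed.

(** If [a] is a leaf, it becomes an inner vertex and [v] takes its place as a leaf. *)
Lemma leafy_grow W n a v : leafy W n -> a \in W -> E a v -> v \notin W ->
  leafy (v |` W) n.
Proof.
move=> [K [KW K0 cK dom nK]] aW Eav vW.
have vK : v \notin K by apply: contra vW; exact: (fsubsetP KW).
have [aK|aK] := boolP (a \in K).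
  exists K; split=> //.
  - by apply: fsubset_trans KW _; exact: fsubsetUr.
  - move=> u; rewrite !inE => /andP[uK /orP[/eqP->|uW]]; first by exists a.
    by apply: dom; rewrite !inE uK.
  - apply: leq_trans nK _; apply: fsubset_leq_card; apply/fsubsetP => u.
    by rewrite !inE => /andP[-> ->]; rewrite orbT.
have [b bK Eba] : exists2 u, u \in K & E u a by apply: dom; rewrite !inE aK.
exists (a |` K); split=> //.
- by apply/fsubsetP => u; rewrite !inE => /orP[/eqP->|/(fsubsetP KW)->]; rewrite ?aW orbT.
- by apply/fset0Pn; exists a; rewrite !inE eqxx.
- exact: conn_add1 bK Eba.
- move=> u; rewrite !inE negb_or => /andP[/andP[ua uK] /orP[/eqP->|uW]].
    by exists a; rewrite // !inE eqxx.
  by have [|w wK Ewu] := dom u; rewrite ?inE ?uK //; exists w; rewrite // !inE wK orbT.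
have -> : (v |` W) `\` (a |` K) = v |` (W `\` K `\ a).
  apply/fsetP => u; rewrite !inE negb_or.
  case: (eqVneq u v) => [->|_] /=; last by rewrite andbA.
  by rewrite vK !andbT; apply: (contraNneq _ vW) => ->.
rewrite cardfsU1 !inE (negbTE vW) !andbF /=.
by have := cardfsD1 a (W `\` K); rewrite !inE aK aW /=; move: nK; clear; lia.
Qed.

Lemma leafy_grows W n a s : leafy W n -> a \in W -> path E a s ->
  leafy (W `|` fset_of s) n.
Proof.
elim: s W a => [|v s IH] W a lW aW /=; first by have -> : W `|` fset_of [::] = W by apply/fsetP => z; rewrite !inE orbF.
move=> /andP[Eav ps].
have -> : W `|` fset_of (v :: s) = (v |` W) `|` fset_of s.
  by apply/fsetP => z; rewrite !inE; case: (z == v); rewrite ?orbT.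
apply: (IH _ v) => //; last by rewrite !inE eqxx.
have [vW|vW] := boolP (v \in W); last exact: leafy_grow aW Eav vW.
by have -> : v |` W = W by apply/fsetUidPr; rewrite fsub1set.
Qed.

(** When [v] is a leaf of the tree on [W] enlarged by [v], it becomes an inner vertex with the two
    new leaves [y] and [z], a net gain of one. *)
Lemma leafy_fork W n a v y z : leafy W n -> a \in W -> E a v -> E v y -> E v z ->
  v \notin W -> y \notin W -> z \notin W -> y != v -> z != v -> y != z ->
  leafy (z |` (y |` (v |` W))) n.+1.
Proof.
move=> lW aW Eav Evy Evz vW yW zW yv zv yz.
have [K [KW K0 cK dom nK]] := leafy_grow lW aW Eav vW.
have yW' : y \notin v |` W by rewrite !inE (negbTE yv).
have zW' : z \notin v |` W by rewrite !inE (negbTE zv).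
have [vK|vK] := boolP (v \in K).
  exists K; split=> //.
  - by apply: fsubset_trans KW _; rewrite fsetUA; exact: fsubsetUr.
  - move=> u; rewrite in_fsetD in_fset1U in_fset1U => /andP[uK].
    by case/or3P => [/eqP->|/eqP->|uW]; [exists v|exists v|apply: dom; rewrite in_fsetD uK].
  apply: leq_trans (_ : #|` y |` ((v |` W) `\` K)| <= _).
    by rewrite cardfsU1 in_fsetD (negbTE yW') andbF /=; move: nK; clear; lia.
  apply: fsubset_leq_card; apply/fsubsetP => u; rewrite in_fset1U !in_fsetD !in_fset1U.
  case/orP => [/eqP->|/andP[-> /orP[]->]]; rewrite ?eqxx ?orbT ?andbT //.
  by apply: contra yW'; exact: (fsubsetP KW).
have [b bK Ebv] : exists2 u, u \in K & E u v by apply: dom; rewrite !inE vK eqxx.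
exists (v |` K); split=> //.
- apply/fsubsetP => u; rewrite !in_fset1U => /orP[->|/(fsubsetP KW)]; rewrite ?orbT //.
  by rewrite in_fset1U => ->; rewrite !orbT.
- by apply/fset0Pn; exists v; rewrite !inE eqxx.
- exact: conn_add1 bK Ebv.
- move=> u; rewrite in_fsetD !in_fset1U negb_or => /andP[/andP[uv uK]].
  case/or4P => [/eqP->|/eqP->|/eqP e|uW].
  + by exists v => //; rewrite !inE eqxx.
  + by exists v => //; rewrite !inE eqxx.
  + by rewrite e eqxx in uv.
  have [|w wK Ewu] := dom u; first by rewrite in_fsetD uK in_fset1U uW orbT.
  by exists w; rewrite // in_fset1U wK orbT.
have yK : y \notin K by apply: contra yW'; exact: (fsubsetP KW).
have zK : z \notin K by apply: contra zW'; exact: (fsubsetP KW).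
apply: leq_trans (_ : #|` z |` (y |` ((v |` W) `\` K `\ v))| <= _).
  rewrite !cardfsU1 !in_fset1U !in_fsetD1 !in_fsetD (negbTE zW') (negbTE yW') !andbF orbF eq_sym yz /=.
  by have := cardfsD1 v ((v |` W) `\` K); rewrite in_fsetD vK in_fset1U eqxx /=; move: nK; clear; lia.
apply: fsubset_leq_card; apply/fsubsetP => u; rewrite !in_fset1U !in_fsetD !in_fset1U in_fset1 negb_or.
case/or3P => [/eqP->|/eqP->|/and3P[-> -> /orP[]->]]; rewrite ?eqxx ?orbT ?andbT //.
  by rewrite zv.
by rewrite yv.
Qed.

(** The leaf bound speaks of exactly [k + 1] pages; a smaller tree is enlarged to that size inside a
    connected set without losing leaves. *)
Lemma leafy_extend W X n m : leafy W n -> W `<=` X -> conn E X -> #|` W| <= m <= #|` X| ->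
  exists W', [/\ leafy W' n, W' `<=` X & #|` W'| = m].
Proof.
move=> lW WX cX /andP[Wm mX].
move eN : (m - #|` W|) => N; elim: N W lW WX Wm eN => [|N IH] W lW WX Wm eN.
  by exists W; split=> //; move: Wm eN; clear; lia.
have [x xW] : exists x, x \in W.
  have [K [KW /fset0Pn[x xK] _ _ _]] := lW.
  by exists x; exact: (fsubsetP KW).
have [y yX yW] : exists2 y, y \in X & y \notin W.
  have : ~~ (X `<=` W) by apply/negP => /fsubset_leq_card; move: mX eN; clear; lia.
  by case/fsubsetPn => y; exists y.
have [p [pp lp pX]] := cX _ _ (fsubsetP WX _ xW) yX.
have [a [v [aW vW vX Eav]]] : exists a v, [/\ a \in W, v \notin W, v \in X & E a v].
  elim: p x xW pp lp pX => [|v p IHp] x xW /=; first by move=> _ e; rewrite -e xW in yW.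
  move=> /andP[Exv pp] lp pX; have [vW|vW] := boolP (v \in W).
    by apply: (IHp v vW pp lp) => z zp; apply: pX; rewrite inE zp orbT.
  by exists x, v; split=> //; apply: pX; rewrite !inE eqxx orbT.
have c1 : #|` v |` W| = #|` W|.+1 by rewrite cardfsU1 vW.
apply: (IH (v |` W)); rewrite ?c1.
- exact: leafy_grow aW Eav vW.
- by rewrite fsubUset fsub1set vX.
- by move: eN; clear; lia.
- by move: eN; clear; lia.
Qed.

End Leafy.

(** * The two lower bounds on the ratio of the competitor *)

Section Bounds.
Variables (V : choiceType) (G : rel V) (k : nat) (A : online V) (q c0 : nat).
Hypothesis Gsym : symmetric G.
Hypothesis k0 : 0 < k.
Hypothesis Alegal : online_legal k A.
Hypothesis comp : forall s, s \in paths G -> cost k A s <= q * OPT k s + c0.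

Notation E := (step G).
Let Esym := step_sym Gsym.

(** Each leaf is a vine of one page, which has level 1 at scale 1. For [g = f = 1] the condition of
    [vine_bound] holds whatever the number of vines. *)
Theorem leafy_bound W n : #|` W| = k.+1 -> leafy E W n -> n <= q + 2.
Proof.
move=> cW [K [KW K0 cK dom nK]].
pose D := [seq [:: v] | v <- enum_fset (W `\` K)].
have fD : flatten D = enum_fset (W `\` K) by rewrite /D; elim: (enum_fset _) => //= v s ->.
have st : vstruct E K D.
  split=> //; rewrite ?fD ?fset_uniq //.
    by move=> v; rewrite in_fsetE /=; case/andP.
  move=> s /mapP[v vW ->]; have [u uK Euv] := dom v vW.
  by exists u, u; rewrite /= Euv Esym Euv.
have eX : vverts K D = W.
  apply/fsetP => v; rewrite !inE fD; case: (boolP (v \in K)) => [/(fsubsetP KW)->//|vK] /=.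
  by rewrite in_fsetE /= vK.
have eL : levs 1 D = #|` W `\` K|.
  rewrite /levs /D big_map (eq_bigr (fun=> 1)) => [|v _]; last exact: lev11.
  by rewrite sum1_size.
have := @vine_bound V G k A q c0 Gsym k0 Alegal comp 1 1 K D.
rewrite muln0 mul1n muln1 eX eL cW addn1 => /(_ isT isT st K0 erefl).
by move: nK; clear; lia.
Qed.

Lemma vstruct_absorb_all K s D : vstruct E K (s :: D) ->
  vstruct E (K `|` fset_of (flatten D)) [:: s].
Proof.
elim: D K => [|s' D IH] K st.
  by have -> : K `|` fset_of (flatten [::]) = K by apply/fsetP => z; rewrite !inE orbF.
have -> : K `|` fset_of (flatten (s' :: D)) = (K `|` fset_of s') `|` fset_of (flatten D).
  by apply/fsetP => z; rewrite !inE /= orbA.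
apply: IH; apply: (vstruct_behead Esym).
apply: vstruct_perm st.
by rewrite -[s :: s' :: D]/([:: s] ++ [:: s'] ++ D) perm_catCA.
Qed.

Lemma fsetU_neq0 (K K' : {fset V}) : K != fset0 -> K `|` K' != fset0.
Proof. by case/fset0Pn=> x xK; apply/fset0Pn; exists x; rewrite inE xK. Qed.

(** The rate [f / g] of [vine_bound] gets worse with the number of vines, except for a surplus of
    one page, where [f = 1] serves any number of them. So a long vine [s] is used twice: as the only
    vine it has level at most [3 * q + 2], and as a reserve it gives up [h - 1] pages, after which
    the other vines live on [k + 1] pages and have [q + 2] levels in all. Vines shorter than [g]
    have level zero and join the core. *)
Theorem levs_bound g h K D : 0 < h -> h <= g -> vstruct E K D -> K != fset0 ->
  #|` vverts K D| = k + h -> levs g D <= 4 * q + 4.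
Proof.
move=> h0 hg; elim: D K => [|s D IH] K st K0 cX; first by rewrite /levs big_nil.
have [sg|gs] := ltnP (size s) g.
  rewrite levs_cons {1}/lev sg add0n; apply: (IH (K `|` fset_of s)).
  - exact: vstruct_behead Esym _ _ _ st.
  - exact: fsetU_neq0.
  - by rewrite vverts_behead.
have bs : lev g (size s) <= 3 * q + 2.
  apply: leq_trans (lev_anti _ h0 hg) _.
  (* The third of [h], rounded up, is the largest [f] with [3 * (f - 1) < h], the condition for a
     single vine. *)
  pose f := (h + 2) %/ 3.
  have f1 : 3 * f <= h + 2 by rewrite mulnC leq_trunc_div.
  have f2 : h <= 3 * f by have := divn_eq (h + 2) 3; have := ltn_pmod (h + 2) (isT : 0 < 3); rewrite -/f; clear; lia.
  have := @vine_bound V G k A q c0 Gsym k0 Alegal comp h f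
    (K `|` fset_of (flatten D)) [:: s] h0.
  rewrite /levs big_seq1 => /(_ _ (vstruct_absorb_all st) (fsetU_neq0 _ K0)).
  have -> : vverts (K `|` fset_of (flatten D)) [:: s] = vverts K (s :: D).
    by apply/fsetP => z; rewrite !inE /= orbF -!orbA; congr (_ || _); rewrite orbC.
  move=> /(_ _ cX) B.
  have {}B : f * (lev h (size s) - 2) <= q * h by apply: B; rewrite /=; move: f1 h0; clear; lia.
  have : h * (lev h (size s) - 2) <= h * (3 * q).
    apply: leq_trans (_ : 3 * f * (lev h (size s) - 2) <= _); first by rewrite leq_mul2r f2 orbT.
    by rewrite -mulnA [h * _]mulnCA [h * q]mulnC leq_mul2l B orbT.
  by rewrite leq_pmul2l // ; move: (lev _ _) => L; clear; lia.
rewrite levs_cons.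
suff : levs g D <= q + 2 by move: bs; move: (lev _ _) (levs _ _) => a b; clear; lia.
(* The pages of [s1] are discarded altogether, while [s2] joins the core by its other end. There are
   enough pages because [h <= g <= size s]. *)
pose s1 := take (h - 1) s; pose s2 := drop (h - 1) s.
have st1 : vstruct E K ((s1 ++ s2) :: D) by rewrite cat_take_drop.
have st2 := vstruct_absorb Esym st1.
have st3 : vstruct E (K `|` fset_of s2) D.
  have [c u n v] := st2; split=> //.
  - by move: u; rewrite /= cat_uniq => /and3P[].
  - by move=> z zD; apply: n; rewrite /= mem_cat zD orbT.
  - by move=> z zD; apply: v; rewrite inE zD orbT.
have cX3 : #|` vverts (K `|` fset_of s2) D| = k + 1.
  have := card_vverts st2; have := card_vverts st3; rewrite vverts_absorb cat_take_drop cX.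
  rewrite /= size_cat size_takel; last by move: gs hg; clear; lia.
  by move: gs hg h0; move: (size _) (size _) #|` _| #|` _| => a b c' d; clear; lia.
have := @vine_bound V G k A q c0 Gsym k0 Alegal comp 1 1 _ _ isT _ st3 (fsetU_neq0 _ K0) cX3.
rewrite muln0 mul1n muln1 => /(_ isT).
have : levs g D <= levs 1 D.
  by apply: leq_sum => i _; apply: lev_anti => //; apply: leq_trans hg.
by clear; lia.
Qed.

End Bounds.

(** * Chains and the splitting of gaps *)

Section Chains.
Variables (V : choiceType) (T : rel V).
Hypothesis Tsym : symmetric T.
Implicit Types (u v x y z : V) (s : seq V).

(* s is a path of vertices of degree 2, and x, y are the outer neighbours of
   its ends. *)
Fixpoint chain x s y : Prop :=
  if s is v :: s' then
    [/\ T x v, T v (head y s'), x != head y s',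
        forall u, T v u -> u = x \/ u = head y s' & chain v s' y]
  else True.

Lemma head_cat_cons y s1 v s2 : head y (s1 ++ v :: s2) = head v s1.
Proof. by case: s1. Qed.

Lemma chain_cat x s1 v s2 y : chain x (s1 ++ v :: s2) y <->
  chain x s1 v /\ chain (last x s1) (v :: s2) y.
Proof.
elim: s1 x => [|u s1 IH] x; first by split=> // -[].
rewrite cat_cons [chain x (u :: _) y]/= [chain x (u :: s1) v]/= head_cat_cons; split.
  by case=> h1 h2 h3 h4 /IH[h5 h6].
by case=> -[h1 h2 h3 h4 h5] h6; split=> //; apply/IH.
Qed.

Lemma chain_split x s1 v s2 y : chain x (s1 ++ v :: s2) y ->
  [/\ chain x s1 v, T (last x s1) v, T v (head y s2), last x s1 != head y s2 & chain v s2 y].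
Proof. by case/chain_cat => ? [? ? ? _ ?]. Qed.

Lemma chain_path x s y : s != [::] -> chain x s y -> path T x (rcons s y).
Proof.
elim: s x => // v s IH x _ [h1 h2 _ _ h5] /=; rewrite h1.
by case: s IH h2 h5 => [|u s] IH h2 h5 /=; [rewrite h2|exact: IH].
Qed.

Lemma chain_path1 x s y : chain x s y -> path T x s.
Proof.
have [->//|s0] := eqVneq s [::].
by move=> /(chain_path s0); rewrite rcons_path => /andP[].
Qed.

Lemma chain_nbr x s y z u : chain x s y -> z \in s -> T z u -> u \in x :: rcons s y.
Proof.
elim: s x => // v s IH x [_ _ _ h4 h5]; rewrite inE => /orP[/eqP-> /h4[]->|zs Tzu].
- by rewrite inE eqxx.
- by case: (s) => [|w s']; rewrite !inE eqxx ?orbT.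
by rewrite inE (IH v) ?orbT.
Qed.

Lemma chain_rcons x s v y : chain x (rcons s v) y <->
  [/\ chain x s v, T (last x s) v, T v y, last x s != y &
      forall u, T v u -> u = last x s \/ u = y].
Proof.
rewrite -cats1; split; first by case/chain_cat => ? [? ? ? ? _].
by case=> ? ? ? ? ?; apply/chain_cat.
Qed.

Lemma chain_rev x s y : chain x s y -> chain y (rev s) x.
Proof.
elim: s x => // v s IH x [h1 h2 h3 h4 h5]; rewrite rev_cons; apply/chain_rcons.
have -> : last y (rev s) = head y s by case: s {IH h2 h3 h4 h5} => // w s; rewrite rev_cons last_rcons.
split; [exact: IH|by rewrite Tsym|by rewrite Tsym|by rewrite eq_sym|].
by move=> u /h4[]; [right|left].
Qed.

End Chains.

(** * The process that splits gaps *)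

Section GapProcess.
Variables (V : choiceType).
Implicit Types (u v x y z : V) (s w : seq V) (L : seq (seq V)).

(** Here [n] is the size of the gap that is split and [m] that of its shorter side. For [g > 0] both
    quantities vanish at [m = 0], that is, when a gap is entered at an end. They account for the
    growth of the potential: in levels if both sides are long, in pages if a long gap gets a short
    side. *)
Definition incA g m := if 10 * g <= m then lev g m else 0.
Definition incB g n m := if (10 * g <= n) && (m < 10 * g) then m else 0.

(* run g L0 w L a b: visiting the vertices of w successively turns the family
   of gaps L0 into L; a and b collect the contributions of the visits that
   split a gap, which are nonzero only if the walk jumped into the gap. *)
Inductive run g L0 : seq V -> seq (seq V) -> nat -> nat -> Prop :=
| RunNil : run g L0 [::] L0 0 0
| RunOut w L a b v : run g L0 w L a b -> v \notin flatten L ->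
    run g L0 (rcons w v) L a b
| RunSplit w L a b s1 v s2 L' : run g L0 w L a b ->
    perm_eq L ((s1 ++ v :: s2) :: L') ->
    run g L0 (rcons w v) (s1 :: s2 :: L')
      (a + incA g (minn (size s1) (size s2)))
      (b + incB g (size (s1 ++ v :: s2)) (minn (size s1) (size s2))).

Variable T : rel V.

Definition gaps_ok L := uniq (flatten L) /\
  {in L, forall s, exists x y, [/\ x \notin flatten L, y \notin flatten L & chain T x s y]}.

Lemma flatten_split L s1 v s2 L' : perm_eq L ((s1 ++ v :: s2) :: L') ->
  perm_eq (flatten L) (v :: flatten (s1 :: s2 :: L')).
Proof.
move=> /perm_flatten/permPl->; rewrite /= -catA cat_cons.
by rewrite perm_catC /= perm_cons perm_catC.
Qed.

Lemma gaps_ok_perm L L' : perm_eq L L' -> gaps_ok L -> gaps_ok L'.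
Proof.
move=> pL [u h]; have pf := perm_flatten pL; split; first by rewrite -(perm_uniq pf).
move=> s; rewrite -(perm_mem pL) => /h[x [y]]; rewrite !(perm_mem pf) => ?.
by exists x, y.
Qed.

Lemma gaps_ok_split L s1 v s2 L' : perm_eq L ((s1 ++ v :: s2) :: L') ->
  gaps_ok L -> gaps_ok (s1 :: s2 :: L').
Proof.
move=> pL [u h]; have pf := flatten_split pL.
move: u; rewrite (perm_uniq pf) cons_uniq => /andP[vn u]; split=> //.
have sub z : z \notin flatten L -> z \notin flatten (s1 :: s2 :: L').
  by rewrite (perm_mem pf) inE negb_or => /andP[].
have [|x [y [xL yL /chain_split[c1 _ _ _ c2]]]] := h (s1 ++ v :: s2).
  by rewrite (perm_mem pL) inE eqxx.
move=> s; rewrite !inE => /or3P[/eqP->|/eqP->|sL].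
- by exists x, v; split=> //; exact: sub.
- by exists v, y; split=> //; exact: sub.
have [|x' [y' [xL' yL' c]]] := h s; first by rewrite (perm_mem pL) inE sL orbT.
by exists x', y'; split=> //; exact: sub.
Qed.

Lemma run_gaps_ok g L0 w L a b : gaps_ok L0 -> run g L0 w L a b -> gaps_ok L.
Proof. by move=> h; elim=> // *; apply: gaps_ok_split; eassumption. Qed.

Lemma run_subset g L0 w L a b : run g L0 w L a b -> {subset flatten L <= flatten L0}.
Proof.
elim=> // {}w {}L {}a {}b s1 v s2 L' _ IH /flatten_split pf z zL.
by apply: IH; rewrite (perm_mem pf) inE zL orbT.
Qed.

End GapProcess.

(** * The number of evictions that a gap process can force *)

Section Exchange.
Variables (V : choiceType) (G T : rel V).
Hypothesis Gsym : symmetric G.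
Notation E := (step G).
Hypothesis Tsym : symmetric T.
Hypothesis TE : subrel T E.
Implicit Types (u v x y z b : V) (s w W : seq V) (L D : seq (seq V)) (K : {fset V}).

Let Esym := step_sym Gsym.

(** Edges outside the tree count only away from the gaps, so a path inside the core enters and
    leaves a gap at its ends. This is what makes a gap in the core recoverable as a vine. *)
Definition gap_rel L u v := T u v || [&& E u v, u \notin flatten L & v \notin flatten L].

Lemma gap_rel_sym L : symmetric (gap_rel L).
Proof. by move=> u v; rewrite /gap_rel Tsym Esym [(u \notin _) && _]andbC. Qed.

Lemma gap_rel_mono L L' : {subset flatten L' <= flatten L} -> subrel (gap_rel L) (gap_rel L').
Proof.
move=> h u v; rewrite /gap_rel => /orP[->//|/and3P[-> uL vL]].
by rewrite !(contra (@h _)) ?orbT.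
Qed.

Lemma gap_rel_step L : subrel (gap_rel L) E.
Proof. by move=> u v /orP[/TE//|/and3P[]]. Qed.

Lemma sub_gap_rel L : subrel T (gap_rel L).
Proof. by move=> u v; rewrite /gap_rel => ->. Qed.

(* The vines D are not the gaps themselves: a gap may have been absorbed by the
   core, and a vine may contain several gaps. *)
Definition exch L K D :=
  [/\ conn (gap_rel L) K, uniq (flatten D), {in flatten D, forall v, v \notin K},
     {in D, forall W, W != [::] /\ exists x y,
        [/\ x \in K, y \in K, x \notin flatten L, y \notin flatten L & chain T x W y]} &
     {in L, forall s, {subset s <= K} \/
        exists2 W, W \in D & exists s1 s2, W = s1 ++ s ++ s2}].

Lemma exch_perm L K D D' : perm_eq D D' -> exch L K D -> exch L K D'.
Proof.
move=> pD [h1 h2 h3 h4 h5]; have pf := perm_flatten pD; split=> //.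
- by rewrite -(perm_uniq pf).
- by move=> v; rewrite -(perm_mem pf) => /h3.
- by move=> v; rewrite -(perm_mem pD) => /h4.
by move=> s /h5[?|[W WD ?]]; [left|right; exists W; rewrite -?(perm_mem pD)].
Qed.

Lemma exch_permL L L' K D : perm_eq L L' -> exch L K D -> exch L' K D.
Proof.
move=> pD [h1 h2 h3 h4 h5]; have pf := perm_flatten pD; split=> //.
- apply: conn_relW h1 => u v _ _; apply: gap_rel_mono => z.
  by rewrite -(perm_mem pf).
- by move=> W /h4[W0 [x [y]]]; rewrite !(perm_mem pf) => ?; split=> //; exists x, y.
by move=> s; rewrite -(perm_mem pD); exact: h5.
Qed.

Lemma exch_vstruct L K D : exch L K D -> vstruct E K D.
Proof.
move=> [h1 h2 h3 h4 h5]; split=> //.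
  by apply: conn_relW h1 => u v _ _; exact: gap_rel_step.
move=> W /h4[W0 [x [y [xK yK _ _ c]]]]; exists x, y; split=> //.
by apply: sub_path (chain_path W0 c).
Qed.

Lemma exch_refine L L' K D : {subset flatten L' <= flatten L} ->
  {in L', forall s', exists2 s, s \in L & exists s1 s2, s = s1 ++ s' ++ s2} ->
  exch L K D -> exch L' K D.
Proof.
move=> sL h [h1 h2 h3 h4 h5]; split=> //.
- by apply: conn_relW h1 => u v _ _; exact: gap_rel_mono.
- move=> W /h4[W0 [x [y [xK yK xL yL c]]]]; split=> //; exists x, y; split=> //.
    by apply: contra xL; exact: sL.
  by apply: contra yL; exact: sL.
move=> s' /h[s /h5 hs [s1 [s2 e]]]; case: hs => [sK|[W WD [t1 [t2 eW]]]].
  by left => z zs; apply: sK; rewrite e !mem_cat zs orbT.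
by right; exists W => //; exists (t1 ++ s1), (s2 ++ t2); rewrite eW e !catA.
Qed.

Lemma prefix_cut (s1 s2 t2 s : seq V) b : s1 ++ b :: s2 = s ++ t2 -> b \notin s ->
  exists t, s1 = s ++ t.
Proof.
elim: s1 s => [|a s1 IH] [|d s] /=; try by move=> _ _; exists [::].
- by case=> <- _; rewrite inE eqxx.
- by move=> _ _; exists (a :: s1).
by case=> <- /IH h; rewrite inE negb_or => /andP[_ /h[t ->]]; exists t.
Qed.

Lemma infix_cut (s1 s2 t1 t2 s : seq V) b : s1 ++ b :: s2 = t1 ++ s ++ t2 -> b \notin s ->
  (exists t, s1 = t1 ++ s ++ t) \/ (exists t, s2 = t ++ s ++ t2).
Proof.
elim: s1 t1 => [|a s1 IH] [|c t1] /=.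
- case: s => [|d s] /=; first by move=> _ _; left; exists [::].
  by case=> <- _; rewrite inE eqxx.
- by case=> _ -> _; right; exists t1.
- by move=> e bs; left; apply: prefix_cut bs; rewrite cat_cons; exact: e.
case=> <- /IH h /h[[t ->]|[t ->]]; first by left; exists t.
by right; exists t.
Qed.

(** Since [b] lies in no gap, cutting the vine at [b] cuts no gap: each gap of the vine ends up
    wholly in the core or wholly in [s1]. *)
Lemma exch_absorb L K s1 b s2 D : b \notin flatten L -> exch L K ((s1 ++ b :: s2) :: D) ->
  exch L (K `|` fset_of (b :: s2)) (if s1 is [::] then D else s1 :: D).
Proof.
move=> bL [h1 h2 h3 h4 h5].
have [_ [x [y [xK yK xL yL c]]]] : (s1 ++ b :: s2) != [::] /\ exists x y,
        [/\ x \in K, y \in K, x \notin flatten L, y \notin flatten L & chain T x (s1 ++ b :: s2) y].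
  by apply: h4; rewrite inE eqxx.
have [c1 c2] := (chain_cat T x s1 b s2 y).1 c.
pose K1 := K `|` fset_of (b :: s2).
have subK : {subset K <= K1} by move=> z zK; rewrite inE zK.
have bK1 : b \in K1 by rewrite !inE eqxx orbT.
have conn1 : conn (gap_rel L) K1.
  apply: conn_add => //; first exact: gap_rel_sym.
    by apply/fset0Pn; exists x.
  move=> u; rewrite in_fset_of => us; exists y => //.
  have pT : path T y (rev (b :: s2)).
    by apply: (@chain_path1 _ _ _ _ (last x s1)); apply: chain_rev.
  apply: (@reach_path _ _ _ _ (rev (b :: s2))).
  - by apply: sub_path pT; exact: sub_gap_rel.
  - by move=> z; rewrite in_cons mem_rev in_fsetU in_fset_of => /orP[/eqP->|->]; rewrite ?yK ?orbT.
  by rewrite inE mem_rev us orbT.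
have infl : {in L, forall s, {subset s <= K1} \/ exists2 W, W \in (if s1 is [::] then D else s1 :: D) &
     exists s1 s2, W = s1 ++ s ++ s2}.
  move=> s sL; case: (h5 s sL) => [sK|[W]]; first by left => z /sK/subK.
  rewrite inE => /orP[/eqP->|WD] [t1 [t2 e]]; last first.
    right; exists W; last by exists t1, t2.
    by case: (s1) => // *; rewrite inE WD orbT.
  have bs : b \notin s.
    by apply: contra bL => bs; apply/flattenP; exists s.
  case: (infix_cut e bs) => [[t e1]|[t e2]].
    case: (s1) e1 => [|a s1'] e1.
      by left => z zs; move: (congr1 (fun l => z \in l) e1); rewrite /= !mem_cat zs orbT.
    by right; exists (a :: s1'); [rewrite inE eqxx|exists t1, t].
  by left => z zs; rewrite in_fsetU in_fset_of e2 inE !mem_cat zs !orbT.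
have uq : uniq (flatten D) /\ uniq (flatten (s1 :: D)).
  move: h2; rewrite /= -catA uniq_catCA cat_uniq => /and3P[_ _ h2].
  by split=> //; move: h2; rewrite cat_uniq => /and3P[].
have dis : {in flatten (s1 :: D), forall v, v \notin K1}.
  move=> v vD; rewrite in_fsetU in_fset_of negb_or h3; last first.
    by move: vD; rewrite /= !mem_cat => /orP[]->; rewrite ?orbT.
  move: h2; rewrite /= -catA uniq_catCA cat_uniq => /and3P[_ /hasPn h _].
  by apply: h.
have vin : {in D, forall W, W != [::] /\ exists x y,
        [/\ x \in K1, y \in K1, x \notin flatten L, y \notin flatten L & chain T x W y]}.
  move=> W WD; have [|W0 [x' [y' [x'K y'K x'L y'L c']]]] := h4 W; first by rewrite inE WD orbT.
  by split=> //; exists x', y'; split=> //; exact: subK.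
case: s1 uq dis c1 infl {h2 h3 h4 h5 c} c2 => [|a s1] [u1 u2] dis c1 infl c2.
  by split.
split=> // W; rewrite inE => /orP[/eqP->|/vin//]; split=> //.
by exists x, b; split=> //; exact: subK.
Qed.

Lemma exch_absorb_left L K s1 b s2 D : b \notin flatten L -> exch L K ((s1 ++ b :: s2) :: D) ->
  exch L (K `|` fset_of (rcons s1 b)) (if s2 is [::] then D else s2 :: D).
Proof.
move=> bL [h1 h2 h3 h4 h5].
have [_ [x [y [xK yK xL yL c]]]] : (s1 ++ b :: s2) != [::] /\ exists x y,
        [/\ x \in K, y \in K, x \notin flatten L, y \notin flatten L & chain T x (s1 ++ b :: s2) y].
  by apply: h4; rewrite inE eqxx.
have [c1 _ _ _ c2] := chain_split c.
pose K1 := K `|` fset_of (rcons s1 b).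
have subK : {subset K <= K1} by move=> z zK; rewrite inE zK.
have bK1 : b \in K1 by rewrite in_fsetU in_fset_of mem_rcons inE eqxx orbT.
have conn1 : conn (gap_rel L) K1.
  apply: conn_add => //; first exact: gap_rel_sym.
    by apply/fset0Pn; exists x.
  move=> u; rewrite in_fset_of => us; exists x => //.
  have pT : path T x (rcons s1 b).
    have := chain_path1 c; rewrite -cat_rcons cat_path; by case/andP.
  apply: (@reach_path _ _ _ _ (rcons s1 b)).
  - by apply: sub_path pT; exact: sub_gap_rel.
  - by move=> z; rewrite in_cons in_fsetU in_fset_of => /orP[/eqP->|->]; rewrite ?xK ?orbT.
  by rewrite inE us orbT.
have infl : {in L, forall s, {subset s <= K1} \/ exists2 W, W \in (if s2 is [::] then D else s2 :: D) &
     exists s1 s2, W = s1 ++ s ++ s2}.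
  move=> s sL; case: (h5 s sL) => [sK|[W]]; first by left => z /sK/subK.
  rewrite inE => /orP[/eqP->|WD] [t1 [t2 e]]; last first.
    right; exists W; last by exists t1, t2.
    by case: (s2) => // *; rewrite inE WD orbT.
  have bs : b \notin s.
    by apply: contra bL => bs; apply/flattenP; exists s.
  case: (infix_cut e bs) => [[t e1]|[t e2]].
    by left => z zs; rewrite in_fsetU in_fset_of e1 mem_rcons inE !mem_cat zs !orbT.
  case: (s2) e2 => [|a s2'] e2.
    by left => z zs; move: (congr1 (fun l => z \in l) e2); rewrite /= !mem_cat zs orbT.
  by right; exists (a :: s2'); [rewrite inE eqxx|exists t, t2].
have h2' : uniq ((rcons s1 b ++ s2) ++ flatten D) by rewrite cat_rcons.
have uq : uniq (flatten D) /\ uniq (flatten (s2 :: D)).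
  move: h2'; rewrite -catA cat_uniq => /and3P[_ _ h].
  by split=> //; move: h; rewrite cat_uniq => /and3P[].
have dis : {in flatten (s2 :: D), forall v, v \notin K1}.
  move=> v vD; rewrite in_fsetU in_fset_of negb_or h3; last first.
    by move: vD; rewrite /= !mem_cat inE => /orP[]->; rewrite ?orbT.
  move: h2'; rewrite -catA cat_uniq => /and3P[_ /hasPn h _].
  by apply: h.
have vin : {in D, forall W, W != [::] /\ exists x y,
        [/\ x \in K1, y \in K1, x \notin flatten L, y \notin flatten L & chain T x W y]}.
  move=> W WD; have [|W0 [x' [y' [x'K y'K x'L y'L c']]]] := h4 W; first by rewrite inE WD orbT.
  by split=> //; exists x', y'; split=> //; exact: subK.
case: s2 uq dis c2 infl {h2 h3 h4 h5 c h2'} => [|a s2] [u1 u2] dis c2 infl.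
  by split.
split=> // W; rewrite inE => /orP[/eqP->|/vin//]; split=> //.
by exists b, y; split=> //; exact: subK.
Qed.

Lemma vverts_absorb_left K s1 s2 D :
  vverts (K `|` fset_of s1) (s2 :: D) = vverts K ((s1 ++ s2) :: D).
Proof.
apply/fsetP=> v; rewrite !inE /=.
by case: (v \in K) => //=; case: (v \in s1); case: (v \in s2) => //=; rewrite ?orbT.
Qed.

Lemma levs_if g s D : 0 < g -> levs g (if s is [::] then D else s :: D) = lev g (size s) + levs g D.
Proof. by case: s => [|a s] g0; rewrite ?levs_cons // /lev /= g0. Qed.

(* Of the vine containing b, the larger side remains a vine. *)
Lemma exch_visit g L K D b : 0 < g -> exch L K D -> b \in vverts K D -> b \notin flatten L ->
  exists K' D', [/\ exch L K' D', vverts K' D' = vverts K D, b \in K' &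
    levs g D <= (levs g D').+1].
Proof.
move=> g0 ex; rewrite in_fsetU in_fset_of; case: (boolP (b \in K)) => [bK _ bL|_ /= bD bL].
  by exists K, D; split.
have /flattenP[W WD bW] := bD.
have [s1 [s2 eW]] : exists s1 s2, W = s1 ++ b :: s2.
  by move: bW; clear; case/splitPr => s1 s2; exists s1, s2.
have hp := perm_to_rem WD; rewrite eW in hp.
have ex' := exch_perm hp ex.
rewrite (vverts_perm K hp) (levs_perm g hp) levs_cons size_cat /=.
have [h|h] := leqP (size s2) (size s1).
  exists (K `|` fset_of (b :: s2)), (if s1 is [::] then rem W D else s1 :: rem W D); split.
  - by have := exch_absorb bL ex'; rewrite eW.
  - by rewrite eW; case: (s1) => [|a s1']; [exact: vverts_behead | exact: vverts_absorb].
  - by rewrite !inE eqxx orbT.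
  - rewrite levs_if // eW -addSn leq_add2r; apply: lev_half_le => //.
    by move: h; clear; lia.
exists (K `|` fset_of (rcons s1 b)), (if s2 is [::] then rem W D else s2 :: rem W D); split.
- by have := exch_absorb_left bL ex'; rewrite eW.
- rewrite eW -cat_rcons; case: (s2) => [|a s2']; last exact: vverts_absorb_left.
  by rewrite cats0; exact: vverts_behead.
- by rewrite in_fsetU in_fset_of mem_rcons inE eqxx orbT.
rewrite levs_if // eW -addSn leq_add2r; apply: lev_half_le => //.
by move: h; clear; lia.
Qed.

Lemma exch_add L K D b c : exch L K D -> b \in K -> b \notin flatten L -> path E b c ->
  {in c, forall z, z \notin vverts K D} -> {in c, forall z, z \notin flatten L} ->
  exch L (K `|` fset_of c) D.
Proof.
move=> [h1 h2 h3 h4 h5] bK bL pc cX cL.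
have subK : {subset K <= K `|` fset_of c} by move=> z zK; rewrite inE zK.
split=> //.
- apply: conn_add => //; first exact: gap_rel_sym.
    by apply/fset0Pn; exists b.
  move=> u; rewrite in_fset_of => us; exists b => //.
  apply: (@reach_path _ _ _ _ c); last by rewrite inE us orbT.
  + elim: (c) b bL pc cL {bK cX us subK} => //= a c' IH b bL /andP[Eba pc] cL.
    have aL : a \notin flatten L by apply: cL; rewrite inE eqxx.
    rewrite /gap_rel Eba bL aL orbT /=; apply: IH => // z zc.
    by apply: cL; rewrite inE zc orbT.
  + by move=> z; rewrite in_cons in_fsetU in_fset_of => /orP[/eqP->|->]; rewrite ?bK ?orbT.
- move=> v vD; rewrite in_fsetU negb_or h3 //= in_fset_of; apply/negP => /cX.
  by rewrite in_fsetU in_fset_of vD orbT.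
- move=> W /h4[W0 [x [y [xK yK xL yL ch]]]]; split=> //.
  by exists x, y; split=> //; exact: subK.
by move=> s /h5[sK|?]; [left => z /sK/subK|right].
Qed.

End Exchange.

(** * Exchanging a gap after a jump into it *)

Section ExchangeRun.
Variables (V : choiceType) (G T : rel V).
Hypothesis Gsym : symmetric G.
Notation E := (step G).
Hypothesis Tsym : symmetric T.
Hypothesis TE : subrel T E.
Implicit Types (u v x y z b : V) (s w W c : seq V) (L D : seq (seq V)) (K : {fset V}).

(** Meant for a core [K] from which a whole gap with outer neighbours [e1] and [e2] was removed: it
    has at most two pieces, one at each of them. The jump links [v] to [e1], and the side [s] that
    is kept links [v] to [e2]. *)
Lemma conn_side (R : rel V) K1 K v e1 e2 s : symmetric R -> K `<=` K1 -> v \in K1 ->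
  {subset s <= K1} -> {in K1, forall u, [\/ u \in K, u = v | u \in s]} ->
  {in K, forall u, reach R K u e1 \/ reach R K u e2} -> reach R K1 v e1 ->
  path R v (rcons s e2) -> conn R K1.
Proof.
move=> sR KK1 vK1 sK1 cov rK re1; rewrite rcons_path => /andP[ps Re2].
have mono u u' : reach R K u u' -> reach R K1 u u'.
  by apply: reach_sub => // z; exact: (fsubsetP KK1).
have sK : {subset v :: s <= K1} by move=> z; rewrite inE => /orP[/eqP->|/sK1].
apply: (@conn_root _ _ _ v) => // u /cov[uK|->|us]; last 2 first.
- exact: reach_refl.
- by apply: (reach_path ps) => //; rewrite inE us orbT.
case: (rK u uK) => r; first by apply: reach_trans re1 _; apply: reach_sym => //; exact: mono.
have [_ e2K] := reach_in r.
apply: (@reach_trans _ _ _ e2); last by apply: reach_sym => //; exact: mono.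
apply: (@reach_trans _ _ _ (last v s)).
  by apply: (reach_path ps) => //; exact: mem_last.
apply: reach_step => //; first by apply: sK; exact: mem_last.
exact: (fsubsetP KK1).
Qed.

(** The edges of [gap_rel] at pages of the gap are tree edges, so a path from [u] into the gap must
    first come to [x] or [y]. *)
Lemma gap_exit L K s x y v u : s \in L -> chain T x s y -> v \in s ->
  conn (gap_rel G T L) K -> v \in K -> u \in K `\` fset_of s ->
  reach (gap_rel G T L) (K `\` fset_of s) u x \/ reach (gap_rel G T L) (K `\` fset_of s) u y.
Proof.
move=> sL ch vs cK vK; rewrite in_fsetD in_fset_of => /andP[us uK].
have [p [pp lp pK]] := cK _ _ uK vK.
elim: p u us uK pp lp pK => [|a p IH] u us uK /=; first by move=> _ e; rewrite e vs in us.
move=> /andP[Rua pp] lp pK.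
have uK' : u \in K `\` fset_of s by rewrite in_fsetD in_fset_of us.
have aK : a \in K by apply: pK; rewrite !inE eqxx orbT.
have [as'|as'] := boolP (a \in s).
  have aL : a \in flatten L by apply/flattenP; exists s.
  have Tau : T a u by move: Rua; rewrite /gap_rel aL !andbF orbF Tsym.
  have := chain_nbr ch as' Tau; rewrite inE mem_rcons inE (negbTE us) orbF.
  by case/orP => /eqP <-; [left|right]; exact: reach_refl.
have aK' : a \in K `\` fset_of s by rewrite in_fsetD in_fset_of as'.
have ru := reach_step uK' aK' Rua.
have [|r|r] := IH a as' aK pp lp; first by move=> z zp; apply: pK; rewrite inE zp orbT.
  by left; exact: reach_trans ru r.
by right; exact: reach_trans ru r.
Qed.

(** The larger part is one level below the whole at worst, and the smaller part comes in
    addition. *)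
Lemma lev_cut g n1 n2 m1 m2 : 0 < g -> m1 <= n1 -> m2 <= n2 ->
  lev g (n1 + n2.+1) + minn (lev g m1) (lev g m2) <= (lev g n1 + lev g n2).+1.
Proof.
move=> g0 h1 h2; have l1 := lev_mono g h1; have l2 := lev_mono g h2.
have [h|h] := leqP n1 n2.
  have : lev g (n1 + n2.+1) <= (lev g n2).+1 by apply: lev_half_le => //; move: h; clear; lia.
  by move: l1 l2; move: (lev _ _) (lev _ _) (lev _ _) (lev _ _) (lev _ _); clear; lia.
have : lev g (n1 + n2.+1) <= (lev g n1).+1 by apply: lev_half_le => //; move: h; clear; lia.
by move: l1 l2; move: (lev _ _) (lev _ _) (lev _ _) (lev _ _) (lev _ _); clear; lia.
Qed.

(** A gap inside the core gives back one of its sides as a vine, as the jump from [pr] to [v]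
    replaces the connection through that side. A gap inside a vine has [v] join the core through the
    jump, which cuts the vine in two at the loss of at most one level. *)
Lemma exch_split g L K D s1 v s2 L' pr : 0 < g -> gaps_ok T L -> exch G T L K D ->
    perm_eq L ((s1 ++ v :: s2) :: L') -> s1 != [::] -> s2 != [::] ->
    pr \in K -> pr \notin flatten L -> E pr v ->
  exists K' D', [/\ exch G T (s1 :: s2 :: L') K' D', vverts K' D' = vverts K D &
    levs g D + minn (lev g (size s1)) (lev g (size s2)) <= (levs g D').+1].
Proof.
move=> g0 gok0 ex0 hp s10 s20 prK prL0 Ev.
have gok := gaps_ok_perm hp gok0; have ex := exch_permL hp ex0.
have prL : pr \notin flatten ((s1 ++ v :: s2) :: L') by rewrite -(perm_mem (perm_flatten hp)).
move: gok ex prL {hp gok0 ex0 prL0 L}.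
set s := s1 ++ v :: s2; set L := s :: L'; set L1 := s1 :: s2 :: L' => gok ex prL.
have pf : perm_eq (flatten L) (v :: flatten L1) by apply: flatten_split; exact: perm_refl.
have sub : {subset flatten L1 <= flatten L} by move=> z zL; rewrite (perm_mem pf) inE zL orbT.
have uL1 : uniq (v :: flatten L1) by rewrite -(perm_uniq pf); case: gok.
have vL1 : v \notin flatten L1 by case/andP: uL1.
have prL1 : pr \notin flatten L1 by apply: contra prL; exact: sub.
have Rprv : gap_rel G T L1 pr v by rewrite /gap_rel Ev prL1 vL1 orbT.
have Rsym := gap_rel_sym Gsym Tsym.
have [h1 h2 h3 h4 h5] := ex.
have mono := gap_rel_mono (G := G) (T := T) sub.
have notL1 z : z \notin flatten L -> z \notin flatten L1 by apply: contra; exact: sub.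
have vs : v \in s by rewrite mem_cat inE eqxx orbT.
case: (h5 s); first by rewrite inE eqxx.
  move=> sK; have vK := sK v vs.
  have [_ /(_ s)] := gok; rewrite inE eqxx => /(_ isT)[x [y [xL yL ch]]].
  have [ch1 _ _ _ ch2] := chain_split ch.
  have us : uniq s by move: uL1; rewrite -(perm_uniq pf) /= cat_uniq => /andP[].
  have prs : pr \notin s by apply: contra prL => prs; rewrite mem_cat prs.
  have prK' : pr \in K `\` fset_of s by rewrite in_fsetD in_fset_of prs.
  have exit u : u \in K `\` fset_of s ->
      reach (gap_rel G T L1) (K `\` fset_of s) u x \/ reach (gap_rel G T L1) (K `\` fset_of s) u y.
    move=> uK; have := @gap_exit L K s x y v u _ ch vs h1 vK uK; rewrite inE eqxx => /(_ isT).
    by case=> r; [left|right]; apply: reach_sub r => // ? ? _ _; exact: mono.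
  have [dis1 dis2] : {in s1, forall z, z \notin s2 /\ z != v} /\ {in s2, forall z, z \notin s1 /\ z != v}.
    move: us; rewrite cat_uniq /= negb_or => /and3P[_ /andP[vs1 /hasPn d] /andP[vs2 _]]; split=> z zs.
      split; first by apply/negP => /d; rewrite zs.
      by apply: contraNneq vs1 => <-.
    split; first exact: d.
    by apply: contraNneq vs2 => <-.
  (* The side [S'] leaves the core and becomes a vine, provided that the core stays connected
     without it. *)
  have drop (S' : seq V) : S' \in [:: s1; s2] -> S' != [::] ->
      conn (gap_rel G T L1) (K `\` fset_of S') ->
      (exists x y, [/\ x \in K `\` fset_of S', y \in K `\` fset_of S', x \notin flatten L1,
                       y \notin flatten L1 & chain T x S' y]) ->
      exists K' D', [/\ exch G T L1 K' D', vverts K' D' = vverts K D &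
        levs g D + minn (lev g (size s1)) (lev g (size s2)) <= (levs g D').+1].
    move=> hS S0 cS vS.
    have SK : {subset S' <= K}.
      move=> z zS; apply: sK; rewrite mem_cat inE.
      by move: hS; rewrite !inE => /orP[]/eqP<-; rewrite zS ?orbT.
    have SL : S' \in L1 by move: hS; rewrite !inE => /orP[]->; rewrite ?orbT.
    exists (K `\` fset_of S'), (S' :: D); split; last first.
    - rewrite levs_cons; move: hS; rewrite !inE => /orP[]/eqP->;
      by move: (lev _ _) (lev _ _) (levs _ _); clear; lia.
    - apply/fsetP => z; rewrite !in_fsetU !in_fset_of in_fsetD in_fset_of /= mem_cat.
      case: (boolP (z \in S')) => //= zS.
      by rewrite SK.
    split=> //.
    - rewrite /= cat_uniq h2 andbT; apply/andP; split; last first.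
        by apply/hasPn => z /h3; apply: contra; exact: SK.
      by move: us; rewrite cat_uniq /= => /and3P[u1 _ /andP[_ u2]]; move: hS; rewrite !inE => /orP[]/eqP->.
    - move=> z; rewrite /= mem_cat => /orP[zS|/h3 zK]; first by rewrite in_fsetD in_fset_of zS.
      by rewrite in_fsetD (negbTE zK) andbF.
    - move=> W; rewrite inE => /orP[/eqP->|/h4[W0 [x' [y' [x'K y'K x'L y'L c']]]]]; first by split.
      have h z : z \notin flatten L -> z \in K -> z \in K `\` fset_of S'.
        move=> zL zK; rewrite in_fsetD in_fset_of zK andbT; apply: contra zL => zS; apply: sub.
        by apply/flattenP; exists S'.
      by split=> //; exists x', y'; split=> //; [exact: h|exact: h|exact: notL1|exact: notL1].
    move=> s' s'L1; have [->|ne] := eqVneq s' S'.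
      by right; exists S'; [rewrite inE eqxx|exists [::], [::]; rewrite cats0].
    have dS : {in s', forall z, z \notin S'}.
      move=> z zs'; apply/negP => zS.
      have e1 : perm_eq L1 (S' :: rem S' L1) := perm_to_rem SL.
      have s'r : s' \in rem S' L1 by move: s'L1; rewrite (perm_mem e1) inE (negbTE ne).
      have : uniq (flatten L1) by case/andP: uL1.
      rewrite (perm_uniq (perm_flatten e1)) /= cat_uniq => /and3P[_ /hasPn d _].
      have zr : z \in flatten (rem S' L1) by apply/flattenP; exists s'.
      by move: (d z zr); rewrite /= zS.
    have : {subset s' <= s} \/ s' \in L.
      move: s'L1; rewrite !inE => /or3P[/eqP->|/eqP->|->]; last by right; rewrite orbT.
        by left => z zs; rewrite mem_cat zs.
      by left => z zs; rewrite mem_cat inE zs !orbT.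
    case=> [ss|/h5[s'K|[W WD ?]]].
    - by left => z zs'; rewrite in_fsetD in_fset_of dS //= sK // ss.
    - by left => z zs'; rewrite in_fsetD in_fset_of dS //= s'K.
    by right; exists W => //; rewrite inE WD orbT.
  have sub1 : K `\` fset_of s `<=` K `\` fset_of s1.
    by apply/fsubsetP => z; rewrite !in_fsetD !in_fset_of mem_cat negb_or => /andP[/andP[->]].
  have sub2 : K `\` fset_of s `<=` K `\` fset_of s2.
    by apply/fsubsetP => z; rewrite !in_fsetD !in_fset_of mem_cat inE !negb_or => /andP[/and3P[_ _ ->]].
  have v1 : v \in K `\` fset_of s1.
    by rewrite in_fsetD in_fset_of vK andbT; apply/negP => /dis1[_]; rewrite eqxx.
  have v2 : v \in K `\` fset_of s2.
    by rewrite in_fsetD in_fset_of vK andbT; apply/negP => /dis2[_]; rewrite eqxx.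
  have TR : subrel T (gap_rel G T L1) by apply: sub_gap_rel.
  have weak K2 a b : K `\` fset_of s `<=` K2 -> reach (gap_rel G T L1) (K `\` fset_of s) a b ->
      reach (gap_rel G T L1) K2 a b.
    by move=> hK; apply: reach_sub => // z; exact: (fsubsetP hK).
  (* If [pr] is linked to [x] off the gap, then [s1] can be released: [v] reaches [x] by way of [pr]
     and [y] by way of [s2]. The other case is the mirror image. *)
  case: (exit _ prK') => r.
    apply: (drop s1) => //; first by rewrite inE eqxx.
      apply: (@conn_side _ _ (K `\` fset_of s) v x y s2) => //.
      - by move=> z zs2; rewrite in_fsetD in_fset_of (dis2 z zs2).1 sK // mem_cat inE zs2 !orbT.
      - move=> z; rewrite !in_fsetD !in_fset_of mem_cat inE => /andP[zs1 zK].
        case: (eqVneq z v) => [->|zv]; first by constructor 2.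
        by case: (boolP (z \in s2)) => zs2; [constructor 3|constructor 1; rewrite zK negb_or zs1].
      - apply: (@reach_trans _ _ _ pr); last exact: weak r.
        apply: reach_step => //; first exact: (fsubsetP sub1).
        by rewrite gap_rel_sym.
      - by apply: sub_path (chain_path s20 ch2).
    exists x, v; split=> //; last exact: notL1.
    exact/(fsubsetP sub1)/(reach_in r).2.
  apply: (drop s2) => //; first by rewrite !inE eqxx orbT.
    apply: (@conn_side _ _ (K `\` fset_of s) v y x (rev s1)) => //.
    - by move=> z; rewrite mem_rev => zs1; rewrite in_fsetD in_fset_of (dis1 z zs1).1 sK // mem_cat zs1.
    - move=> z; rewrite !in_fsetD !in_fset_of mem_cat inE mem_rev => /andP[zs2 zK].
      case: (eqVneq z v) => [->|zv]; first by constructor 2.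
      by case: (boolP (z \in s1)) => zs1; [constructor 3|constructor 1; rewrite zK negb_or (negbTE zs2)].
    - by move=> z /exit[]; [right|left].
    - apply: (@reach_trans _ _ _ pr); last exact: weak r.
      apply: reach_step => //; first exact: (fsubsetP sub2).
      by rewrite gap_rel_sym.
    - apply: sub_path (_ : path T v _) => //; rewrite (path_rev_rcons Tsym).
      exact: chain_path ch1.
  exists v, y; split=> //; last exact: notL1.
  exact/(fsubsetP sub2)/(reach_in r).2.
case=> W WD [t1 [t2 eW]].
have eW' : W = (t1 ++ s1) ++ v :: (s2 ++ t2) by rewrite eW /s -!catA.
have hpD := perm_to_rem WD; set D' := rem W D in hpD.
have pfD : perm_eq (flatten D) (v :: flatten ((t1 ++ s1) :: (s2 ++ t2) :: D')).
  by apply: flatten_split; rewrite -eW'.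
have vK : v \notin K by apply: h3; rewrite (perm_mem pfD) inE eqxx.
have [W0 [x [y [xK yK xL yL ch]]]] := h4 W WD.
rewrite eW' in ch; have [ch1 _ _ _ ch2] := chain_split ch.
exists (v |` K), ((t1 ++ s1) :: (s2 ++ t2) :: D'); split; last first.
- rewrite (levs_perm g hpD) !levs_cons eW' size_cat /=.
  have := @lev_cut g (size (t1 ++ s1)) (size (s2 ++ t2)) (size s1) (size s2) g0.
  rewrite !size_cat leq_addl leq_addr => /(_ isT isT).
  by move: (lev _ _) (lev _ _) (lev _ _) (lev _ _) (lev _ _) (levs _ _); clear; lia.
- apply/fsetP => z; rewrite !in_fsetU !in_fset_of (perm_mem pfD) in_fset1 inE.
  by case: (z == v); rewrite ?orbT.
split.
- apply: (conn_add1 _ _ prK Rprv); first exact: Rsym.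
  by apply: conn_relW h1 => ? ? _ _; exact: mono.
- by move: h2; rewrite (perm_uniq pfD) => /andP[].
- move=> z zD; rewrite in_fset1U negb_or h3 ?andbT; last by rewrite (perm_mem pfD) inE zD orbT.
  by move: h2; rewrite (perm_uniq pfD) => /andP[vD _]; apply: contraNneq vD => <-.
- have subK : {subset K <= v |` K} by move=> z zK; rewrite in_fset1U zK orbT.
  move=> W'; rewrite !inE => /or3P[/eqP->|/eqP->|WD'].
  + split; first by case: (t1); case: (s1) s10.
    by exists x, v; split=> //; rewrite ?in_fset1U ?eqxx ?xK ?orbT //; exact: notL1.
  + split; first by case: (s2) s20.
    by exists v, y; split=> //; rewrite ?in_fset1U ?eqxx ?yK ?orbT //; exact: notL1.
  have [|W'0 [x' [y' [x'K y'K x'L y'L c']]]] := h4 W'; first by rewrite (perm_mem hpD) inE WD' orbT.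
  by split=> //; exists x', y'; split=> //; [exact: subK|exact: subK|exact: notL1|exact: notL1].
move=> s'; rewrite !inE => /or3P[/eqP->|/eqP->|s'L'].
- by right; exists (t1 ++ s1); rewrite ?inE ?eqxx //; exists t1, [::]; rewrite cats0.
- by right; exists (s2 ++ t2); rewrite ?inE ?eqxx ?orbT //; exists [::], t2.
have [|s'K|[W' W'D [r1 [r2 eW2]]]] := h5 s'; first by rewrite inE s'L' orbT.
  by left => z zs'; rewrite in_fset1U s'K ?orbT.
move: W'D; rewrite (perm_mem hpD) inE => /orP[/eqP e|W'D].
  have vs' : v \notin s'.
    by apply: contra vL1 => vs'; rewrite /= !mem_cat orbA; apply/orP; right; apply/flattenP; exists s'.
  have := @infix_cut _ (t1 ++ s1) (s2 ++ t2) r1 r2 s' v; rewrite -eW' -eW2 e => /(_ erefl vs').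
  case=> -[t et]; right.
    by exists (t1 ++ s1); rewrite ?inE ?eqxx //; exists r1, t.
  by exists (s2 ++ t2); rewrite ?inE ?eqxx ?orbT //; exists t, r2.
by right; exists W'; rewrite ?inE ?W'D ?orbT //; exists r1, r2.
Qed.

End ExchangeRun.

(** * Jumps that leave two long sides *)

Section RunA.
Variables (V : choiceType) (G T : rel V).
Hypothesis Gsym : symmetric G.
Notation E := (step G).
Hypothesis Tsym : symmetric T.
Hypothesis TE : subrel T E.
Implicit Types (u v x y z p : V) (s w W c : seq V) (L D : seq (seq V)) (K : {fset V}).

Definition gap_init K0 L0 :=
  [/\ conn (gap_rel G T L0) K0, uniq (flatten L0), {in flatten L0, forall v, v \notin K0} &
      {in L0, forall s, s != [::] /\ exists x y, [/\ x \in K0, y \in K0 & chain T x s y]}].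

Lemma gap_init_ok K0 L0 : gap_init K0 L0 -> gaps_ok T L0.
Proof.
move=> [h1 h2 h3 h4]; split=> // s /h4[s0 [x [y [xK yK c]]]]; exists x, y.
by split=> //; apply/negP => /h3; rewrite ?xK ?yK.
Qed.

Lemma exch_init K0 L0 : gap_init K0 L0 -> exch G T L0 K0 L0.
Proof.
move=> gi; have [h1 h2 h3 h4] := gi; split=> //.
  move=> s /h4[s0 [x [y [xK yK c]]]]; split=> //; exists x, y.
  by split=> //; apply/negP => /h3; rewrite ?xK ?yK.
by move=> s sL; right; exists s => //; exists [::], [::]; rewrite cats0.
Qed.

(** The part [c] of the walk since its last page in [X] is held back: it joins the core only
    together with a split that pays, since moving the core to a page [b] inside a vine costs a
    level. *)
Definition anchored (X : {fset V}) L w q := exists b c,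
  [/\ b \in X /\ b \notin flatten L, path E b c, last b c = q, {in c, forall z, z \notin X} &
      {subset c <= w}].

Lemma anchored_step X L L' w q v : anchored X L w q -> E q v ->
  {subset flatten L' <= flatten L} -> v \notin flatten L' -> anchored X L' (rcons w v) v.
Proof.
move=> [b [c [[bX bL] pc lc cX cw]]] Eqv sL vL.
have [vX|vX] := boolP (v \in X); first by exists v, [::]; split.
exists b, (rcons c v); split.
- by split=> //; apply: contra bL; exact: sL.
- by rewrite rcons_path pc lc.
- by rewrite last_rcons.
- by move=> z; rewrite mem_rcons inE => /orP[/eqP->|/cX].
by move=> z; rewrite !mem_rcons !inE => /orP[->//|/cw->]; rewrite orbT.
Qed.

(** If both sides are long, moving the core to the walk loses one level and the split another one,
    while the gain is the level of the shorter side, at least 4. At least half of the gain remains,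
    hence the factor 2. All other splits leave the structure as it is, since a vine may contain
    several gaps. *)
Theorem exch_run g K0 L0 p w L a b : 0 < g -> gap_init K0 L0 -> p \in K0 -> path E p w ->
  run g L0 w L a b -> exists K D,
  [/\ exch G T L K D, vverts K0 L0 `<=` vverts K D,
      vverts K D `<=` vverts K0 L0 `|` fset_of w, anchored (vverts K D) L w (last p w) &
      levs g L0 + a <= 2 * levs g D].
Proof.
move=> g0 gi pK0 pw r.
have gok0 := gap_init_ok gi.
elim: r pw => [|{}w {}L {}a {}b v r IH vL|{}w {}L {}a {}b s1 v s2 L' r IH hp].
- move=> _; exists K0, L0; split; rewrite ?addn0 ?leq_pmull //.
  + exact: exch_init.
  + exact: fsubsetUl.
  exists p, [::]; split=> //; split; first by rewrite in_fsetU pK0.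
  by have [_ _ h _] := gi; apply/negP => /h; rewrite pK0.
- rewrite rcons_path last_rcons => /andP[/IH[K [D [h1 h2 h3 h4 h5]]] Ev].
  exists K, D; split=> //.
    apply: fsubset_trans h3 _; apply: fsetUS; apply/fsubsetP => z.
    by rewrite !in_fset_of mem_rcons inE orbC => ->.
  by apply: anchored_step h4 Ev _ vL.
rewrite rcons_path last_rcons => /andP[/IH[K [D [h1 h2 h3 h4 h5]]] Ev].
have gok := run_gaps_ok gok0 r.
have gok1 := gaps_ok_split hp gok.
have pf := flatten_split hp.
have sub : {subset flatten (s1 :: s2 :: L') <= flatten L} by move=> z zL; rewrite (perm_mem pf) inE zL orbT.
have vL1 : v \notin flatten (s1 :: s2 :: L').
  by have [u _] := gok; move: u; rewrite (perm_uniq pf) => /andP[].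
have wsub : fset_of w `<=` fset_of (rcons w v).
  by apply/fsubsetP => z; rewrite !in_fset_of mem_rcons inE orbC => ->.
have [small|big] := ltnP (minn (size s1) (size s2)) (10 * g).
  exists K, D; split=> //.
  - apply: exch_refine h1 => // s'; rewrite !inE => /or3P[/eqP->|/eqP->|s'L].
    + exists (s1 ++ v :: s2); first by rewrite (perm_mem hp) inE eqxx.
      by exists [::], (v :: s2).
    + exists (s1 ++ v :: s2); first by rewrite (perm_mem hp) inE eqxx.
      by exists (rcons s1 v), [::]; rewrite cats0 cat_rcons.
    exists s'; first by rewrite (perm_mem hp) inE s'L orbT.
    by exists [::], [::]; rewrite cats0.
  - by apply: fsubset_trans h3 _; exact: fsetUS.
  - exact: anchored_step Ev sub vL1.
  by rewrite /incA [10 * g <= _]leqNgt small addn0.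
have [s10 s20] : s1 != [::] /\ s2 != [::].
  by move: big g0; clear; case: s1; case: s2 => //= *; lia.
have [b0 [c [[bX bL] pc lc cX cw]]] := h4.
have [K1 [D1 [e1 eX1 bK1 lv1]]] := exch_visit Gsym Tsym g0 h1 bX bL.
have X0L : {subset flatten L0 <= vverts K D}.
  by move=> z zL; apply: (fsubsetP h2); rewrite in_fsetU in_fset_of zL orbT.
have cL : {in c, forall z, z \notin flatten L}.
  by move=> z /cX; apply: contra => /(run_subset r); exact: X0L.
have cX1 : {in c, forall z, z \notin vverts K1 D1} by rewrite eX1.
have e2 := exch_add Gsym Tsym e1 bK1 bL pc cX1 cL.
have lK2 : last p w \in K1 `|` fset_of c.
  rewrite -lc; have := mem_last b0 c; rewrite inE in_fsetU in_fset_of => /orP[/eqP->|->]; rewrite ?bK1 ?orbT //.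
have lL : last p w \notin flatten L.
  by rewrite -lc; have := mem_last b0 c; rewrite inE => /orP[/eqP->|/cL].
have [K3 [D3 [e3 eX3 lv3]]] := exch_split Gsym Tsym g0 gok e2 hp s10 s20 lK2 lL Ev.
have eX : vverts K3 D3 = vverts K D `|` fset_of c.
  by rewrite eX3 -eX1; apply/fsetP => z; rewrite !in_fsetU !in_fset_of; case: (z \in K1); rewrite //= orbC.
have cw' : fset_of c `<=` fset_of (rcons w v).
  by apply: fsubset_trans wsub; apply/fsubsetP => z; rewrite !in_fset_of; exact: cw.
exists K3, D3; split=> //.
- by rewrite eX; apply: fsubset_trans h2 _; exact: fsubsetUl.
- rewrite eX; rewrite fsubUset; apply/andP; split.
    by apply: fsubset_trans h3 _; exact: fsetUS.
  by apply: fsubset_trans cw' _; exact: fsubsetUr.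
- exists v, [::]; split=> //; split=> //; apply: (fsubsetP (_ : vverts K0 L0 `<=` _)).
    by rewrite eX; apply: fsubset_trans h2 _; exact: fsubsetUl.
  rewrite in_fsetU in_fset_of (run_subset r) ?orbT // (perm_mem pf).
  by rewrite inE eqxx.
have lvm : lev g (minn (size s1) (size s2)) <= minn (lev g (size s1)) (lev g (size s2)).
  by rewrite leq_min !lev_mono ?geq_minl ?geq_minr.
have l4 := lev_ge4 g0 big.
rewrite /incA big; move: h5 lv1 lv3 lvm l4; clear.
by move: (lev _ (minn _ _)) (minn (lev _ _) _) (levs g L0) (levs g D) (levs g D1) (levs g D3); lia.
Qed.

Variables (k : nat) (A : online V) (q c0 : nat).
Hypothesis k0 : 0 < k.
Hypothesis Alegal : online_legal k A.
Hypothesis comp : forall s, s \in paths G -> cost k A s <= q * OPT k s + c0.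

(** [levs_bound] is applied with [h] the surplus over [k] of the pages in the exchanged structure;
    it lies between 1 and [g] because the structure grows only by pages of the walk. *)
Theorem runA_bound g K0 L0 p w L a b : 0 < g -> gap_init K0 L0 -> p \in K0 -> path E p w ->
  run g L0 w L a b -> k < #|` vverts K0 L0| -> #|` vverts K0 L0 `|` fset_of w| <= k + g ->
  levs g L0 + a <= 8 * q + 8.
Proof.
move=> g0 gi pK0 pw r X0k Xk.
have [K [D [ex s1 s2 [b0 [c [[bX _] _ _ _ _]]] hl]]] := exch_run g0 gi pK0 pw r.
have st := exch_vstruct TE ex.
have c1 := fsubset_leq_card s1; have c2 := fsubset_leq_card s2.
have K0' : K != fset0.
  have [z zV] : exists z, z \in vverts K D by exists b0.
  move: zV; rewrite in_fsetU in_fset_of => /orP[zK|/flattenP[W WD _]].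
    by apply/fset0Pn; exists z.
  by have [_ _ _ /(_ W WD)[_ [x [_ [xK _ _ _ _]]]] _] := ex; apply/fset0Pn; exists x.
have := @levs_bound V G k A q c0 Gsym k0 Alegal comp g (#|` vverts K D| - k) K D.
move=> B; suff : levs g D <= 4 * q + 4 by move: hl; clear; lia.
by apply: B => //; move: c1 c2 X0k Xk; clear; lia.
Qed.

End RunA.

(** * Jumps that leave a short side *)

Section RunB.
Variables (V : choiceType) (G T : rel V).
Hypothesis Gsym : symmetric G.
Notation E := (step G).
Hypothesis Tsym : symmetric T.
Hypothesis TE : subrel T E.
Variables (k g : nat).
Hypothesis g0 : 0 < g.
Implicit Types (u v x y z p : V) (s w S O : seq V) (L D : seq (seq V)) (K W X : {fset V}).

Let Esym := step_sym Gsym.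

Lemma vstruct_conn K D : vstruct E K D -> conn E (vverts K D).
Proof.
elim: D K => [|s D IH] K st.
  have -> : vverts K [::] = K by apply/fsetP => z; rewrite !inE orbF.
  by have [] := st.
by rewrite -vverts_behead; apply: IH; exact: vstruct_behead Esym _ _ _ st.
Qed.

Lemma conn_walk X p w : conn E X -> p \in X -> path E p w -> conn E (X `|` fset_of w).
Proof.
move=> cX pX pw; apply: conn_add => //; first by apply/fset0Pn; exists p.
move=> u; rewrite in_fset_of => uw; exists p => //.
apply: (@reach_path _ _ _ _ w) => //; last by rewrite inE uw orbT.
by move=> z; rewrite inE in_fsetU in_fset_of => /orP[/eqP->|->]; rewrite ?pX ?orbT.
Qed.

(* Once the pages no longer fit into k + 1, the tree is frozen at W', and
   the vertices of W outside W' pay for the rest. *)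
Definition budget W c := exists W' n,
  [/\ leafy E W' n, W' `<=` W, #|` W'| <= k.+1, W' = W \/ k <= #|` W'| + 10 * g + 1 &
      c + #|` W'| <= 10 * g * n + #|` W|].

Lemma budget_leq W c c' : c' <= c -> budget W c -> budget W c'.
Proof.
move=> cc [W' [n [h1 h2 h3 h4 h5]]]; exists W', n; split=> //.
by apply: leq_trans h5; rewrite leq_add2r.
Qed.

Lemma budget_add W c a v : budget W c -> a \in W -> E a v -> budget (v |` W) c.
Proof.
have [vW|vW] := boolP (v \in W).
  by have -> : v |` W = W by apply/fsetUidPr; rewrite fsub1set.
move=> [W' [n [h1 h2 h3 h4 h5]]] aW Eav.
have cv : #|` v |` W| = #|` W|.+1 by rewrite cardfsU1 vW.
case: (ltnP #|` W'| k.+1) => [lk|lk]; first case: h4 => h4.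
- subst W'; exists (v |` W), n; split; rewrite ?cv //.
  + exact: leafy_grow aW Eav vW.
  + by left.
  + by move: h5; clear; lia.
- exists W', n; split=> //.
  + by apply: fsubset_trans h2 _; exact: fsubsetUr.
  + by right.
  + by move: h5; rewrite cv; clear; lia.
exists W', n; split=> //.
- by apply: fsubset_trans h2 _; exact: fsubsetUr.
- by right; move: lk; clear; lia.
by move: h5; rewrite cv; clear; lia.
Qed.

(** While everything fits into [k + 1] pages, the new leaf pays [10 * g]. If the tree is frozen, or
    [B] forces it to be, the pages of [B] outside [W] pay instead. *)
Lemma budget_fork W c c' a v y z s : budget W c -> a \in W -> E a v -> E v y -> E v z ->
  v \notin W -> y \notin W -> z \notin W -> y != v -> z != v -> y != z -> path E y s ->
  let B := (z |` (y |` (v |` W))) `|` fset_of s in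
  #|` B| <= #|` W| + 10 * g + 1 -> c' <= c + 10 * g -> c' + #|` W| <= c + #|` B| ->
  budget B c'.
Proof.
move=> [W' [n [h1 h2 h3 h4 h5]]] aW Eav Evy Evz vW yW zW yv zv yz py B cB cc cB'.
have WB : W `<=` B.
  by apply/fsubsetP => u uW; rewrite !in_fsetU !in_fset1 uW !orbT.
have W'B := fsubset_trans h2 WB.
case: h4 => h4; last first.
  exists W', n; split=> //; first by right.
  by move: h5 cB'; clear; lia.
subst W'; case: (leqP #|` B| k.+1) => hB; last first.
  exists W, n; split=> //; first by right; move: hB cB; clear; lia.
  by move: h5 cB'; clear; lia.
exists B, n.+1; split=> //.
- apply: (@leafy_grows _ _ Esym _ _ y) py; first exact: leafy_fork Eav Evy Evz vW yW zW yv zv yz.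
  by rewrite !in_fsetU !in_fset1 eqxx !orbT.
- by left.
- by rewrite mulnS; move: h5 cc; clear; lia.
Qed.

Lemma card_add W s : uniq s -> #|` W `|` fset_of s| + count (mem W) s = #|` W| + size s.
Proof.
elim: s => [|v s IH] /=; first by have -> : W `|` fset_of [::] = W by apply/fsetP => z; rewrite !inE orbF.
move=> /andP[vs /IH h].
have -> : W `|` fset_of (v :: s) = v |` (W `|` fset_of s).
  by apply/fsetP => z; rewrite !inE; case: (z == v); rewrite ?orbT.
rewrite cardfsU1 in_fsetU in_fset_of (negbTE vs) orbF.
by move: h; case: (v \in W) => /=; clear; lia.
Qed.

(** [S] is the short side and [O] the long one, both read from [v]. The jump attaches [v] to [W],
    and [v] forks into the two sides, a new leaf. If the first page of [S] is in [W] already, then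
    [S] is that page alone, and the count over [W] has charged it before. *)
Lemma fork_step W b r pr v S O : pr \in W -> E pr v -> path E v S -> path E v O ->
    uniq (v :: S ++ O) -> v \notin W -> 0 < size S -> size S < 10 * g -> 1 < size O ->
    {in S, forall t, t \in W -> t = last v S} -> {in O, forall t, t \in W -> t = last v O} ->
    budget W (b + (count (mem W) S + count (mem W) O + r)) ->
  exists W2, [/\ v |` W `<=` W2, W2 `<=` (v |` W) `|` fset_of (S ++ O),
     {in O, forall t, t \in W2 -> t = head v O \/ t = last v O} &
     budget W2 (b + size S + (count (mem W2) O + r))].
Proof.
case: S => [//|y S]; case: O => [//|z O] prW Ev /andP[Evy pS] /andP[Evz pO].
rewrite cons_uniq => /andP[vSO uSO] vW _ Sg O1 SW OW bud.
have [yW|yW] := boolP (y \in W).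
  have S0 : S = [::].
    move: (SW y); rewrite inE eqxx => /(_ isT yW) /= e.
    case: (S) uSO e => // t S' /= /andP[yn _] e.
    by move: yn; rewrite -cat_cons mem_cat {1}e mem_last.
  subst S; exists (v |` W); split=> //.
  - by apply/fsubsetP => u uW; rewrite in_fsetU uW.
  - move=> t tO; rewrite in_fset1U => /orP[/eqP e|/(OW t tO)]; last by right.
    by move: vSO; rewrite mem_cat -e tO orbT.
  have -> : count (mem (v |` W)) (z :: O) = count (mem W) (z :: O).
    apply: eq_in_count => t tO; rewrite /= in_fset1U; case: eqP => // e.
    by move: vSO; rewrite mem_cat -e tO orbT.
  apply: budget_leq (budget_add bud prW Ev).
  by rewrite /= yW; clear; lia.
have zW : z \notin W.
  apply/negP => zW; move: (OW z); rewrite inE eqxx => /(_ isT zW) /= e.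
  case: (O) O1 uSO e => // t O' _; rewrite cat_uniq => /and3P[_ _] /= /andP[zn _] e.
  by move: zn; rewrite {1}e mem_last.
have yv : y != v by move: vSO; rewrite mem_cat !inE !negb_or eq_sym => /andP[/andP[]].
have zv : z != v by move: vSO; rewrite mem_cat !inE !negb_or => /andP[_ /andP[]]; rewrite eq_sym.
have yz : y != z.
  move: uSO; rewrite cat_cons cons_uniq mem_cat !inE !negb_or.
  by case/andP => /andP[_ /andP[]].
pose B := (z |` (y |` (v |` W))) `|` fset_of S.
have eB : B = (z |` (v |` W)) `|` fset_of (y :: S).
  by apply/fsetP => t; rewrite !inE; case: (t == z); case: (t == y); case: (t == v); rewrite ?orbT.
have cB : #|` B| + count (mem W) (y :: S) = #|` W| + 2 + (size S).+1.
  have uS : uniq (y :: S) by move: uSO; rewrite cat_uniq => /and3P[].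
  have := card_add (z |` (v |` W)) uS; rewrite -eB.
  have -> : count (mem (z |` (v |` W))) (y :: S) = count (mem W) (y :: S).
    apply: eq_in_count => t tS; rewrite /= !in_fset1U.
    have -> : t == z = false.
      apply/eqP => e; move: uSO; rewrite cat_uniq => /and3P[_ /hasPn /(_ z)].
      by rewrite inE eqxx => /(_ isT) /negP; rewrite -e.
    have -> : t == v = false by apply/eqP => e; move: vSO; rewrite mem_cat -e tS.
    by [].
  rewrite !cardfsU1 in_fset1U (negbTE zv) (negbTE zW) (negbTE vW) /=.
  by move=> ->; clear; lia.
have OB : {in z :: O, forall t, t \in B = (t == z) || (t \in W)}.
  move=> t tO; rewrite eB in_fsetU in_fset_of !in_fset1U.
  have -> : t == v = false by apply/eqP => e; move: vSO; rewrite mem_cat -e tO orbT.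
  have -> : t \in y :: S = false.
    by apply/negbTE; move: uSO; rewrite cat_uniq => /and3P[_ /hasPn /(_ t tO)].
  by rewrite orbF.
have cO : count (mem B) (z :: O) <= (count (mem W) (z :: O)).+1.
  rewrite /= OB ?inE ?eqxx //= (negbTE zW) !add0n add1n ltnS.
  apply: eq_leq; apply: eq_in_count => t tO /=.
  rewrite OB ?inE ?tO ?orbT //; case: eqP => // e.
  by move: uSO; rewrite cat_uniq /= -e tO !andbF.
exists B; split.
- by apply/fsubsetP => u uW; rewrite eB !in_fsetU; move: uW; rewrite in_fsetU => ->; rewrite orbT.
- apply/fsubsetP => u; rewrite !inE; case: (u == z); case: (u == y); case: (u == v); case: (u \in W); rewrite ?orbT //=.
  by case: (u \in S); rewrite ?orbT.
- move=> t tO; rewrite OB // => /orP[/eqP->|/(OW t tO)]; [by left|by right].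
have cle : count (mem W) (y :: S) <= (size S).+1 by exact: count_size.
apply: (@budget_fork W _ _ pr v y z S bud) => //; rewrite -/B.
- by move: cB Sg; rewrite /=; clear; lia.
- by move: cO Sg; rewrite [size (y :: S)]/=; move: (count _ _) (count _ (z :: O)) (count _ _); clear; lia.
- move: cO cB; rewrite [size (y :: S)]/=.
  by move: (count _ (y :: S)) (count _ (z :: O)) (count _ _); clear; lia.
Qed.

(** Pages of long gaps that serve as leaves of the tree although the walk has not visited them. They
    are charged in advance, as such a page may be a short side later on. *)
Definition fringe W L := \sum_(s <- L | 10 * g <= size s) count (mem W) s.

Definition ends_only W L := {in L, forall s, 10 * g <= size s ->
  {in s, forall z, z \in W -> z = head z s \/ z = last z s}}.

Lemma fringe_perm W L L' : perm_eq L L' -> fringe W L = fringe W L'.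
Proof. exact: perm_big. Qed.

Lemma fringe_cons W s L :
  fringe W (s :: L) = (if 10 * g <= size s then count (mem W) s else 0) + fringe W L.
Proof. by rewrite /fringe big_cons; case: ifP. Qed.

Lemma eq_fringe W W' L : {in flatten L, forall z, (z \in W) = (z \in W')} -> fringe W L = fringe W' L.
Proof.
move=> h; rewrite /fringe big_seq_cond [RHS]big_seq_cond; apply: eq_bigr => s /andP[sL _].
by apply: eq_in_count => z zs; apply: h; apply/flattenP; exists s.
Qed.

(** [W] contains the walk, so every jump starts in [W]. A gap that is still long meets [W] in its
    ends at most, so a page in its interior is new to [W] when the walk jumps to it, and [fork_step]
    applies. *)
Theorem budget_run K0 L0 p w L a b : gap_init G T K0 L0 -> p \in K0 -> path E p w ->
  run g L0 w L a b -> exists W,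
  [/\ K0 `|` fset_of w `<=` W, W `<=` vverts K0 L0 `|` fset_of w, ends_only W L &
      budget W (b + fringe W L)].
Proof.
move=> gi pK0 pw r.
have gok0 := gap_init_ok gi.
have cK0 : conn E K0 by have [h _ _ _] := gi; apply: conn_relW h => ? ? _ _; exact: gap_rel_step.
elim: r pw => [|{}w {}L {}a {}b v r IH vL|{}w {}L {}a {}b s1 v s2 L' r IH hp].
- move=> _; exists K0.
  have [_ _ dis _] := gi.
  have -> : fringe K0 L0 = 0.
    rewrite /fringe big_seq_cond big1 // => s /andP[sL _].
    apply/eqP; rewrite -leqn0 leqNgt -has_count; apply/hasP => -[z zs zK].
    have /dis : z \in flatten L0 by apply/flattenP; exists s.
    by move/negP; apply.
  split.
  + by apply/fsubsetP => z; rewrite !inE orbF.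
  + by apply/fsubsetP => z; rewrite !inE => ->.
  + move=> s sL _ z zs zK; have /dis : z \in flatten L0 by apply/flattenP; exists s.
    by rewrite zK.
  have l1 : leafy E [fset p] 0.
    apply: leafy_conn; first by apply/fset0Pn; exists p; rewrite inE.
    by move=> x y; rewrite !inE => /eqP-> /eqP->; apply: reach_refl; rewrite inE.
  have pK : [fset p] `<=` K0 by rewrite fsub1set.
  (* If the core alone has more than [k + 1] pages, the tree is frozen from the start, with no leaf
     guaranteed, and the remaining pages of the core are credit. *)
  have [hk|hk] := leqP #|` K0| k.+1.
    exists K0, 0; split=> //; [|by left|by rewrite muln0].
    by apply: leafy_conn => //; apply/fset0Pn; exists p.
  have [|W' [h1 h2 h3]] := @leafy_extend _ E Esym _ _ _ k.+1 l1 pK cK0.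
    by rewrite cardfs1 (ltnW hk).
  exists W', 0; split=> //; rewrite ?h3 //.
    by right; clear; lia.
  by rewrite muln0; move: hk; clear; lia.
- rewrite rcons_path => /andP[/IH[W [h1 h2 h3 h4]] Ev].
  have lW : last p w \in W.
    apply: (fsubsetP h1); have := mem_last p w; rewrite inE in_fsetU in_fset_of => /orP[/eqP->|->].
      by rewrite pK0.
    by rewrite orbT.
  exists (v |` W); split.
  + apply/fsubsetP => z; rewrite in_fsetU in_fset_of mem_rcons inE in_fset1U orbCA.
    by case: (z == v) => //= zX; apply: (fsubsetP h1); rewrite in_fsetU in_fset_of.
  + apply/fsubsetP => z; rewrite in_fset1U => /orP[/eqP->|/(fsubsetP h2)].
      by rewrite in_fsetU in_fset_of mem_rcons inE eqxx orbT.
    by rewrite !in_fsetU !in_fset_of mem_rcons inE => /orP[->//|->]; rewrite !orbT.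
  + move=> s sL hs z zs; rewrite in_fset1U => /orP[/eqP e|]; last exact: h3.
    by exfalso; move/negP: vL; apply; apply/flattenP; exists s; rewrite -?e.
  rewrite (@eq_fringe _ W); first exact: budget_add h4 lW Ev.
  by move=> z zL; rewrite in_fset1U; case: eqP => // e; move: vL; rewrite -e zL.
rewrite rcons_path => /andP[/IH[W [h1 h2 h3 h4]] Ev].
have lW : last p w \in W.
  apply: (fsubsetP h1); have := mem_last p w; rewrite inE in_fsetU in_fset_of => /orP[/eqP->|->].
    by rewrite pK0.
  by rewrite orbT.
have gok := run_gaps_ok gok0 r.
have pf := flatten_split hp.
have uL : uniq (v :: flatten (s1 :: s2 :: L')) by rewrite -(perm_uniq pf); case: gok.
have sL : s1 ++ v :: s2 \in L by rewrite (perm_mem hp) inE eqxx.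
have [_ /(_ _ sL)[x [y [_ _ ch]]]] := gok.
set s := s1 ++ v :: s2 in hp sL ch *.
have us : uniq s by have [u _] := gok; move: u; rewrite (perm_uniq (perm_flatten hp)) /= cat_uniq => /andP[].
have sub0 : {subset s <= vverts K0 L0}.
  by move=> z zs; rewrite in_fsetU in_fset_of (run_subset r) ?orbT //; apply/flattenP; exists s.
have L's z : z \in flatten L' -> z \notin s.
  have [u _] := gok; move: u; rewrite (perm_uniq (perm_flatten hp)) /= cat_uniq => /and3P[_ /hasPn h _].
  exact: h.
have L'L : {subset L' <= L} by move=> t tL; rewrite (perm_mem hp) inE tL orbT.
have finish W2 b' : v |` W `<=` W2 -> W2 `<=` (v |` W) `|` fset_of s ->
   (10 * g <= size s1 -> {in s1, forall z, z \in W2 -> z = head z s1 \/ z = last z s1}) ->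
   (10 * g <= size s2 -> {in s2, forall z, z \in W2 -> z = head z s2 \/ z = last z s2}) ->
   budget W2 (b' + ((if 10 * g <= size s1 then count (mem W2) s1 else 0) +
                   ((if 10 * g <= size s2 then count (mem W2) s2 else 0) + fringe W L'))) ->
   exists W,
  [/\ K0 `|` fset_of (rcons w v) `<=` W, W `<=` vverts K0 L0 `|` fset_of (rcons w v), ends_only W (s1 :: s2 :: L') &
      budget W (b' + fringe W (s1 :: s2 :: L'))].
  move=> hW hW2 e1 e2 hb.
  have W2s z : z \notin s -> (z \in W2) = (z \in W).
    move=> zs; have zv : z != v by apply: contraNneq zs => ->; rewrite mem_cat inE eqxx orbT.
    apply/idP/idP => [/(fsubsetP hW2)|zW].
      by rewrite in_fsetU in_fset_of (negbTE zs) in_fset1U (negbTE zv) orbF.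
    by apply: (fsubsetP hW); rewrite in_fset1U zW orbT.
  exists W2; split.
  - apply/fsubsetP => z; rewrite in_fsetU in_fset_of mem_rcons inE orbCA => hz.
    apply: (fsubsetP hW); rewrite in_fset1U; case/orP: hz => [->//|hz].
    by apply/orP; right; apply: (fsubsetP h1); rewrite in_fsetU in_fset_of.
  - apply/fsubsetP => z /(fsubsetP hW2); rewrite in_fsetU in_fset1U in_fset_of => /orP[/orP[/eqP->|/(fsubsetP h2)]|/sub0].
    + by rewrite in_fsetU in_fset_of mem_rcons inE eqxx orbT.
    + by rewrite !in_fsetU !in_fset_of mem_rcons inE => /orP[->//|->]; rewrite !orbT.
    by rewrite [in X in _ -> X]in_fsetU => ->.
  - move=> t; rewrite !inE => /or3P[/eqP->|/eqP->|tL'] //.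
    move=> ht z zt; rewrite W2s; last by apply: L's; apply/flattenP; exists t.
    by apply: h3 => //; exact: L'L.
  rewrite !fringe_cons (@eq_fringe _ W) // => z zL'.
  by apply: W2s; exact: L's.
rewrite (fringe_perm _ hp) fringe_cons in h4.
have endsS : 10 * g <= size s -> {in s, forall z, z \in W -> z = head z s \/ z = last z s} by exact: h3.
have v1 : v \notin s1 by move: us; rewrite cat_uniq /= negb_or => /and3P[_ /andP[]].
have v2 : v \notin s2 by move: us; rewrite cat_uniq /= => /and3P[_ _ /andP[]].
have d12 : {in s1, forall z, z \notin s2}.
  move=> z z1; apply/negP => z2; move: us; rewrite cat_uniq => /and3P[_ /hasPn h _].
  by move: (h z); rewrite inE z2 orbT => /(_ isT); rewrite /= z1.
have far1 : 10 * g <= size s -> {in s1, forall z, z \in W -> z = head z s1}.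
  move=> hs z z1 zW; have zs : z \in s by rewrite mem_cat z1.
  case: (endsS hs z zs zW) => e; first by rewrite {1}e /s; case: (s1) z1.
  exfalso; move: e; rewrite /s last_cat /= => e.
  have := mem_last v s2; rewrite -e inE (negbTE (d12 z z1)) orbF => /eqP ez.
  by move: v1; rewrite -ez z1.
have far2 : 10 * g <= size s -> {in s2, forall z, z \in W -> z = last z s2}.
  move=> hs z z2 zW; have zs : z \in s by rewrite mem_cat inE z2 !orbT.
  case: (endsS hs z zs zW) => e; last by rewrite {1}e /s last_cat; case: (s2) z2.
  exfalso; move: e; rewrite /s; case: (s1) d12 => [|t s1'] d /= e.
    by move: v2; rewrite -e z2.
  by move: (d t); rewrite inE eqxx => /(_ isT); rewrite -e z2.
have cs W2 : count (mem W2) s = count (mem W2) s1 + (v \in W2) + count (mem W2) s2.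
  by rewrite /s count_cat /= addnA.
have plain : {in s1, forall z, (z \in v |` W) = (z \in W)} /\ {in s2, forall z, (z \in v |` W) = (z \in W)}.
  by split=> z zs; rewrite in_fset1U; case: eqP => // e; move: v1 v2; rewrite -e ?zs.
have sz : size s = size s1 + (size s2).+1 by rewrite size_cat.
(* Unless a long gap is split with a short nonempty side, [incB] is zero and [v] merely joins
   [W]. *)
case: (boolP ((10 * g <= size s) && (0 < minn (size s1) (size s2) < 10 * g))); last first.
  move=> hn; have -> : b + incB g (size s) (minn (size s1) (size s2)) = b.
    rewrite /incB; case: ifP => [/andP[h5 h6]|_]; last by rewrite addn0.
    by move: hn; rewrite h5 h6 andbT lt0n negbK => /eqP->; rewrite addn0.
  apply: (finish (v |` W)) => //.
  - exact: fsubsetUl.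
  - by move=> hs z z1; rewrite plain.1 // => zW; left; apply: far1 => //; rewrite sz; move: hs; clear; lia.
  - by move=> hs z z2; rewrite plain.2 // => zW; right; apply: far2 => //; rewrite sz; move: hs; clear; lia.
  apply: budget_leq (budget_add h4 lW Ev); rewrite leq_add2l addnA leq_add2r.
  have -> : count (mem (v |` W)) s1 = count (mem W) s1 by apply: eq_in_count; exact: plain.1.
  have -> : count (mem (v |` W)) s2 = count (mem W) s2 by apply: eq_in_count; exact: plain.2.
  rewrite cs sz; move: (count (mem W) s1) (count (mem W) s2) (v \in W) (size s1) (size s2) => c1 c2 bv n1 n2.
  by case: (leqP (10 * g) n1) => l1; case: (leqP (10 * g) n2) => l2; case: (leqP (10 * g) (n1 + n2.+1)) => l3; move: l1 l2 l3; clear; lia.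
case/and3P => hs m0 mg; rewrite /incB hs mg; rewrite hs cs in h4.
have vW : v \notin W.
  apply/negP => vW; have vs : v \in s by rewrite mem_cat inE eqxx orbT.
  case: (endsS hs v vs vW); rewrite /s.
    by case: (s1) v1 m0 => [|t s1'] /=; rewrite ?min0n // inE negb_or => /andP[/eqP h _] _ /h.
  rewrite last_cat /= => e; have := mem_last v s2; rewrite -e.
  case: (s2) e v2 m0 => [|t s2'] /= e; first by rewrite minn0.
  by rewrite e mem_last.
have pv1 : path E v (rev s1).
  have [c1 _ _ _ _] := chain_split ch.
  have := chain_path1 (chain_rev Tsym c1); apply: sub_path; exact: TE.
have pv2 : path E v s2.
  by have [_ _ _ _ c2] := chain_split ch; apply: sub_path (chain_path1 c2).
have hd0 : head v (rev s1) = last v s1 by case/lastP: (s1) => // t z; rewrite rev_rcons last_rcons.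
have la0 : last v (rev s1) = head v s1 by case: (s1) => // t z; rewrite rev_cons last_rcons.
rewrite (negbTE vW) addn0 in h4.
have cr W2 : count (mem W2) (rev s1) = count (mem W2) s1 by rewrite count_rev.
have dflt (t z : V) (l : seq V) : t \in l -> head z l = head t l /\ last z l = last t l by case: l.
have [le|lt] := leqP (size s1) (size s2).
  have m1 : minn (size s1) (size s2) = size s1 by exact/minn_idPl.
  rewrite m1 in m0 mg *.
  have := @fork_step W b (fringe W L') (last p w) v (rev s1) s2 lW Ev pv1 pv2.
  rewrite !cr !size_rev.
  have -> : uniq (v :: rev s1 ++ s2).
    rewrite /= mem_cat mem_rev negb_or v1 v2 cat_uniq rev_uniq.
    move: us; rewrite cat_uniq /= => /and3P[-> _ /andP[_ ->]]; rewrite andbT.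
    by apply/hasPn => z z2; rewrite /= mem_rev; apply/negP => /d12; rewrite z2.
  have O1 : 1 < size s2 by move: hs le g0; rewrite sz; clear; lia.
  move=> /(_ isT vW m0 mg O1) [].
  - by move=> t; rewrite mem_rev => t1 /(far1 hs t t1) e; rewrite la0 (dflt t v s1 t1).1.
  - by move=> t t2 /(far2 hs t t2) e; rewrite (dflt t v s2 t2).2.
  - exact: h4.
  move=> W2 [w1 w2 w3 w4]; apply: (finish W2) => //.
  - apply: fsubset_trans w2 _; apply: fsetUS; apply/fsubsetP => z.
    by rewrite !in_fset_of /s !mem_cat mem_rev inE => /orP[]->; rewrite ?orbT.
  - by move=> hh; move: mg; rewrite ltnNge hh.
  - move=> _ z z2 /(w3 z z2); have [-> ->] := dflt z v s2 z2; by [].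
  rewrite leqNgt mg /= add0n; apply: budget_leq w4.
  by rewrite leq_add2l leq_add2r; case: ifP.
have m2 : minn (size s1) (size s2) = size s2 by apply/minn_idPr; exact: ltnW.
rewrite m2 in m0 mg *.
have := @fork_step W b (fringe W L') (last p w) v s2 (rev s1) lW Ev pv2 pv1.
rewrite !cr !size_rev.
have -> : uniq (v :: s2 ++ rev s1).
  rewrite /= mem_cat mem_rev negb_or v1 v2 cat_uniq rev_uniq.
  move: us; rewrite cat_uniq /= => /and3P[-> _ /andP[_ ->]]; rewrite andbT /=.
  by apply/hasPn => z; rewrite mem_rev => /d12.
have O1 : 1 < size s1 by move: hs lt g0; rewrite sz; clear; lia.
move=> /(_ isT vW m0 mg O1) [].
- by move=> t t2 /(far2 hs t t2) e; rewrite (dflt t v s2 t2).2.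
- by move=> t; rewrite mem_rev => t1 /(far1 hs t t1) e; rewrite la0 (dflt t v s1 t1).1.
- by rewrite [X in b + (X + _)]addnC.
move=> W2 [w1 w2 w3 w4]; apply: (finish W2) => //.
- apply: fsubset_trans w2 _; apply: fsetUS; apply/fsubsetP => z.
  by rewrite !in_fset_of /s !mem_cat mem_rev inE => /orP[]->; rewrite ?orbT.
- move=> _ z z1; have z1' : z \in rev s1 by rewrite mem_rev.
  move=> /(w3 z z1'); rewrite hd0 la0; have [-> ->] := dflt z v s1 z1.
  by case; [right|left].
- by move=> hh; move: mg; rewrite ltnNge hh.
rewrite [10 * g <= size s2]leqNgt mg /= add0n; apply: budget_leq w4.
by rewrite cr leq_add2l leq_add2r; case: ifP.
Qed.

Lemma card_gap_init K0 L0 : gap_init G T K0 L0 ->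
  #|` vverts K0 L0| = #|` K0| + size (flatten L0).
Proof. by move=> gi; apply: (card_vverts (E := E)); exact: (exch_vstruct TE (exch_init gi)). Qed.

Lemma gap_init_conn K0 L0 : gap_init G T K0 L0 -> conn E (vverts K0 L0).
Proof. by move=> gi; apply: vstruct_conn; exact: (exch_vstruct TE (exch_init gi)). Qed.

(** A gap attached to the core adds its last page as a leaf, worth [10 * g]. Gaps are added up to
    the first that does not fit into [k + 1] pages; that one counts at most [10 * g], and the later
    ones at most their pages, all of which are in excess of [k + 1]. *)
Lemma leafy_gaps K0 L K W n :
    [/\ K `<=` W, K != fset0, conn E K, {in W `\` K, forall v, exists2 u, u \in K & E u v} &
      n <= #|` W `\` K|] -> K0 `<=` K ->
    {in L, forall s, s != [::] /\ exists2 x, x \in K0 & path E x s} ->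
    uniq (flatten L) -> {in flatten L, forall v, v \notin W} -> #|` W| <= k.+1 ->
  exists W2 n2, [/\ leafy E W2 n2, W2 `<=` W `|` fset_of (flatten L), #|` W2| <= k.+1 &
    \sum_(s <- L) minn (10 * g) (size s) + 10 * g * n <=
      10 * g * n2 + 10 * g + (#|` W| + size (flatten L) - k.+1)].
Proof.
elim: L K W n => [|s L IH] K W n lK K0K hL uL dL Wk.
  exists W, n; split=> //; first by exists K.
    exact: fsubsetUl.
  by rewrite big_nil add0n -addnA leq_addr.
have [s0 [x xK0 px]] := hL s (mem_head _ _).
have hL' : {in L, forall s, s != [::] /\ exists2 x, x \in K0 & path E x s}.
  by move=> t tL; apply: hL; rewrite inE tL orbT.
move: uL; rewrite [flatten _]/= cat_uniq => /and3P[us /hasPn d uL].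
have ds : {in s, forall v, v \notin W} by move=> v vs; apply: dL; rewrite /= mem_cat vs.
have dL' : {in flatten L, forall v, v \notin W} by move=> v vs; apply: dL; rewrite /= mem_cat vs orbT.
have cW : #|` W `|` fset_of s| = #|` W| + size s.
  have := card_add W us; suff -> : count (mem W) s = 0 by rewrite addn0.
  by apply/eqP; rewrite -leqn0 leqNgt -has_count; apply/hasPn => v /ds.
have [small|big] := leqP (#|` W| + size s) k.+1; last first.
  exists W, n; have [h1 h2 h3 h4 h5] := lK; split=> //; first by exists K.
    exact: fsubsetUl.
  have : \sum_(i <- L) minn (10 * g) (size i) <= size (flatten L).
    rewrite size_flatten /shape sumnE big_map; apply: leq_sum => i _; exact: geq_minr.
  rewrite big_cons size_cat; have := geq_minl (10 * g) (size s).
  by move: big; clear; lia.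
case/lastP: s => [//|s z] in s0 px us d ds cW small hL dL *.
have [h1 h2 h3 h4 h5] := lK.
have [||||||W2 [n2 [e1 e2 e3 e4]]] := IH (K `|` fset_of s) (W `|` fset_of (rcons s z)) n.+1.
- have zs : z \notin s by move: us; rewrite rcons_uniq => /andP[].
  have xK : x \in K := fsubsetP K0K x xK0.
  have subK : {subset x :: s <= K `|` fset_of s}.
    by move=> v; rewrite inE in_fsetU in_fset_of => /orP[/eqP->|->]; rewrite ?xK ?orbT.
  move: px; rewrite rcons_path => /andP[px Ez].
  split.
  + apply/fsubsetP => v; rewrite !in_fsetU !in_fset_of mem_rcons inE.
    by case/orP => [/(fsubsetP h1)->|->]; rewrite ?orbT.
  + exact: fsetU_neq0.
  + apply: conn_add => // v; rewrite in_fset_of => vs; exists x => //.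
    by apply: (reach_path px) => //; rewrite inE vs orbT.
  + move=> v; rewrite in_fsetD !in_fsetU !in_fset_of mem_rcons inE negb_or.
    case/andP => /andP[vK vs]; rewrite (negbTE vs) orbF => /orP[vW|/eqP->].
      by have [|u uK Euv] := h4 v; [rewrite in_fsetD vK|exists u; rewrite // in_fsetU uK].
    by exists (last x s) => //; apply: subK; exact: mem_last.
  apply: leq_trans (_ : #|` z |` (W `\` K)| <= _).
    have zW : z \notin W by apply: ds; rewrite mem_rcons inE eqxx.
    by rewrite cardfsU1 in_fsetD (negbTE zW) andbF add1n ltnS.
  apply: fsubset_leq_card; apply/fsubsetP => v.
  rewrite in_fset1U !in_fsetD !in_fsetU !in_fset_of mem_rcons inE negb_or.
  case/orP => [/eqP->|/andP[vK vW]].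
    rewrite eqxx zs orbT !andbT; apply/negP => /(fsubsetP h1); apply/negP.
    by apply: ds; rewrite mem_rcons inE eqxx.
  rewrite vK vW /= andbT; apply/negP => vs.
  by move: (ds v); rewrite mem_rcons inE vs orbT vW => /(_ isT).
- by apply: fsubset_trans K0K _; exact: fsubsetUl.
- exact: hL'.
- exact: uL.
- move=> v vL; rewrite in_fsetU in_fset_of negb_or dL' //=.
  by apply/negP => vs; move: (d v vL); rewrite /= vs.
- by rewrite cW.
exists W2, n2; split=> //.
  apply: fsubset_trans e2 _; apply/fsubsetP => v.
  by rewrite !in_fsetU !in_fset_of /= mem_cat orbA.
move: e4; rewrite cW big_cons mulnS size_cat; have := geq_minl (10 * g) (size (rcons s z)).
by clear; lia.
Qed.

Variables (A : online V) (q c0 : nat).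
Hypothesis k0 : 0 < k.
Hypothesis Alegal : online_legal k A.
Hypothesis comp : forall s, s \in paths G -> cost k A s <= q * OPT k s + c0.

Lemma leafy_bound_in X W n : leafy E W n -> W `<=` X -> conn E X -> #|` W| <= k.+1 ->
  k < #|` X| -> n <= q + 2.
Proof.
move=> lW WX cX Wk Xk.
have [|W' [h1 h2 h3]] := @leafy_extend _ E Esym _ _ _ k.+1 lW WX cX; first by rewrite Wk.
exact: (leafy_bound Gsym k0 Alegal comp h3 h1).
Qed.

(** The constant is [20 + 12]: [q + 2] leaves are worth [10 * g * q + 20 * g], and at most
    [11 * g + 1] pages lie outside a frozen tree. *)
Theorem runB_bound K0 L0 p w L a b : gap_init G T K0 L0 -> p \in K0 -> path E p w ->
  run g L0 w L a b -> k < #|` vverts K0 L0| -> #|` vverts K0 L0 `|` fset_of w| <= k + g ->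
  b <= 10 * g * q + 32 * g.
Proof.
move=> gi pK0 pw r X0k Xk.
have [W [h1 h2 h3 [W' [n [l1 l2 l3 l4 l5]]]]] := budget_run gi pK0 pw r.
have cX : conn E (vverts K0 L0 `|` fset_of w).
  by apply: conn_walk pw; [exact: gap_init_conn|rewrite in_fsetU pK0].
have nq : n <= q + 2.
  apply: (leafy_bound_in l1 _ cX l3); first exact: fsubset_trans h2.
  apply: leq_trans X0k _; apply: fsubset_leq_card; exact: fsubsetUl.
have : 10 * g * n <= 10 * g * (q + 2) by rewrite leq_mul2l nq orbT.
have := leq_trans (fsubset_leq_card h2) Xk; rewrite mulnDr.
case: l4 => l4; first by subst W'; move: l5; clear; lia.
by move: l5 l4 g0; move: (10 * g * n) (10 * g * q); clear; lia.
Qed.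

(** The constant is [20 + 10 + 1]: the leaves, the first gap that does not fit, and the pages in
    excess of [k + 1]. *)
Theorem initB_bound K0 L0 : gap_init G T K0 L0 -> k < #|` vverts K0 L0| ->
  #|` vverts K0 L0| <= k + g -> K0 != fset0 ->
  \sum_(s <- L0) minn (10 * g) (size s) <= 10 * g * q + 31 * g.
Proof.
move=> gi X0k Xk K00.
have [cK uL dL vL] := gi; have cX := card_gap_init gi.
have sumle : \sum_(i <- L0) minn (10 * g) (size i) <= size (flatten L0).
  rewrite size_flatten /shape sumnE big_map; apply: leq_sum => i _; exact: geq_minr.
have [hk|hk] := leqP #|` K0| k.+1; last first.
  by move: sumle Xk hk; rewrite cX; clear; lia.
have [||||||W2 [n2 [e1 e2 e3 e4]]] := @leafy_gaps K0 L0 K0 K0 0 => //.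
- split=> //; first by apply: conn_relW cK => ? ? _ _; exact: gap_rel_step.
  by move=> v; rewrite fsetDv inE.
- move=> s /vL[s0 [x [y [xK yK ch]]]]; split=> //; exists x => //.
  by apply: sub_path (chain_path1 ch).
have nq := leafy_bound_in e1 e2 (gap_init_conn gi) e3 X0k.
have : 10 * g * n2 <= 10 * g * (q + 2) by rewrite leq_mul2l nq orbT.
move: e4 Xk; rewrite cX muln0 addn0 mulnDr.
by clear -g0; lia.
Qed.

End RunB.

(** * The potential of the gaps *)

Section Potential.
Variables (V : choiceType) (g : nat).
Hypothesis g0 : 0 < g.
Implicit Types (u v w z : V) (s : seq V) (e : nat) (H S : pred V).

(* A gap with, for each end, a flag that is 1 when the end is an end of an
   initial gap; the outer neighbour of an end with flag 0 is marked. *)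
Definition gap : Type := nat * seq V * nat.
Implicit Types (c : gap) (C : seq gap).
Definition seg c := c.1.2.
Definition segs C := [seq seg c | c <- C].

(** A victim may miss the middle because up to [g] pages nearer to the midpoint are holes. With
    [2 * g] subtracted, the sides of such a victim still lose a level. *)
Definition psi n e := if n < 10 * g then 0 else lev g (n - 2 * g) + e.

Lemma psi_mono n m e e' : n <= m -> e <= e' -> psi n e <= psi m e'.
Proof.
move=> nm ee; rewrite /psi; case: (ltnP n) => // h; case: (ltnP m) => h'.
  by move: h h' nm; clear; lia.
by apply: leq_add => //; apply: lev_mono; apply: leq_sub2r.
Qed.

Definition hole_pot c z :=
  let s := seg c in maxn (psi (index z s) c.1.1) (psi (size s - (index z s).+1) c.2).

Definition hole_part H c :=
  (g - count H (seg c)) * psi (size (seg c)) (c.1.1 + c.2) +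
  \sum_(z <- seg c | H z) hole_pot c z.

Definition stale_part S c := minn (10 * g) (count S (seg c)).

Definition pot H S C := \sum_(c <- C) (hole_part H c + stale_part S c).

Lemma pot_cons H S c C : pot H S (c :: C) = hole_part H c + stale_part S c + pot H S C.
Proof. by rewrite /pot big_cons. Qed.

Lemma eq_pot H H' S S' C : {in flatten (segs C), H =1 H'} -> {in flatten (segs C), S =1 S'} ->
  pot H S C = pot H' S' C.
Proof.
move=> eH eS; rewrite /pot big_seq [RHS]big_seq; apply: eq_bigr => c cC.
have sub z : z \in seg c -> z \in flatten (segs C).
  by move=> zc; apply/flattenP; exists (seg c) => //; exact: map_f.
rewrite /hole_part /stale_part.
have -> : count H (seg c) = count H' (seg c) by apply: eq_in_count => z /sub/eH.
have -> : count S (seg c) = count S' (seg c) by apply: eq_in_count => z /sub/eS.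
congr (_ + _ + _); rewrite big_seq_cond [RHS]big_seq_cond; apply: eq_bigl => z.
by case: (boolP (z \in seg c)) => //= /sub/eH.
Qed.

Lemma hole_part_small H c : size (seg c) < 10 * g -> hole_part H c = 0.
Proof.
move=> h; rewrite /hole_part {1}/psi h muln0 add0n big_seq_cond big1 // => z /andP[zs _].
rewrite /hole_pot /psi; have iz : index z (seg c) < size (seg c) by rewrite index_mem.
by rewrite !ifT //; move: h iz; clear; lia.
Qed.

Lemma index_mid s1 w s2 : w \notin s1 -> index w (s1 ++ w :: s2) = size s1.
Proof. by move=> ws; rewrite index_cat (negbTE ws) /= eqxx addn0. Qed.

(** In a long gap a token falls from the value of the gap to that of a side of [w], which is smaller
    by the last hypothesis. In a short gap the cap [10 * g] is not reached, so one stale page less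
    lowers [stale_part]. *)
Lemma pot_evict H H' S S' C e s1 w s2 e' C' :
    perm_eq C ((e, s1 ++ w :: s2, e') :: C') -> uniq (flatten (segs C)) ->
    S w -> ~~ H w -> (forall z, H' z = (z == w) || H z) -> (forall z, S' z = (z != w) && S z) ->
    count H' (s1 ++ w :: s2) <= g ->
    (10 * g <= size (s1 ++ w :: s2) ->
      maxn (psi (size s1) e) (psi (size s2) e') < psi (size (s1 ++ w :: s2)) (e + e')) ->
  pot H' S' C < pot H S C.
Proof.
move=> hp uC Sw Hw eH eS cH big.
have uC' : uniq (flatten (segs ((e, s1 ++ w :: s2, e') :: C'))).
  by rewrite -(perm_uniq (perm_flatten (perm_map seg hp))).
rewrite /pot !(perm_big _ hp) /= -!/(pot _ _ _) !pot_cons.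
have us : uniq (s1 ++ w :: s2) by move: uC'; rewrite /= cat_uniq => /andP[].
have w1 : w \notin s1 by move: us; rewrite cat_uniq /= negb_or => /and3P[_ /andP[]].
have w2 : w \notin s2 by move: us; rewrite cat_uniq /= => /and3P[_ _ /andP[]].
have wC : w \notin flatten (segs C').
  move: uC'; rewrite /= cat_uniq => /and3P[_ /hasPn h _]; apply/negP => /h.
  by rewrite /= mem_cat inE eqxx orbT.
have ne z s : w \notin s -> z \in s -> (z == w) = false.
  by move=> ws zs; apply/negbTE; apply: contraNneq ws => <-.
rewrite (@eq_pot H' H S' S C'); first last.
- by move=> z zC; rewrite eS (ne z _ wC zC).
- by move=> z zC; rewrite eH (ne z _ wC zC).
rewrite ltn_add2r.
have cH' : count H' (s1 ++ w :: s2) = (count H (s1 ++ w :: s2)).+1.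
  rewrite !count_cat /= eH eqxx (negbTE Hw) /= add0n addnS.
  congr (_ + _).+1; apply: eq_in_count => z zs; rewrite eH.
    by rewrite (ne z _ w1 zs).
  by rewrite (ne z _ w2 zs).
have cS' : count S (s1 ++ w :: s2) = (count S' (s1 ++ w :: s2)).+1.
  rewrite !count_cat /= eS eqxx Sw /= add0n addnS.
  congr (_ + _).+1; apply: eq_in_count => z zs; rewrite eS.
    by rewrite (ne z _ w1 zs).
  by rewrite (ne z _ w2 zs).
have [small|hbig] := ltnP (size (s1 ++ w :: s2)) (10 * g).
  rewrite !hole_part_small // !add0n /stale_part /= cS'.
  have := count_size S (s1 ++ w :: s2); rewrite cS'; move: small.
  by move: (count _ _) (size _); clear; lia.
have {}big := big hbig.
have hs : stale_part S' (e, s1 ++ w :: s2, e') <= stale_part S (e, s1 ++ w :: s2, e').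
  by rewrite /stale_part /= cS'; move: (count _ _); clear; lia.
suff : hole_part H' (e, s1 ++ w :: s2, e') < hole_part H (e, s1 ++ w :: s2, e').
  by move: hs; clear; lia.
rewrite /hole_part /= cH'.
have -> : \sum_(z <- s1 ++ w :: s2 | H' z) hole_pot (e, s1 ++ w :: s2, e') z =
   hole_pot (e, s1 ++ w :: s2, e') w + \sum_(z <- s1 ++ w :: s2 | H z) hole_pot (e, s1 ++ w :: s2, e') z.
  rewrite !big_cat /= !big_cons eH eqxx (negbTE Hw) /=.
  rewrite addnCA; congr (_ + (_ + _)); rewrite big_seq_cond [RHS]big_seq_cond; apply: eq_bigl => z;
  rewrite eH; case: (boolP (z \in _)) => //= zs.
    by rewrite (ne z _ w1 zs).
  by rewrite (ne z _ w2 zs).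
have -> : hole_pot (e, s1 ++ w :: s2, e') w = maxn (psi (size s1) e) (psi (size s2) e').
  rewrite /hole_pot /= index_mid //; congr (maxn _ (psi _ _)).
  by rewrite size_cat /=; clear; lia.
move: cH; rewrite cH' => cH; rewrite addnA ltn_add2r.
have -> : g - count H (s1 ++ w :: s2) = (g - (count H (s1 ++ w :: s2)).+1).+1.
  by move: cH; clear; lia.
by rewrite mulSn addnC ltn_add2r.
Qed.

(** A flag adds at most 1 to a level that is at least 4 when both sides are long; the factor 2
    covers it. *)
Lemma psi_incA n m e e' : e <= 1 -> e' <= 1 ->
  minn (psi n e) (psi m e') <= 2 * incA g (minn n m).
Proof.
move=> e1 e1'; rewrite /incA.
have [h|h] := leqP (10 * g) (minn n m); last first.
  move: h; rewrite /psi; case: (ltnP n) => hn; case: (ltnP m) => hm; rewrite ?min0n ?minn0 //.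
  by move: hn hm; clear; lia.
have l4 := lev_ge4 g0 h.
have hx x f : f <= 1 -> psi x f <= lev g x + 1.
  rewrite /psi => f1; case: ifP => // _; apply: leq_add => //.
  by apply: lev_mono; exact: leq_subr.
have [le|lt] := leqP n m.
  have := hx n e e1; move: l4; rewrite (minn_idPl le).
  by have := geq_minl (psi n e) (psi m e'); clear; lia.
have := hx m e' e1'; move: l4; rewrite (minn_idPr (ltnW lt)).
by have := geq_minr (psi n e) (psi m e'); clear; lia.
Qed.

Lemma split_arith (h1 h2 hv n A B M p1 p2 q1 q2 : nat) :
  h1 + (hv + h2) <= n -> maxn A B <= M ->
  p1 + h1 * B <= q1 + h1 * minn A B -> p2 + h2 * A <= q2 + h2 * minn A B ->
  (n - h1) * A + p1 + ((n - h2) * B + p2) <=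
  (n - (h1 + (hv + h2))) * M + (q1 + hv * maxn A B + q2) + n * minn A B.
Proof.
move=> hn hM S1 S2.
have [d ->] : exists d, n = h1 + (hv + h2) + d.
  by exists (n - (h1 + (hv + h2))); move: hn; clear; lia.
have -> : h1 + (hv + h2) + d - h1 = hv + h2 + d by clear; lia.
have -> : h1 + (hv + h2) + d - h2 = h1 + hv + d by clear; lia.
have -> : h1 + (hv + h2) + d - (h1 + (hv + h2)) = d by clear; lia.
have eAB : A + B = maxn A B + minn A B by clear; lia.
have D1 : d * A + d * B <= d * M + d * minn A B.
  by rewrite -!mulnDr leq_mul2l; apply/orP; right; move: hM; clear; lia.
have D2 : hv * A + hv * B = hv * maxn A B + hv * minn A B by rewrite -!mulnDr eAB.
rewrite !mulnDl; move: S1 S2 D1 D2; clear; move: (maxn A B) (minn A B) => X Y.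
by move: (h1 * B) (h1 * Y) (h2 * A) (h2 * Y) (d * A) (d * B) (d * M) (d * Y) (hv * A) (hv * B) (hv * X) (hv * Y); lia.
Qed.

Lemma hole_part_split H e s1 v s2 e' : uniq (s1 ++ v :: s2) -> count H (s1 ++ v :: s2) <= g ->
  hole_part H (e, s1, 0) + hole_part H (0, s2, e') <=
  hole_part H (e, s1 ++ v :: s2, e') + g * minn (psi (size s1) e) (psi (size s2) e').
Proof.
move=> us cH; set A := psi (size s1) e; set B := psi (size s2) e'.
have v1 : v \notin s1 by move: us; rewrite cat_uniq /= negb_or => /and3P[_ /andP[]].
have d21 : {in s2, forall z, z \notin s1}.
  move=> z zs; move: us; rewrite cat_uniq /= => /and3P[_ + _].
  by rewrite negb_or => /andP[_ /hasPn h]; exact: h.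
have v2 : v \notin s2 by move: us; rewrite cat_uniq /= => /and3P[_ _ /andP[]].
rewrite /hole_part /= !addn0 !add0n -/A -/B.
pose F := hole_pot (e, s1 ++ v :: s2, e').
have hC : maxn A B <= psi (size (s1 ++ v :: s2)) (e + e').
  rewrite geq_max; apply/andP; split; apply: psi_mono; rewrite ?leq_addr ?leq_addl //;
  by rewrite size_cat /= ; clear; lia.
have f1 z : z \in s1 -> hole_pot (e, s1, 0) z + B <= F z + minn A B.
  move=> zs; rewrite /F /hole_pot /= index_cat zs.
  have iz : index z s1 < size s1 by rewrite index_mem.
  set i := index z s1 in iz *.
  have l1 : psi (size s1 - i.+1) 0 <= psi (size (s1 ++ v :: s2) - i.+1) e'.
    by apply: psi_mono => //; rewrite size_cat /=; clear; lia.
  have l2 : psi i e <= A by apply: psi_mono => //; exact: ltnW.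
  have l3 : psi (size s1 - i.+1) 0 <= A by apply: psi_mono => //; exact: leq_subr.
  have l4 : B <= psi (size (s1 ++ v :: s2) - i.+1) e'.
    by apply: psi_mono => //; rewrite size_cat /=; move: iz; clear; lia.
  by move: l1 l2 l3 l4; move: (psi _ _) (psi _ _) (psi _ _); clear; lia.
have f2 z : z \in s2 -> hole_pot (0, s2, e') z + A <= F z + minn A B.
  move=> zs; rewrite /F /hole_pot /= index_cat (negbTE (d21 z zs)) /=.
  have -> : v == z = false by apply/eqP => ez; move: v2; rewrite ez zs.
  have iz : index z s2 < size s2 by rewrite index_mem.
  set i := index z s2 in iz *.
  have -> : size (s1 ++ v :: s2) - (size s1 + i.+1).+1 = size s2 - i.+1.
    by rewrite size_cat /=; clear; lia.
  have l1 : psi i 0 <= psi (size s1 + i.+1) e by apply: psi_mono => //; clear; lia.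
  have l2 : psi (size s2 - i.+1) e' <= B by apply: psi_mono => //; exact: leq_subr.
  have l3 : psi i 0 <= B by apply: psi_mono => //; exact: ltnW.
  have l4 : A <= psi (size s1 + i.+1) e by apply: psi_mono => //; clear; lia.
  by move: l1 l2 l3 l4; move: (psi _ _) (psi _ _) (psi _ _); clear; lia.
have sumle (s : seq V) (f : V -> nat) (a b : nat) : {in s, forall z, f z + a <= F z + b} ->
    \sum_(z <- s | H z) f z + count H s * a <= \sum_(z <- s | H z) F z + count H s * b.
  elim: s => [|z s IH] hf; first by rewrite !big_nil.
  have {}IH := IH (fun t ts => hf t (@mem_behead _ (z :: s) t ts)); have hz := hf z (mem_head _ _).
  rewrite !big_cons /=; case: (H z) => //=; rewrite !mulSn.
  by move: IH hz; clear; lia.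
have S1 := sumle s1 _ _ _ f1; have S2 := sumle s2 _ _ _ f2.
have -> : \sum_(z <- s1 ++ v :: s2 | H z) hole_pot (e, s1 ++ v :: s2, e') z =
   \sum_(z <- s1 | H z) F z + (H v) * F v + \sum_(z <- s2 | H z) F z.
  by rewrite big_cat big_cons /= -addnA; case: (H v); rewrite ?mul1n // mul0n add0n.
have Fv : F v = maxn A B.
  rewrite /F /hole_pot /= index_mid //; congr (maxn _ (psi _ _)).
  by rewrite size_cat /=; clear; lia.
rewrite Fv; move: cH; rewrite count_cat /= => cH.
exact: split_arith cH hC S1 S2.
Qed.

(** The cap is paid a second time only if both sides are long. A long gap with a short side costs at
    most the pages of that side, and a short gap is below the cap, so it costs nothing. *)
Lemma stale_part_split S e s1 v s2 e' :
  stale_part S (e, s1, 0) + stale_part S (0, s2, e') <=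
  stale_part S (e, s1 ++ v :: s2, e') +
    (incB g (size (s1 ++ v :: s2)) (minn (size s1) (size s2)) +
     10 * g * incA g (minn (size s1) (size s2))).
Proof.
rewrite /stale_part /seg /= count_cat /= /incA /incB.
have c1 := count_size S s1; have c2 := count_size S s2.
have [h|h] := leqP (10 * g) (minn (size s1) (size s2)).
  have l4 := lev_ge4 g0 h.
  have : 10 * g * 1 <= 10 * g * lev g (minn (size s1) (size s2)).
    by rewrite leq_mul2l; apply/orP; right; move: l4; clear; lia.
  by move: (_ * lev _ _) (count _ _) (count _ _) (nat_of_bool _); clear; lia.
rewrite andbT; case: (leqP (10 * g) (size _)) => h2; rewrite muln0 addn0.
  by move: c1 c2; clear; lia.
by move: h2 c1 c2; rewrite size_cat /=; clear; lia.
Qed.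

(** [12 = 2 + 10], from the tokens and from the cap. The two ends next to [v] get flag 0, as [v] is
    marked from now on. *)
Lemma pot_split H H' S S' C e s1 v s2 e' C' :
    perm_eq C ((e, s1 ++ v :: s2, e') :: C') -> uniq (flatten (segs C)) -> e <= 1 -> e' <= 1 ->
    (forall z, z != v -> H' z = H z) -> (forall z, z != v -> S' z = S z) ->
    count H (s1 ++ v :: s2) <= g ->
  pot H' S' ((e, s1, 0) :: (0, s2, e') :: C') <=
  pot H S C + (12 * g * incA g (minn (size s1) (size s2)) +
               incB g (size (s1 ++ v :: s2)) (minn (size s1) (size s2))).
Proof.
move=> hp uC e1 e1' eH eS cH.
have pf := flatten_split (perm_map seg hp).
have nv z : z \in flatten (segs ((e, s1, 0) :: (0, s2, e') :: C')) -> z != v.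
  move=> zC; move: uC; rewrite (perm_uniq pf) => /andP[vC _].
  by apply: contraNneq vC => <-.
rewrite (@eq_pot H' H S' S); first last.
- by move=> z /nv/eS.
- by move=> z /nv/eH.
rewrite [pot H S C]/pot (perm_big _ hp) /= -!/(pot _ _ _) !pot_cons.
have us : uniq (s1 ++ v :: s2).
  have : uniq (flatten (segs ((e, s1 ++ v :: s2, e') :: C'))).
    by rewrite -(perm_uniq (perm_flatten (perm_map seg hp))).
  by rewrite /= cat_uniq => /andP[].
have h1 := hole_part_split e e' us cH.
have h2 := stale_part_split S e s1 v s2 e'.
have h3 : g * minn (psi (size s1) e) (psi (size s2) e') <= g * (2 * incA g (minn (size s1) (size s2))).
  by rewrite leq_mul2l psi_incA // orbT.
move: h1 h2 h3; move: (incB _ _ _) (incA _ _) => b a.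
rewrite mulnA [g * 2]mulnC.
have -> : 12 * g * a = 2 * g * a + 10 * g * a by rewrite -!mulnDl.
move: (g * minn _ _) (2 * g * a) (10 * g * a) (pot _ _ _).
move: (hole_part _ _) (hole_part _ _) (hole_part _ _) (stale_part _ _) (stale_part _ _) (stale_part _ _).
by clear; lia.
Qed.

(** All ends are flagged, so a gap is worth two more than its level at most, and three times the
    level covers that. *)
Lemma pot_init H S (L : seq (seq V)) : {in L, forall s, count H s <= g} ->
  pot H S [seq (1, s, 1) | s <- L] <=
    3 * g * levs g L + \sum_(s <- L) minn (10 * g) (size s).
Proof.
elim: L => [|s L IH] hL; first by rewrite /pot /= !big_nil.
rewrite map_cons pot_cons levs_cons big_cons mulnDr.
have {}IH := IH (fun t tL => hL t (@mem_behead _ (s :: L) t tL)).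
have hs := hL s (mem_head _ _).
have h1 : stale_part S (1, s, 1) <= minn (10 * g) (size s).
  by rewrite /stale_part /= leq_min geq_minl /= (leq_trans (geq_minr _ _)) ?count_size.
suff h2 : hole_part H (1, s, 1) <= 3 * g * lev g (size s).
  by move: IH h1 h2; move: (_ * levs _ _) (_ * lev _ _) (minn _ _) (\sum_(_ <- _) _); clear; lia.
have [small|big] := ltnP (size s) (10 * g); first by rewrite hole_part_small.
have l4 := lev_ge4 g0 big.
have p3 : psi (size s) 2 <= 3 * lev g (size s).
  rewrite /psi; case: ifP => // _; have := lev_mono g (leq_subr (2 * g) (size s)).
  by move: l4; clear; lia.
apply: leq_trans (_ : g * psi (size s) 2 <= _); last first.
  by rewrite -mulnA mulnCA leq_mul2l p3 orbT.
rewrite /hole_part /= addnn -[1.*2]/2.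
have : \sum_(z <- s | H z) hole_pot (1, s, 1) z <= count H s * psi (size s) 2.
  rewrite -sum1_count big_distrl /= big_seq_cond [X in _ <= X]big_seq_cond.
  apply: leq_sum => z /andP[zs _]; rewrite mul1n /hole_pot /= geq_max.
  have iz : index z s < size s by rewrite index_mem.
  by apply/andP; split; apply: psi_mono => //; [exact: ltnW|exact: leq_subr].
have [d ->] : exists d, g = count H s + d by exists (g - count H s); move: hs; clear; lia.
have -> : count H s + d - count H s = d by clear; lia.
by rewrite mulnDl; move: (_ * _) (_ * _) (\sum_(_ <- _ | _) _); clear; lia.
Qed.

End Potential.

(** * Spanning trees *)

Section Tree.
Variables (V : choiceType) (P : seq V) (T : rel V).
Hypothesis tree : spanning_tree P T.
Implicit Types (u v x y z : V) (s p : seq V) (W : {fset V}).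

Let Tsym : symmetric T. Proof. by case: tree. Qed.

Lemma tree_in u v : T u v -> [/\ u \in P, v \in P & u != v].
Proof.
have [_ sub _ _] := tree => /sub /andP[uv h].
have zipin a b s t : (a, b) \in zip s t -> a \in s /\ b \in t.
  elim: s t => [|c s IH] [|d t] //=; rewrite !inE => /orP[/eqP[-> ->]|/IH[-> ->]].
    by rewrite !eqxx.
  by rewrite !orbT.
by split=> //; case/orP: h => /zipin[h1 h2] => //; exact: mem_behead.
Qed.

Lemma tree_step G : symmetric G -> sorted (step G) P -> subrel T (step G).
Proof.
move=> Gsym sP u v; have [_ sub _ _] := tree => /sub /andP[_].
have h a b : (a, b) \in zip P (behead P) -> step G a b.
  case: P sP => // c s; rewrite [behead _]/=; elim: s c => //= d s IH c /andP[Ecd ps].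
  by rewrite inE => /orP[/eqP[-> ->]|/IH]; [|exact].
by case/orP=> /h //; rewrite step_sym.
Qed.

Lemma tree_acyclic x p : path T x p -> uniq (x :: p) -> 1 < size p -> ~~ T (last x p) x.
Proof.
move=> pp up sp; apply/negP => Tl; have [_ _ _ /(_ (x :: p))] := tree.
by rewrite /= ltnS sp rcons_path pp Tl -[_ && _]/(uniq (x :: p)) up => /(_ isT).
Qed.

Lemma tree_path u v : u \in P -> v \in P ->
  exists p, [/\ path T u p, last u p = v, uniq (u :: p) & {subset p <= P}].
Proof.
move=> uP vP; have [_ _ /(_ u v uP vP)[p pp lp] _] := tree.
case/shortenP: pp lp => p' pp' up' _ lp'; exists p'; split=> //.
elim: p' u pp' {uP up' lp'} => //= a p' IH u /andP[/tree_in[_ aP _] pp'] z.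
by rewrite inE => /orP[/eqP->//|]; exact: IH pp' z.
Qed.

Definition nbrs v : {fset V} := [fset u in P | T v u].
Definition deg v := #|` nbrs v|.

Lemma in_nbrs v u : (u \in nbrs v) = T v u.
Proof.
rewrite !inE /=; case: (boolP (T v u)) => h; rewrite ?andbF // andbT.
by case: (tree_in h).
Qed.

Lemma deg_ge2 v a b : T v a -> T v b -> a != b -> 1 < deg v.
Proof.
move=> Ta Tb ab; have : [fset a; b] `<=` nbrs v.
  by apply/fsubsetP => z; rewrite in_fset2 => /orP[]/eqP->; rewrite in_nbrs.
by move/fsubset_leq_card; rewrite cardfs2 ab.
Qed.

Lemma deg2P v : deg v = 2 -> exists a b,
  [/\ a != b, T v a, T v b & forall u, T v u -> u = a \/ u = b].
Proof.
move=> d2; have /fset0Pn[a] : nbrs v != fset0 by rewrite -cardfs_gt0 -/(deg v) d2.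
rewrite in_nbrs => Ta; have := cardfsD1 a (nbrs v); rewrite in_nbrs Ta -/(deg v) d2 => d.
have e : #|` nbrs v `\ a| = 1 by move: d; clear; lia.
have /fset0Pn[b] : nbrs v `\ a != fset0 by rewrite -cardfs_gt0 e.
rewrite in_fsetD1 in_nbrs => /andP[ba Tb]; exists a, b; split=> //; first by rewrite eq_sym.
move=> u Tu; have [->|ua] := eqVneq u a; first by left.
right; apply/eqP; apply: contraT => ub.
have : [fset b; u] `<=` nbrs v `\ a.
  apply/fsubsetP => z; rewrite in_fset2 => /orP[]/eqP->; rewrite in_fsetD1 in_nbrs ?ba ?ua //.
by move/fsubset_leq_card; rewrite cardfs2 eq_sym ub e.
Qed.

(** A path inside [W] between two different neighbours of [v] would close a cycle. *)
Lemma uniq_nbr W v a b : conn T W -> a \in W -> b \in W -> v \notin W -> T v a -> T v b -> a = b.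
Proof.
move=> cW aW bW vW Ta Tb; apply/eqP; apply: contraT => ab.
have [p [pp lp sp]] := cW _ _ aW bW.
case/shortenP: pp lp => p' pp' up' sub lp'.
have pth : path T v (a :: p') by rewrite /= Ta.
have un : uniq (v :: a :: p').
  rewrite cons_uniq up' andbT; apply: contra vW => h; apply: sp.
  by move: h; rewrite !inE => /orP[->//|/sub ->]; rewrite orbT.
have := tree_acyclic pth un; rewrite [last _ _]/= lp' Tsym Tb /=.
by case: (p') lp' => [/= e|? ? _ /(_ isT)//]; rewrite e eqxx in ab.
Qed.

Lemma grow_vertex W X : conn T X -> W `<=` X -> W != fset0 -> W != X ->
  exists a v, [/\ a \in W, v \in X, v \notin W & T a v].
Proof.
move=> cX WX /fset0Pn[x xW] WneX.
have [y yX yW] : exists2 y, y \in X & y \notin W.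
  have : ~~ (X `<=` W) by apply: contra WneX => XW; rewrite eqEfsubset WX.
  by case/fsubsetPn => y; exists y.
have [p [pp lp pX]] := cX _ _ (fsubsetP WX _ xW) yX.
elim: p x xW pp lp pX => [|v p IHp] x xW /=; first by move=> _ e; rewrite -e xW in yW.
move=> /andP[Exv pp] lp pX; have [vW|vW] := boolP (v \in W).
  by apply: (IHp v vW pp lp) => z zp; apply: pX; rewrite inE zp orbT.
by exists x, v; split=> //; apply: pX; rewrite !inE eqxx orbT.
Qed.

Lemma tree_conn : conn T (fset_of P).
Proof.
move=> u v; rewrite !in_fset_of => uP vP; have [p [pp lp _ sp]] := tree_path uP vP.
exists p; split=> // z; rewrite inE in_fset_of => /orP[/eqP->//|/sp//].
Qed.

(** The tree is grown from a single vertex. By [uniq_nbr] a new vertex brings exactly one edge,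
    which adds 2 to the sum of the degrees. *)
Lemma sum_deg : P != [::] -> \sum_(v <- fset_of P) deg v + 2 <= 2 * #|` fset_of P|.
Proof.
move=> P0; set X := fset_of P.
have main N : forall W, N = #|` X| - #|` W| -> conn T W -> W `<=` X -> W != fset0 ->
    \sum_(v <- W) #|` nbrs v `&` W| + 2 <= 2 * #|` W| ->
    \sum_(v <- X) deg v + 2 <= 2 * #|` X|.
  elim: N => [|N IH] W eN cW WX W0 hW.
    have e : W = X.
      by apply/eqP; rewrite eqEfcard WX /=; move: eN; clear; lia.
    apply: leq_trans (_ : \sum_(v <- X) #|` nbrs v `&` X| + 2 <= _); last by rewrite -e.
    rewrite leq_add2r; apply: leq_sum => v _; apply: fsubset_leq_card.
    apply/fsubsetP => u uv; rewrite in_fsetI uv /= in_fset_of.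
    by move: uv; rewrite in_nbrs => /tree_in[].
  have WneX : W != X by apply/eqP => e; move: eN; rewrite e; clear; lia.
  have [a [v [aW vX vW Tav]]] := grow_vertex tree_conn WX W0 WneX.
  have c1 : #|` v |` W| = #|` W|.+1 by rewrite cardfsU1 vW.
  apply: (IH (v |` W)).
  - by move: eN; rewrite c1; clear; lia.
  - exact: conn_add1 aW Tav.
  - by rewrite fsubUset fsub1set vX.
  - by apply/fset0Pn; exists v; rewrite in_fset1U eqxx.
  rewrite c1 (big_fsetD1 v) /= ?in_fset1U ?eqxx //.
  have -> : (v |` W) `\ v = W.
    apply/fsetP => z; rewrite in_fsetD1 in_fset1U; case: (eqVneq z v) => [->|//].
    by rewrite (negbTE vW).
  have e1 : #|` nbrs v `&` (v |` W)| <= 1.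
    have : nbrs v `&` (v |` W) `<=` [fset a].
      apply/fsubsetP => z; rewrite in_fsetI in_nbrs in_fset1U in_fset1 => /andP[Tvz].
      case/orP => [/eqP e|zW]; first by have [_ _] := tree_in Tvz; rewrite e eqxx.
      by apply/eqP; apply: (uniq_nbr cW zW aW vW Tvz); rewrite Tsym.
    by move/fsubset_leq_card; rewrite cardfs1.
  have e2 : \sum_(z <- W) #|` nbrs z `&` (v |` W)| <= \sum_(z <- W) #|` nbrs z `&` W| + 1.
    rewrite (big_fsetD1 a) //= [in X in _ <= X](big_fsetD1 a) //=.
    have h1 : #|` nbrs a `&` (v |` W)| <= #|` nbrs a `&` W|.+1.
      have : nbrs a `&` (v |` W) `<=` v |` (nbrs a `&` W).
        apply/fsubsetP => z; rewrite in_fsetI in_fset1U in_fset1U in_fsetI.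
        by case/andP => -> /orP[]->; rewrite ?orbT.
      move/fsubset_leq_card; move/leq_trans; apply.
      by rewrite cardfsU1; case: (_ \notin _); clear; lia.
    have h2 : \sum_(z <- W `\ a) #|` nbrs z `&` (v |` W)| <= \sum_(z <- W `\ a) #|` nbrs z `&` W|.
      rewrite big_seq [X in _ <= X]big_seq; apply: leq_sum => z.
      rewrite in_fsetD1 => /andP[za zW]; apply: fsubset_leq_card; apply/fsubsetP => u.
      rewrite !in_fsetI in_fset1U in_nbrs => /andP[Tzu /orP[/eqP e|->]]; last by rewrite Tzu.
      case/negP: za; apply/eqP.
      by rewrite e in Tzu; apply: (uniq_nbr cW zW aW vW); rewrite Tsym.
    by move: h1 h2; move: #|` _| #|` _|; clear; lia.
  by move: hW e1 e2; clear; lia.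
have [x xP] : exists x, x \in P by case: (P) P0 => // x s; exists x; rewrite inE eqxx.
apply: (main (#|` X| - 1) [fset x]).
- by rewrite cardfs1.
- by move=> u v; rewrite !inE => /eqP-> /eqP->; apply: reach_refl; rewrite inE.
- by rewrite fsub1set in_fset_of.
- by apply/fset0Pn; exists x; rewrite inE.
rewrite big_seq_fset1 cardfs1.
have -> : nbrs x `&` [fset x] = fset0.
  apply/fsetP => z; rewrite in_fsetI in_nbrs in_fset1 inE.
  by apply/negP => /andP[/tree_in[_ _]] + /eqP e; rewrite e eqxx.
by rewrite cardfs0.
Qed.

Definition ndeg (p : pred nat) := #|` [fset v in P | p (deg v)]|.

Lemma card_sum (Q : pred V) : #|` [fset v in P | Q v]| = \sum_(v <- fset_of P) (Q v : nat).
Proof.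
have -> : [fset v in P | Q v] = fset_of [seq z <- enum_fset (fset_of P) | Q z].
  apply/fsetP => z; rewrite in_fset_of mem_filter.
  have -> : (z \in enum_fset (fset_of P)) = (z \in P) by rewrite -(in_fset_of P z).
  by rewrite !inE andbC.
rewrite card_fset_of ?filter_uniq ?fset_uniq // size_filter -sum1_count big_mkcond /=.
by apply: eq_bigr => v _; case: (Q v).
Qed.

(** The average degree is below 2, so the excess of the vertices of degree 3 or more is made up for
    by those of degree 0 and 1. *)
Lemma count_deg : P != [::] -> ndeg (fun n => 2 < n) + 2 <= ndeg (fun n => n == 1) + 2 * ndeg (fun n => n == 0).
Proof.
move=> P0; have := sum_deg P0; rewrite /ndeg !card_sum.
have : \sum_(v <- fset_of P) ((2 < deg v) : nat) + 2 * #|` fset_of P| <=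
   \sum_(v <- fset_of P) deg v + \sum_(v <- fset_of P) ((deg v == 1) : nat) + 2 * \sum_(v <- fset_of P) ((deg v == 0) : nat).
  have -> : 2 * #|` fset_of P| = \sum_(v <- fset_of P) 2.
    by rewrite big_const_seq count_predT iter_addn_0 mulnC.
  rewrite big_distrr /= -!big_split /=; apply: leq_sum => v _.
  by case: (deg v) => [|[|[|n]]].
by clear; lia.
Qed.

Lemma inner_deg u p z : path T u p -> uniq (u :: p) -> z \in p -> z != last u p -> 1 < deg z.
Proof.
move=> pp up zp; move: zp pp up; case/splitPr => p1 p2.
case: p2 => [|y p2]; first by rewrite last_cat /= eqxx.
rewrite cat_path /= => /and4P[_ Tz Ty _] up _.
apply: (@deg_ge2 _ (last u p1) y) => //; first by rewrite Tsym.
apply/eqP => e; have : uniq ((u :: p1) ++ [:: z, y & p2]) by exact: up.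
rewrite cat_uniq.
case/and3P => _ /hasPn /(_ y) h _; move: h; rewrite !inE eqxx !orbT => /(_ isT).
by rewrite /= -e -in_cons mem_last.
Qed.

(** The core consists of the vertices of degree at least 2; it is connected, as the inner vertices
    of a tree path have degree at least 2. A third page guarantees that the neighbour of a leaf is
    not a leaf itself. *)
Lemma leafy_tree E : symmetric E -> subrel T E -> 2 < #|` fset_of P| ->
  leafy E (fset_of P) (ndeg (fun n => n <= 1)).
Proof.
move=> Esym TE P3.
pose K := [fset v in P | 1 < deg v].
have inK z : (z \in K) = (z \in P) && (1 < deg z) by rewrite !inE.
have dom v : v \in P -> v \notin K -> exists2 u, u \in K & T v u.
  move=> vP vK.
  have notK a b : T v a -> T v b -> a = b.
    move=> Ta Tb; apply/eqP; apply: contraT => ab; move: vK.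
    by rewrite inK vP (deg_ge2 Ta Tb ab).
  have [t tP tv] : exists2 t, t \in P & t != v.
    have : ~~ (fset_of P `<=` [fset v]) by apply/negP => /fsubset_leq_card; rewrite cardfs1; move: P3; clear; lia.
    by case/fsubsetPn => t; rewrite in_fset_of in_fset1 => tP tv; exists t.
  have [[|u p] [pp lp up sp]] := tree_path vP tP; first by rewrite -lp eqxx in tv.
  have Tvu : T v u by move: pp => /= /andP[].
  have [t' t'P] : exists2 t, t \in P & (t != v) && (t != u).
    have : ~~ (fset_of P `<=` [fset v; u]).
      by apply/negP => /fsubset_leq_card; rewrite cardfs2; move: P3; clear; case: (_ != _); lia.
    by case/fsubsetPn => t'; rewrite in_fset_of in_fset2 negb_or => tP' h; exists t'.
  move=> /andP[t'v t'u].
  have [[|u' p'] [pp' lp' up' sp']] := tree_path vP t'P; first by rewrite -lp' eqxx in t'v.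
  have Tvu' : T v u' by move: pp' => /= /andP[].
  exists u' => //; rewrite inK sp' ?inE ?eqxx //=.
  apply: (inner_deg pp' up'); first by rewrite inE eqxx.
  by rewrite lp' (notK _ _ Tvu' Tvu) eq_sym.
exists K; split.
- by apply/fsubsetP => z; rewrite inK in_fset_of => /andP[].
- have [v vP] : exists v, v \in P.
    have /fset0Pn[v] : fset_of P != fset0 by rewrite -cardfs_gt0; move: P3; clear; lia.
    by rewrite in_fset_of; exists v.
  have [vK|vK] := boolP (v \in K); first by apply/fset0Pn; exists v.
  by have [u uK _] := dom v vP vK; apply/fset0Pn; exists u.
- move=> u w; rewrite !inK => /andP[uP du] /andP[wP dw].
  have [p [pp lp up sp]] := tree_path uP wP; exists p; split=> //.
    by apply: sub_path pp.
  move=> z; rewrite inE inK => /orP[/eqP->|zp]; first by rewrite uP.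
  rewrite sp //=; have [->|zl] := eqVneq z (last u p); first by rewrite lp.
  exact: (inner_deg pp up).
- move=> v; rewrite in_fsetD in_fset_of => /andP[vK vP].
  by have [u uK Tvu] := dom v vP vK; exists u => //; rewrite Esym; exact: TE.
apply: fsubset_leq_card; apply/fsubsetP => z.
by rewrite in_fsetD inK in_fset_of !inE => /andP[zP /=]; rewrite zP /= leqNgt => /negbTE->.
Qed.

End Tree.

(** * Decomposition of vertices of degree two into chains *)

Section ChainDecomposition.
Variables (V : choiceType) (P : seq V) (T : rel V).
Hypothesis tree : spanning_tree P T.
Implicit Types (u v x y z : V) (s p : seq V) (D : {fset V}).

Let Tsym : symmetric T. Proof. by case: tree. Qed.

Lemma chain_of_path x s y : path T x (rcons s y) -> uniq s -> x \notin s -> y \notin s ->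
  (x != y) || (1 < size s) -> {in s, forall v, deg P T v = 2} -> chain T x s y.
Proof.
elim: s x => // v s IH x.
rewrite rcons_cons cons_uniq !inE !negb_or => pxv us xs ys; move: pxv us xs ys.
rewrite [path _ _ _]/= => /andP[Txv pv] /andP[vs us] /andP[xv xs] /andP[yv ys] xy dg.
have Tvh : T v (head y s) by move: pv; case: (s) => [|w s'] /= /andP[].
have xh : x != head y s.
  case: (s) xs xy => [|w s'] /=; first by rewrite orbF.
  by rewrite inE negb_or => /andP[].
split=> //; last first.
  apply: IH => //; first by rewrite eq_sym yv.
  by move=> w ws; apply: dg; rewrite inE ws orbT.
have [|a [b [ab Ta Tb only]]] := deg2P tree (v := v); first by apply: dg; rewrite inE eqxx.
move=> u Tu; have Tvx : T v x by rewrite Tsym.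
case: (only x Tvx) xh => ex; case: (only _ Tvh) => -> ; rewrite ex ?eqxx // => _.
  exact: only.
by case: (only u Tu); [right|left].
Qed.

(** A longest path inside [D] is taken. At its ends, a further neighbour in [D] would prolong the
    path if it is new, and close a cycle if it is on the path. *)
Lemma longest_chain D d : {in D, forall v, deg P T v = 2} -> d \in D -> exists s x y,
  [/\ s != [::], uniq s, {subset s <= D}, x \notin D /\ y \notin D & chain T x s y].
Proof.
move=> dg dD.
pose Q n := `[< exists s, [/\ size s = n, 0 < n, uniq s, {subset s <= D} & sorted T s] >].
have Q1 : exists n, Q n.
  by exists 1; apply/asboolP; exists [:: d]; split=> // z; rewrite inE => /eqP->.
have Qb n : Q n -> n <= #|` D|.
  move=> /asboolP[s [<- _ us sD _]].
  by rewrite -(card_fset_of us); apply: fsubset_leq_card; apply/fsubsetP => z; rewrite in_fset_of => /sD.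
case: (ex_maxnP Q1 Qb) => n /asboolP[s [sn n0 us sD ps]] max.
have long t : uniq t -> {subset t <= D} -> sorted T t -> 0 < size t -> size t <= size s.
  by move=> ut tD pt t0; rewrite sn; apply: max; apply/asboolP; exists t.
have ext v s' : uniq (v :: s') -> {subset v :: s' <= D} -> path T v s' -> size s <= size (v :: s') ->
    forall a, T v a -> (s' = [::]) \/ a != head v s' -> a \notin D.
  move=> us' s'D ps' ls a Ta hd; apply/negP => aD.
  have [_ _ va] := tree_in tree Ta.
  case: (boolP (a \in s')) => as'; last first.
    have := long (a :: v :: s'); rewrite /= inE negb_or eq_sym va as' -[_ && _]/(uniq (v :: s')) us'.
    move=> /(_ isT); rewrite Tsym Ta ps' => h.
    have : (size s').+2 <= size s.
      by apply: h => // z; rewrite inE => /orP[/eqP->//|/s'D].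
    by move: ls => /=; clear; lia.
  case: hd => [e|ne]; first by rewrite e in as'.
  move: as' ne us' ps' {s'D ls}; case/splitPr => p1 p2 ne us' ps'.
  have pp : path T v (rcons p1 a) by move: ps'; rewrite -cat_rcons cat_path => /andP[].
  have up : uniq (v :: rcons p1 a).
    by move: us'; rewrite -cat_rcons -cat_cons cat_uniq => /andP[].
  have sp : 1 < size (rcons p1 a).
    by case: (p1) ne => [|? ?]; rewrite ?eqxx // size_rcons.
  by have := tree_acyclic tree pp up sp; rewrite last_rcons Tsym Ta.
case: s us sD ps sn n0 long ext => [|v s] us sD ps sn n0 long ext; first by rewrite -sn in n0.
have dv : deg P T v = 2 by apply: dg; apply: sD; rewrite inE eqxx.
have [a [b [ab Ta Tb only]]] := deg2P tree dv.
have [e|s0] := eqVneq s [::].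
  have h c : T v c -> c \notin D by move=> Tc; apply: (ext v s us sD ps) => //; left.
  exists (v :: s), a, b; split=> //; first by split; exact: h.
  rewrite e /=; split=> //; by rewrite Tsym.
have [x [Tx xh xD]] : exists x, [/\ T v x, x != head v s & x \notin D].
  have [e|ne] := eqVneq a (head v s).
    by exists b; rewrite -e eq_sym ab; split=> //; apply: (ext v s) => //; right; rewrite -e eq_sym.
  by exists a; split=> //; apply: (ext v s) => //; right.
pose l := last v s; pose r := rev (belast v s).
have er : l :: r = rev (v :: s) by rewrite [v :: s]lastI rev_rcons.
have r0 : r != [::] by rewrite /r -size_eq0 size_rev size_belast size_eq0.
have pr : path T l r by rewrite rev_path (eq_path (e' := T)) // => c d'; exact: Tsym.
have ur : uniq (l :: r) by rewrite er rev_uniq.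
have rD : {subset l :: r <= D} by move=> z; rewrite er mem_rev; exact: sD.
have dl : deg P T l = 2 by apply: dg; apply: rD; rewrite inE eqxx.
have [a' [b' [ab' Ta' Tb' only']]] := deg2P tree dl.
have sr : size (v :: s) <= size (l :: r) by rewrite er size_rev.
have [y [Ty yD]] : exists y, T l y /\ y \notin D.
  have [e|ne] := eqVneq a' (head l r).
    by exists b'; split=> //; apply: (ext l r) => //; right; rewrite -e eq_sym.
  by exists a'; split=> //; apply: (ext l r) => //; right.
exists (v :: s), x, y; split=> //; apply: chain_of_path => //.
- by rewrite rcons_cons /= Tsym Tx rcons_path (ps : path T v s).
- by apply: contra xD; exact: sD.
- by apply: contra yD; exact: sD.
- by rewrite orbC /= ltnS lt0n size_eq0 s0.
by move=> w /sD; exact: dg.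
Qed.

(** Longest chains are removed one after the other. What is left stays closed under tree neighbours
    in [D], so the outer neighbours of the next chain lie outside all of [D]. *)
Lemma chains_decomp D : {in D, forall v, deg P T v = 2} -> exists L : seq (seq V),
  [/\ uniq (flatten L), flatten L =i D &
      {in L, forall s, s != [::] /\ exists x y, [/\ x \notin D, y \notin D & chain T x s y]}].
Proof.
move=> dg.
suff main N (D' : {fset V}) : #|` D'| <= N -> D' `<=` D ->
    {in D', forall z u, T z u -> u \in D -> u \in D'} -> exists L : seq (seq V),
    [/\ uniq (flatten L), flatten L =i D' &
      {in L, forall s, s != [::] /\ exists x y, [/\ x \notin D, y \notin D & chain T x s y]}].
  by apply: (main #|` D| D).
elim: N D' => [|N IH] D' cD D'D closed.
  have -> : D' = fset0 by apply/eqP; rewrite -cardfs_eq0 -leqn0.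
  by exists [::].
have [->|/fset0Pn[d dD']] := eqVneq D' fset0; first by exists [::].
have dg' : {in D', forall v, deg P T v = 2} by move=> v /(fsubsetP D'D); exact: dg.
have [s [x [y [s0 us sD' [xD' yD'] ch]]]] := longest_chain dg' dD'.
have xy : x \notin D /\ y \notin D.
  have := chain_path s0 ch; case: (s) s0 sD' => // v s' _ sD'' /=.
  move=> /andP[Txv]; rewrite rcons_path => /andP[_ Tl]; split.
    apply: contra xD' => xD; apply: (closed v) => //; last by rewrite Tsym.
    by apply: sD''; rewrite inE eqxx.
  apply: contra yD' => yD; apply: (closed (last v s')) => //.
  by apply: sD''; exact: mem_last.
have cs : #|` D' `\` fset_of s| <= N.
  have : D' `\` fset_of s `<=` D' `\ head d s.
    apply/fsubsetP => z; rewrite in_fsetD1 in_fsetD in_fset_of => /andP[zs ->]; rewrite andbT.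
    by apply: contraNneq zs => ->; case: (s) s0 => // a l _; rewrite inE eqxx.
  move/fsubset_leq_card => h; have := cardfsD1 (head d s) D'.
  have -> : head d s \in D' by apply: sD'; case: (s) s0 => // a l _; rewrite inE eqxx.
  by move: cD h; clear; lia.
have [||L [uL eL cL]] := IH (D' `\` fset_of s) cs.
- by apply: fsubset_trans D'D; exact: fsubsetDl.
- move=> z; rewrite in_fsetD in_fset_of => /andP[zs zD'] u Tzu uD.
  rewrite in_fsetD in_fset_of (closed z) // andbT; apply/negP => us'.
  have Tuz : T u z by rewrite Tsym.
  have := chain_nbr ch us' Tuz; rewrite inE mem_rcons inE (negbTE zs) orbF.
  by case/orP => /eqP e; [move: xD'|move: yD']; rewrite -e zD'.
exists (s :: L); split.
- rewrite /= cat_uniq us uL andbT; apply/hasPn => z; rewrite eL in_fsetD in_fset_of.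
  by case/andP.
- move=> z; rewrite /= mem_cat eL in_fsetD in_fset_of.
  by case: (boolP (z \in s)) => [/sD'->|].
move=> s'; rewrite inE => /orP[/eqP->|/cL//]; split=> //.
by exists x, y; case: xy.
Qed.

End ChainDecomposition.

(** * Paths that leave a chain *)

Section Follow.
Variables (V : choiceType) (T : rel V).
Hypothesis Tsym : symmetric T.
Implicit Types (u v x y z : V) (s p : seq V).

(** Inside a chain a path can only go on or turn back. As it does not leave by way of [x], it leaves
    by way of [y] and meets all of [s2]. *)
Lemma chain_follow x s1 z s2 y p : chain T x (s1 ++ z :: s2) y -> path T z p ->
  last z p \notin s1 ++ z :: s2 -> x \notin p -> {subset s2 <= p}.
Proof.
elim: p s1 z s2 => [|a p IH] s1 z s2 ch /=; first by rewrite mem_cat inE eqxx orbT.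
move=> /andP[Ta pp] ln; rewrite inE negb_or => /andP[xa xp].
have [c1 [_ _ _ only c2]] := (chain_cat T x s1 z s2 y).1 ch.
case: (only a Ta) => ea.
  case/lastP: s1 c1 only ea ch ln => [|s1 b] c1 only ea ch ln; first by rewrite ea eqxx in xa.
  rewrite last_rcons in ea; subst b; rewrite cat_rcons in ch ln.
  by move=> t ts; rewrite inE (IH _ _ _ ch pp ln xp) ?orbT // inE ts orbT.
case: s2 only ea ch ln c2 => [|w s2] only ea ch ln c2 //=.
rewrite [head _ _]/= in ea; subst w.
rewrite -cat_rcons in ch ln.
move=> t; rewrite !inE => /orP[->//|ts].
by rewrite (IH _ _ _ ch pp ln xp) ?orbT.
Qed.

Lemma chain_follow_rev x s1 z s2 y p : chain T x (s1 ++ z :: s2) y -> path T z p ->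
  last z p \notin s1 ++ z :: s2 -> y \notin p -> {subset s1 <= p}.
Proof.
move=> /(chain_rev Tsym); rewrite rev_cat rev_cons cat_rcons => ch pp ln yp.
have := chain_follow ch pp _ yp; rewrite mem_cat inE !mem_rev => h t ts; apply: h.
  by move: ln; rewrite mem_cat inE orbC -orbA orbCA.
by rewrite mem_rev.
Qed.

End Follow.

(** * Subphase III *)

Section StartIII.
Variables (V : choiceType) (G : rel V) (st : state V) (C' : {fset V}) (B : V -> {fset V}).
Hypothesis Gsym : symmetric G.
Let P := previous st.
Let T := tree st.
Let M := current st.
Hypothesis tre : spanning_tree P T.
Hypothesis sM : sorted (step G) M.
Hypothesis M0 : M != [::].
Hypothesis evP : {subset evicted st <= P}.
Hypothesis noI : forall u, stale st u -> ~~ branch st u.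
Hypothesis dead : forall v, v \in C' -> ~ alive st (B v).
Hypothesis Bv : forall v, v \in C' -> v \in B v.
Hypothesis Bev : forall v, v \in C' -> {subset B v <= evicted st}.
Hypothesis Bbr : forall v w, v \in C' -> w \in B v -> w != v -> ~~ branch st w.
Hypothesis Bconn : forall v w, v \in C' -> w \in B v -> reach T (B v) v w.
Hypothesis Cbr : forall v, v \in C' -> branch st v.
Hypothesis holeB : forall w, hole st w -> exists2 v, v \in C' & w \in B v.

Let Tsym : symmetric T. Proof. by case: tre. Qed.

Let D : {fset V} := [fset v in P | (v \notin M) && (deg P T v == 2)].

Lemma in_D v : (v \in D) = [&& v \in P, v \notin M & deg P T v == 2].
Proof. by rewrite !inE. Qed.

Lemma branchE v : branch st v = (v \in P) && (deg P T v != 2).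
Proof. by []. Qed.

Lemma stale_in_D u : stale st u -> u \in D.
Proof.
move=> su; have := noI su; move: su => /and3P[uP uM _].
by rewrite in_D branchE uP uM /= negbK.
Qed.

Lemma unmarked_hole u : u \in P -> u \notin M -> ~~ stale st u -> hole st u.
Proof. by move=> uP uM; rewrite /stale /hole uP uM /= negbK andbT. Qed.

Lemma hole_branch x : hole st x -> branch st x -> x \in C'.
Proof.
move=> /holeB[v vC xB] bx; have [->//|xv] := eqVneq x v.
by move: (Bbr vC xB xv); rewrite bx.
Qed.

(* Otherwise B x, adjacent to a stale page, would be alive. *)
Lemma gap_end_marked x s y : chain T x s y -> {subset s <= D} -> x \in C' -> has (stale st) s ->
  exists2 z, z \in B x & z \in M.
Proof.
move=> ch sD xC hs; apply: contrapT => noM.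
have Bhole u : u \in B x -> hole st u.
  move=> uB; have uev := Bev xC uB; rewrite /hole uev (evP uev) /=.
  by apply/negP => uM; apply: noM; exists u.
have nost w : w \in B x -> stale st w = false.
  by move=> /(Bev xC) we; rewrite /stale we !andbF.
suff key s1 s2 : s = s1 ++ s2 -> {subset s1 <= B x} -> ~~ has (stale st) s.
  have nil : {subset [::] <= B x} by [].
  by have := key [::] s erefl nil; rewrite hs.
elim: s2 s1 => [|z s2 IH] s1 es s1B.
  by rewrite es cats0; apply/hasPn => w /s1B/nost->.
have [zB|zB] := boolP (z \in B x).
  apply: (IH (rcons s1 z)); first by rewrite cat_rcons.
  by move=> w; rewrite mem_rcons inE => /orP[/eqP->|/s1B].
rewrite es in ch; have [_ Tz _ _ _] := chain_split ch.
have lB : last x s1 \in B x.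
  by have := mem_last x s1; rewrite inE => /orP[/eqP->|/s1B//]; exact: Bv.
have zD : z \in D by apply: sD; rewrite es mem_cat inE eqxx orbT.
have := zD; rewrite in_D => /and3P[zP zM _].
have [sz|nz] := boolP (stale st z).
  by case: (dead xC); split=> //; exists z => //; exists (last x s1).
have [v vC zBv] := holeB (unmarked_hole zP zM nz).
have xv : x != v by apply: contraNneq zB => ->.
have xBv : x \notin B v by apply/negP => xB; move: (Bbr vC xB xv); rewrite Cbr.
have [p [pp lp sp]] : reach T (B v) z v by apply: reach_sym => //; exact: Bconn.
have vs : v \notin s1 ++ z :: s2.
  rewrite -es; apply/negP => /sD; rewrite in_D => /and3P[_ _ dv].
  by have := Cbr vC; rewrite branchE dv andbF.
have s2p : {subset s2 <= p}.
  apply: (chain_follow ch pp); first by rewrite lp.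
  by apply: contra xBv => xp; apply: sp; rewrite inE xp orbT.
apply/hasPn => w; rewrite es mem_cat => /orP[/s1B/nost->//|].
rewrite inE => ws; have : w \in B v.
  by apply: sp; case/orP: ws => [/eqP->|/s2p wp]; rewrite inE ?eqxx ?wp ?orbT.
by move=> /(Bev vC) we; rewrite /stale we !andbF.
Qed.

(** The gaps are the chains of [D] that contain a stale page, and all other pages form the core. To
    see that the core is connected, each of its pages is linked to a marked one: the tree path to
    the stale page [t] meets a marked page or an end of a gap, and an unmarked end lies in [C'] and
    has a marked page in its set [B]. *)
Theorem start_III t : stale st t -> exists L0,
  let K0 := (fset_of P `|` fset_of M) `\` fset_of (flatten L0) in
  [/\ gap_init G T K0 L0, {subset flatten L0 <= D}, forall u, stale st u -> u \in flatten L0 &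
      {in M, forall m, m \notin flatten L0}].
Proof.
move=> stt.
have [|L [uL eL cL]] := @chains_decomp V P T tre D.
  by move=> v; rewrite in_D => /and3P[_ _ /eqP].
pose L0 := [seq s <- L | has (stale st) s].
have subL : {subset L0 <= L} by move=> s; rewrite mem_filter => /andP[].
have fsub : {subset flatten L0 <= flatten L}.
  by move=> z /flattenP[s /subL sL zs]; apply/flattenP; exists s.
have LD : {subset flatten L0 <= D} by move=> z /fsub; rewrite eL.
have stL u : stale st u -> u \in flatten L0.
  move=> su; have := stale_in_D su; rewrite -eL => /flattenP[s sL us].
  apply/flattenP; exists s => //; rewrite mem_filter sL andbT.
  by apply/hasP; exists u.
have ML : {in M, forall m, m \notin flatten L0}.
  by move=> m mM; apply/negP => /LD; rewrite in_D mM andbF.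
have uL0 : uniq (flatten L0).
  rewrite /L0; elim: (L) uL => //= s l IH; rewrite cat_uniq => /and3P[us /hasPn d ul].
  case: ifP => _; last exact: IH.
  rewrite /= cat_uniq us IH // andbT; apply/hasPn => z /flattenP[s' s'l zs].
  by apply: d; apply/flattenP; exists s' => //; move: s'l; rewrite mem_filter => /andP[].
exists L0 => K0; split=> //.
have inK0 z : (z \in K0) = (z \notin flatten L0) && ((z \in P) || (z \in M)).
  by rewrite in_fsetD in_fsetU !in_fset_of.
have MK0 : {subset M <= K0} by move=> m mM; rewrite inK0 ML // mM orbT.
pose R := gap_rel G T L0.
have TR : subrel T R by exact: sub_gap_rel.
have Rsym : symmetric R by exact: gap_rel_sym.
have notD_notL0 z : z \notin D -> z \notin flatten L0 by apply: contra; exact: LD.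
(* The path from [x] to the marked page stays in [B x]. If it met a gap, it would run through all of
   it and hence through a stale page, but all pages of [B x] are evicted. *)
have hopC x : x \in C' -> x \notin M -> (exists2 z, z \in B x & z \in M) ->
    exists2 m, m \in M & reach R K0 x m.
  move=> xC xM [z zB zM]; have [p [pp lp sp]] := Bconn xC zB.
  case/shortenP: pp lp => p' pp' up' sub lp'.
  have {sub sp}sp : {subset x :: p' <= B x}.
    move=> w; rewrite inE => /orP[/eqP->|/sub wp]; first exact: Bv.
    by apply: sp; rewrite inE wp orbT.
  have xD : x \notin D.
    by rewrite in_D; have := Cbr xC; rewrite branchE => /andP[_ /negbTE->]; rewrite !andbF.
  have hM : has (mem M) p'.
    apply/hasP; exists z => //; have := mem_last x p'; rewrite lp' inE => /orP[/eqP e|//].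
    by rewrite -e zM in xM.
  move: pp' up' sp {lp'}; case: (split_find hM) => m p1 p2 mM h1.
  have {}mM : m \in M by [].
  rewrite cat_path => /andP[pp _]; rewrite -cat_cons cat_uniq => /andP[up _] sp.
  exists m => //; exists (rcons p1 m); split.
  - by apply: sub_path pp.
  - by rewrite last_rcons.
  move=> w; rewrite -rcons_cons mem_rcons inE => /orP[/eqP->|]; first exact: MK0.
  have xP : x \in P by have := Cbr xC; rewrite branchE => /andP[].
  rewrite inE => /orP[/eqP->|w1]; first by rewrite inK0 xP andbT; exact: notD_notL0.
  have wB : w \in B x by apply: sp; rewrite inE mem_cat mem_rcons inE w1 !orbT.
  have wP : w \in P by apply: evP; exact: Bev wB.
  rewrite inK0 wP andbT; apply/negP => /flattenP[s sL0 ws].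
  have /cL[_ [a [b [aD bD ch]]]] := subL s sL0.
  have sD : {subset s <= D} by move=> u us; apply: LD; apply/flattenP; exists s.
  move: w1 pp up sp {h1}; case/splitPr => q1 q2; rewrite rcons_cat cat_path => /andP[pq1].
  rewrite rcons_cons [path _ _ _]/= => /andP[Tw pq2] up sp.
  have pback : path T w (rev (x :: q1)).
    have -> : rev (x :: q1) = rev (belast x (rcons q1 w)) by rewrite belast_rcons.
    have := rev_path T x (rcons q1 w); rewrite last_rcons => ->.
    by rewrite (eq_path (e' := T)) ?rcons_path ?pq1 // => c d; exact: Tsym.
  have lback : last w (rev (x :: q1)) \notin s.
    by rewrite rev_cons last_rcons; apply: contra xD; exact: sD.
  have lfwd : last w (rcons q2 m) \notin s.
    by rewrite last_rcons; apply/negP => /sD; rewrite in_D mM andbF.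
  have wne c : c \notin D -> w != c.
    by move=> cD; apply: contraNneq cD => <-; exact: sD.
  have dsj c : c \notin D -> c \in rcons q2 m -> c \notin rev (x :: q1).
    move=> cD cq; rewrite mem_rev; apply/negP => cx.
    move: up; rewrite -cat_cons cat_uniq => /and3P[_ /hasPn h _].
    by have := h c; rewrite inE cq orbT => /(_ isT); rewrite /= cx.
  have [t1 [t2 es]] : exists t1 t2 : seq V, s = t1 ++ w :: t2.
    by case/splitPr: ws => t1 t2; exists t1, t2.
  rewrite es in ch lback lfwd.
  have cov c : c \in t1 ++ w :: t2 -> (c \in w :: rcons q2 m) || (c \in rev (x :: q1)).
    have t2c : {subset t2 <= rcons q2 m} \/ {subset t2 <= rev (x :: q1)}.
      case: (boolP (a \in rcons q2 m)) => aq; last by left; exact: (chain_follow ch pq2 lfwd aq).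
      by right; apply: (chain_follow ch pback lback); exact: dsj.
    have t1c : {subset t1 <= rcons q2 m} \/ {subset t1 <= rev (x :: q1)}.
      case: (boolP (b \in rcons q2 m)) => aq; last by left; exact: (chain_follow_rev Tsym ch pq2 lfwd aq).
      by right; apply: (chain_follow_rev Tsym ch pback lback); exact: dsj.
    rewrite mem_cat !inE; case/or3P => [c1|/eqP->|c2]; last 2 first.
    - by rewrite eqxx.
    - by case: t2c => /(_ c c2) ->; rewrite ?orbT.
    by case: t1c => /(_ c c1) ->; rewrite ?orbT.
  have /hasP[c cs sc] : has (stale st) (t1 ++ w :: t2) by rewrite -es; move: sL0; rewrite mem_filter => /andP[].
  have cM : c \notin M by move: sc => /and3P[].
  have : c \in B x.
    apply: sp; move: (cov c cs); rewrite mem_rev.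
    rewrite !(mem_cat, inE, mem_rcons) /=.
    have -> : c == m = false by apply: contraNF cM => /eqP->.
    by case: (c == x); case: (c \in q1); case: (c == w); case: (c \in q2); rewrite ?orbT.
  by move=> /(Bev xC) ce; move: sc; rewrite /stale ce !andbF.
(* An outer neighbour outside [D] that is unmarked has degree other than 2 and is not stale, since
   stale pages are in [D]. So it is a hole from Subphase I. *)
have hopE s x y : {subset s <= D} -> has (stale st) s -> chain T x s y ->
    x \notin D -> x \in P -> x \notin M -> exists2 m, m \in M & reach R K0 x m.
  move=> sD hs ch xD xP xM.
  have xh : hole st x.
    by apply: unmarked_hole => //; apply/negP => /stale_in_D; apply/negP.
  have xb : branch st x by rewrite branchE xP /=; move: xD; rewrite in_D xP xM.
  have xC := hole_branch xh xb.
  by apply: hopC => //; exact: gap_end_marked ch sD xC hs.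
have hop u : u \in P -> u \in K0 -> exists2 m, m \in M & reach R K0 u m.
  move=> uP uK; have tP : t \in P by case/and3P: stt.
  have [p [pp lp _ sp]] := tree_path tre uP tP.
  elim: p u uP uK pp lp sp => [|a p IH] u uP uK /=.
    by move=> _ e; move: uK; rewrite inK0 e stL.
  move=> /andP[Tua pp] lp sp.
  have [uM|uM] := boolP (u \in M); first by exists u => //; exact: reach_refl.
  have aP : a \in P by apply: sp; rewrite inE eqxx.
  have [aK|aK] := boolP (a \in K0).
    have [|m mM r] := IH a aP aK pp lp; first by move=> z zp; apply: sp; rewrite inE zp orbT.
    by exists m => //; apply: reach_trans r; apply: reach_step => //; exact: TR.
  have /flattenP[s sL0 as'] : a \in flatten L0 by move: aK; rewrite inK0 aP andbT negbK.
  have /cL[_ [x [y [xD yD ch]]]] := subL s sL0.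
  have us : u \notin s.
    by apply/negP => us; move: uK; rewrite inK0 => /andP[/negP]; case; apply/flattenP; exists s.
  have Tau : T a u by rewrite Tsym.
  have := chain_nbr ch as' Tau; rewrite inE mem_rcons inE (negbTE us) orbF.
  have sD : {subset s <= D} by move=> w ws; apply: LD; apply/flattenP; exists s.
  have hs : has (stale st) s by move: sL0; rewrite mem_filter => /andP[].
  case/orP => /eqP e; subst u; first exact: (hopE s x y).
  apply: (hopE (rev s) y x) => //; last exact: chain_rev.
    by move=> w; rewrite mem_rev; exact: sD.
  by rewrite has_rev.
split=> //.
- have [m0 m0M] : exists m, m \in M by case: (M) M0 => // m l; exists m; rewrite inE eqxx.
  have MM m m' : m \in M -> m' \in M -> reach R K0 m m'.
    case eM : M => [//|a l].
    have pl : path R a l.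
      have : path (step G) a l by move: sM; rewrite eM.
      have : {subset a :: l <= M} by rewrite eM.
      elim: (l) (a) => //= c l' IH a' sub /andP[Eac pl].
      have a'M : a' \in M by apply: sub; rewrite inE eqxx.
      have cM : c \in M by apply: sub; rewrite !inE eqxx orbT.
      rewrite /R /gap_rel Eac !ML // orbT /=; apply: IH => // z zs.
      by apply: sub; rewrite inE zs orbT.
    have sub : {subset a :: l <= K0} by rewrite -eM.
    move=> h1 h2; apply: (@reach_trans _ _ _ a); last exact: (reach_path pl).
    by apply: reach_sym => //; exact: (reach_path pl).
  apply: (@conn_root _ _ _ m0) => // u uK.
  have [uM|uM] := boolP (u \in M); first exact: MM.
  have uP : u \in P by move: uK; rewrite inK0 (negbTE uM) orbF => /andP[].
  have [m mM r] := hop u uP uK.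
  by apply: (@reach_trans _ _ _ m); [exact: MM|exact: reach_sym].
- by move=> z zL; rewrite inK0 zL.
move=> s sL0; have [s0 [x [y [xD yD ch]]]] := cL s (subL s sL0); split=> //.
have xyP : x \in P /\ y \in P.
  have := chain_path s0 ch; case: (s) s0 => // v s' _ /= /andP[/(tree_in tre)[xP _ _]].
  by rewrite rcons_path => /andP[_ /(tree_in tre)[_ yP _]].
exists x, y; rewrite !inK0 !xyP.1 !xyP.2 /= !andbT; split=> //; exact: notD_notL0.
Qed.

End StartIII.

(** * The victim of Subphase III and the middle of its gap *)

Lemma lev_double g n m : 0 < g -> g <= n -> 2 * n <= m -> lev g n < lev g m.
Proof.
move=> g0 gn nm; rewrite /lev; case: (ltnP n g) => [|_]; first by move: gn; clear; lia.
case: (ltnP m g) => [|_]; first by move: gn nm; clear; lia.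
have h : 2 * (n %/ g) <= m %/ g.
  by rewrite leq_divRL // -mulnA; apply: leq_trans nm; rewrite leq_mul2l /= leq_trunc_div.
rewrite ltnS; apply: leq_trans (leq_trunc_log 2 h).
by rewrite mul2n trunc_log2_double // divn_gt0.
Qed.

(** If [e' = 0], the diminished size [n - 2 * g] is at most half of the diminished size of the gap,
    and a level is lost. Otherwise the side keeps [e] but loses the flag [e']. *)
Lemma psi_center g n m e e' : 0 < g -> 10 * g <= n + m.+1 -> (e' = 0 -> n <= m + 2 * g) ->
  psi g n e < psi g (n + m.+1) (e + e').
Proof.
move=> g0 big cen.
have -> : psi g (n + m.+1) (e + e') = lev g (n + m.+1 - 2 * g) + (e + e') by rewrite /psi ltnNge big.
have pos : 0 < lev g (n + m.+1 - 2 * g) by rewrite lev_gt0; move: big; clear; lia.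
rewrite /psi; case: (ltnP n) => hn; first by move: pos; clear; lia.
case: e' cen => [|e'] cen.
  rewrite addn0 ltn_add2r; apply: lev_double => //; first by move: hn; clear; lia.
  by have := cen erefl; move: hn; clear; lia.
rewrite [e + _]addnS addnS ltnS addnA; apply: leq_trans (leq_addr _ _); rewrite leq_add2r.
by apply: lev_mono; apply: leq_sub2r; clear; lia.
Qed.

Section EvictIII.
Variables (V : choiceType) (st : state V) (g : nat).
Let P := previous st.
Let T := tree st.
Hypothesis tre : spanning_tree P T.
Hypothesis g0 : 0 < g.
Hypothesis few_holes : forall l : seq V, uniq l -> all (hole st) l -> size l <= g.
Implicit Types (u v w x y z : V) (s p : seq V).

Let Tsym : symmetric T. Proof. by case: tre. Qed.

Lemma chain_prefix x v s y q : chain T x (v :: s) y -> path T v q -> uniq (v :: q) ->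
  x \notin q -> (exists t, s = q ++ t) \/ (exists t, q = s ++ t).
Proof.
elim: s x v q => [|c s IH] x v [|d q].
- by move=> _ _ _ _; left; exists [::].
- by move=> _ _ _ _; right; exists (d :: q).
- by move=> _ _ _ _; left; exists (c :: s).
move=> ch; have [_ _ _ only ch'] := ch; rewrite [path _ _ _]/= => /andP[Tvd pq] up.
rewrite inE negb_or => /andP[xd xq].
case: (only d Tvd) => e; first by rewrite e eqxx in xd.
rewrite /= in e; subst d.
have [vc uq] : v \notin c :: q /\ uniq (c :: q) by move: up; rewrite cons_uniq => /andP[].
have vq : v \notin q by move: vc; rewrite inE negb_or => /andP[].
by case: (IH v c q ch' pq uq vq) => -[t ->]; [left|right]; exists t.
Qed.

Lemma unmarked_rev p : unmarked_path st p -> unmarked_path st (rev p).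
Proof.
move=> [p0 up pp hp]; split.
- by rewrite -size_eq0 size_rev size_eq0.
- by rewrite rev_uniq.
- by rewrite rev_sorted (eq_sorted (e' := T)) // => a b; exact: Tsym.
by move=> v; rewrite mem_rev; exact: hp.
Qed.

Lemma maximal_rev p : maximal_path st p -> maximal_path st (rev p).
Proof.
move=> [up hs mx]; split; [exact: unmarked_rev|by rewrite has_rev|].
move=> q uq h z zq; rewrite mem_rev; apply: (mx q uq _ z zq).
by move=> t tp; apply: h; rewrite mem_rev.
Qed.

Lemma off_center_rev p v : uniq p -> v \in p -> off_center (rev p) v = off_center p v.
Proof.
move=> up vp; rewrite /off_center size_rev.
case: (path.splitPr vp) up => p1 p2 up.
have v1 : v \notin p1 by move: up; rewrite cat_uniq /= negb_or => /and3P[_ /andP[]].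
have v2 : v \notin rev p2 by move: up; rewrite cat_uniq /= mem_rev => /and3P[_ _ /andP[]].
rewrite rev_cat rev_cons cat_rcons !index_mid // size_rev size_cat /=.
by clear; lia.
Qed.

(** The last two hypotheses orient the path, so that [pr] starts towards [s2] and not towards [s1].
    If [pr] stopped inside [s2], the next page of [s2] would prolong the path, against its
    maximality; acyclicity excludes that this page is on [pl]. *)
Lemma maximal_side pl w pr x s1 s2 y : maximal_path st (pl ++ w :: pr) ->
    chain T x (s1 ++ w :: s2) y -> uniq (s1 ++ w :: s2) ->
    {in s1 ++ w :: s2, forall v, v \in P /\ ~~ marked st v} ->
    (pl = [::] \/ last w pl != head y s2) -> (pr = [::] \/ head w pr != last x s1) ->
  exists t, pr = s2 ++ t.
Proof.
move=> [[p0 up pp hp] hs mx] ch us hsu opl opr.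
have pwr : path T w pr by move: pp; case: (pl) => [|a l] //=; rewrite cat_path => /andP[_ /andP[]].
have uwr : uniq (w :: pr) by move: up; rewrite cat_uniq => /and3P[].
have [_ ch2] := (chain_cat T x s1 w s2 y).1 ch.
have [Taw _ _ _ _] := ch2.
have apr : last x s1 \notin pr.
  apply/negP => apr; case: opr => [e|ne]; first by rewrite e in apr.
  move: apr ne pwr uwr; case/splitPr => q1 q2 ne pwr uwr.
  have pq : path T w (rcons q1 (last x s1)) by move: pwr; rewrite -cat_rcons cat_path => /andP[].
  have uq : uniq (w :: rcons q1 (last x s1)).
    by move: uwr; rewrite -cat_rcons -cat_cons cat_uniq => /andP[].
  have sq : 1 < size (rcons q1 (last x s1)).
    by case: (q1) ne => [|? ?]; rewrite ?eqxx // size_rcons.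
  by have := tree_acyclic tre pq uq sq; rewrite last_rcons Taw.
case: (chain_prefix ch2 pwr uwr apr) => // -[[|c t] es2].
  by exists [::]; rewrite es2 !cats0.
exfalso.
have cs : c \in s1 ++ w :: s2 by rewrite es2 mem_cat inE mem_cat inE eqxx !orbT.
have Tlc : T (last w pr) c.
  have := chain_path1 ch2; rewrite es2 [path _ _ _]/= cat_path => /andP[_ /andP[_]].
  by case/andP.
have cpr : c \notin w :: pr.
  move: us; rewrite cat_uniq es2 => /and3P[_ _]; rewrite -cat_cons cat_uniq => /and3P[_ /hasPn h _].
  by apply: h; rewrite inE eqxx.
have cp : c \notin pl ++ w :: pr.
  rewrite mem_cat negb_or cpr andbT; apply/negP => cpl.
  move: cpl opl pp up {p0 hp hs mx}; case/splitPr => q1 q2 opl pp up.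
  have pq : path T c (q2 ++ w :: pr).
    move: pp; rewrite -catA; case: (q1) => [|a l] //=; rewrite cat_path => /andP[_].
    by case/andP.
  have uq : uniq (c :: q2 ++ w :: pr) by move: up; rewrite -catA cat_uniq => /and3P[].
  have sq : 1 < size (q2 ++ w :: pr).
    rewrite size_cat /=; case: (q2) opl => [|? ?]; last by move=> _; rewrite /= addnS.
    case: (pr) es2 => [|? ?] es2 [] //; first by case: (q1).
    by rewrite last_cat /= es2 eqxx.
  by have := tree_acyclic tre pq uq sq; rewrite last_cat /= Tlc.
have := mx (rcons (pl ++ w :: pr) c) _ _ c; rewrite mem_rcons inE eqxx => h.
apply: (negP cp); apply: h => //; last by move=> z zp; rewrite mem_rcons inE zp orbT.
have lc : last w (pl ++ w :: pr) = last w pr by rewrite last_cat.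
split.
- by rewrite -size_eq0 size_rcons.
- by rewrite rcons_uniq cp up.
- by case: (pl) pp lc => [|a l] /= pp lc; rewrite rcons_path pp /= ?lc //= last_cat.
move=> v; rewrite mem_rcons inE => /orP[/eqP->|]; last exact: hp.
by have [] := hsu c cs.
Qed.

(* Otherwise the g + 1 pages of the gap next to w on its long side would be
   closer to the midpoint, hence all be holes. *)
Lemma oriented_center pl w pr x s1 s2 y : maximal_path st (pl ++ w :: pr) -> stale st w ->
    chain T x (s1 ++ w :: s2) y -> uniq (s1 ++ w :: s2) ->
    {in s1 ++ w :: s2, forall v, v \in P /\ ~~ marked st v} -> marked st y ->
    (pl = [::] \/ last w pl != head y s2) -> (pr = [::] \/ head w pr != last x s1) ->
    (forall u, u \in pl ++ w :: pr -> stale st u ->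
       off_center (pl ++ w :: pr) w <= off_center (pl ++ w :: pr) u) ->
  size s1 <= size s2 + 2 * g.
Proof.
move=> mp sw ch us hsu my opl opr mc.
have [[p0 up pp hp] hs mx] := mp.
(* Beyond [s2] the path would have to go to [y], which is marked, or else close a cycle or repeat a
   page. *)
have er : pr = s2.
  have [t e1] := maximal_side mp ch us hsu opl opr.
  have t0 : t = [::].
    have [_ ch2] := (chain_cat T x s1 w s2 y).1 ch.
    case: t e1 => [//|c t] e1.
    exfalso; have cp : c \in pl ++ w :: pr by rewrite e1 mem_cat inE mem_cat inE eqxx !orbT.
    have pwr : path T w (s2 ++ c :: t).
      by move: pp; rewrite e1; case: (pl) => [|a l] //=; rewrite cat_path => /andP[_ /andP[]].
    have Tlc : T (last w s2) c by move: pwr; rewrite cat_path => /andP[_ /andP[]].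
    have uwr : uniq (w :: s2 ++ c :: t) by move: up; rewrite e1 cat_uniq => /and3P[].
    have apr : last x s1 \notin c :: t.
      case: opr => [e|ne]; first by move: e; rewrite e1; case: (s2).
      apply/negP => apr; move: apr ne pwr uwr e1; case/splitPr => q1 q2 ne pwr uwr e1.
      have pq : path T w (rcons (s2 ++ q1) (last x s1)).
        by move: pwr; rewrite catA -cat_rcons cat_path => /andP[].
      have uq : uniq (w :: rcons (s2 ++ q1) (last x s1)).
        by move: uwr; rewrite catA -cat_rcons -cat_cons cat_uniq => /andP[].
      have sq : 1 < size (rcons (s2 ++ q1) (last x s1)).
        rewrite size_rcons ltnS; case: (s2) e1 => [|? ?] // e1; case: (q1) e1 => [|? ?] // e1.
        by move: ne; rewrite e1 /= eqxx.
      have [Taw _ _ _ _] := ch2.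
      by have := tree_acyclic tre pq uq sq; rewrite last_rcons Taw.
    have lin : last w s2 \in w :: s2 := mem_last w s2.
    have : c \in last x s1 :: rcons (w :: s2) y by exact: chain_nbr ch2 lin Tlc.
    rewrite inE => /orP[/eqP ec|]; first by move: apr; rewrite -ec inE eqxx.
    rewrite mem_rcons inE => /orP[/eqP ec|cs].
      by have [_] := hp c cp; rewrite ec my.
    by move: uwr; rewrite -cat_cons cat_uniq => /and3P[_ /hasPn /(_ c) h _]; move: h; rewrite inE eqxx /= cs => /(_ isT).
  by rewrite e1 t0 cats0.
subst pr.
have [t el] : exists t, pl = t ++ s1.
  have mr : maximal_path st (rev s2 ++ w :: rev pl).
    by have := maximal_rev mp; rewrite rev_cat rev_cons cat_rcons.
  have cr : chain T y (rev s2 ++ w :: rev s1) x.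
    by have := chain_rev Tsym ch; rewrite rev_cat rev_cons cat_rcons.
  have hd s z : head z (rev s) = last z s by case/lastP: s => // s c; rewrite rev_rcons last_rcons.
  have la s z : last z (rev s) = head z s by case: s => // c s; rewrite rev_cons last_rcons.
  have ur : uniq (rev s2 ++ w :: rev s1).
    by rewrite -cat_rcons -rev_cons -rev_cat rev_uniq.
  have [|||t et] := maximal_side mr cr ur.
  - move=> v hv; apply: hsu; move: hv; rewrite !mem_cat !inE !mem_rev.
    by case: (v \in s1); case: (v \in s2); rewrite ?orbT.
  - rewrite hd la; case: opr => [->|ne]; [by left|by right].
  - rewrite hd la; case: opl => [->|ne]; [by left|by right].
  by exists (rev t); rewrite -[pl]revK et rev_cat revK.
rewrite leqNgt; apply/negP => far.
pose n := size s1 - g.+1; pose l := drop n s1.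
have sl : size l = g.+1 by rewrite size_drop /n; move: far g0; clear; lia.
suff : size l <= g by rewrite sl ltnn.
have us1 : uniq s1 by move: us; rewrite cat_uniq => /andP[].
apply: few_holes; first by rewrite drop_uniq.
apply/allP => v vl; have v1 : v \in s1 by exact: mem_drop vl.
have vs : v \in s1 ++ w :: s2 by rewrite mem_cat v1.
have [vP vM] := hsu v vs.
rewrite /hole vP (negbTE vM : v \in current st = false) andbT /=.
apply: contraT => nev.
have vst : stale st v by rewrite /stale vP vM nev.
have vp : v \in pl ++ w :: s2 by rewrite el !mem_cat v1 orbT.
have := mc v vp vst.
have [l1 [l2 e]] : exists l1 l2 : seq V, l = l1 ++ v :: l2.
  by case/splitPr: vl => l1 l2; exists l1, l2.
have el2 : size l1 + size l2 = g by move: sl; rewrite e size_cat /= addnS => -[].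
have ep : pl ++ w :: s2 = (t ++ take n s1 ++ l1) ++ v :: (l2 ++ w :: s2).
  by rewrite el -{1}(cat_take_drop n s1) -/l e -!catA.
have wpl : w \notin pl by move: up; rewrite cat_uniq /= negb_or => /and3P[_ /andP[]].
have vpl : v \notin t ++ take n s1 ++ l1.
  by move: up; rewrite ep cat_uniq /= negb_or => /and3P[_ /andP[]].
rewrite /off_center index_mid //.
have -> : index v (pl ++ w :: s2) = size (t ++ take n s1 ++ l1) by rewrite ep index_mid.
have -> : size (pl ++ w :: s2) = size pl + (size s2).+1 by rewrite size_cat.
have -> : size (t ++ take n s1 ++ l1) = size t + n + size l1.
  by rewrite !size_cat size_takel ?addnA // /n leq_subr.
have -> : size pl = size t + size s1 by rewrite el size_cat.
by move: far el2 g0; rewrite /n; clear; lia.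
Qed.

Lemma evict_center p w x s1 s2 y : maximal_path st p -> w \in p -> stale st w ->
    chain T x (s1 ++ w :: s2) y -> uniq (s1 ++ w :: s2) ->
    {in s1 ++ w :: s2, forall v, v \in P /\ ~~ marked st v} -> marked st y ->
    (forall u, u \in p -> stale st u -> off_center p w <= off_center p u) ->
  size s1 <= size s2 + 2 * g.
Proof.
move=> mp wp sw ch us hsu my mc.
have [[p0 up pp hp] hs mx] := mp.
have [pl [pr ep]] : exists pl pr : seq V, p = pl ++ w :: pr.
  by case/splitPr: wp => pl pr; exists pl, pr.
have [_ [Taw Twb ab only _]] := (chain_cat T x s1 w s2 y).1 ch.
have dif : pl != [::] -> pr != [::] -> last w pl != head w pr.
  move=> pl0 pr0; apply/eqP => e; move: up; rewrite ep cat_uniq => /and3P[_ /hasPn h _].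
  have := h (head w pr); rewrite inE /= -e.
  case: (pr) pr0 e => [//|c q] _ e; rewrite e [head _ _]/= inE eqxx orbT => /(_ isT).
  by case/lastP: (pl) pl0 e => [//|q' d] _; rewrite last_rcons => ->; rewrite mem_rcons inE eqxx.
have hd s z : head z (rev s) = last z s by case/lastP: s => // s c; rewrite rev_rcons last_rcons.
have la s z : last z (rev s) = head z s by case: s => // c s; rewrite rev_cons last_rcons.
(* Either the path or its reverse runs through the gap in the direction of the chain. *)
have good : ((pl = [::] \/ last w pl != head y s2) /\ (pr = [::] \/ head w pr != last x s1)) \/
    ((pr = [::] \/ head w pr != head y s2) /\ (pl = [::] \/ last w pl != last x s1)).
  have [l0|l0] := eqVneq pl [::]; have [r0|r0] := eqVneq pr [::].
  - by left; split; left.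
  - have [e|ne] := eqVneq (head w pr) (last x s1); last by left; split; [left|right].
    by right; split; [right; rewrite e|left].
  - have [e|ne] := eqVneq (last w pl) (head y s2); last by left; split; [right|left].
    by right; split; [left|right; rewrite e eq_sym].
  have d := dif l0 r0.
  have [e|ne] := eqVneq (head w pr) (last x s1).
    by right; split; right; rewrite -?e // e.
  have [e'|ne'] := eqVneq (last w pl) (head y s2); last by left; split; right.
  by right; split; right; [rewrite -e' eq_sym|rewrite e' eq_sym].
case: good => -[o1 o2].
  by rewrite ep in mp mc; exact: (oriented_center mp sw ch us hsu my o1 o2 mc).
have er : rev p = rev pr ++ w :: rev pl by rewrite ep rev_cat rev_cons cat_rcons.
have mr := maximal_rev mp; rewrite er in mr.
apply: (oriented_center mr sw ch us hsu my).
- by rewrite la; case: o1 => [->|ne]; [left|right].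
- by rewrite hd; case: o2 => [->|ne]; [left|right].
move=> u; rewrite -er mem_rev => up' su.
by rewrite !off_center_rev //; exact: mc.
Qed.

Theorem evict_psi p w x e s1 s2 e' y : maximal_path st p -> w \in p -> stale st w ->
    chain T x (s1 ++ w :: s2) y -> uniq (s1 ++ w :: s2) ->
    {in s1 ++ w :: s2, forall v, v \in P /\ ~~ marked st v} ->
    (e = 0 -> marked st x) -> (e' = 0 -> marked st y) ->
    (forall u, u \in p -> stale st u -> off_center p w <= off_center p u) ->
    10 * g <= size (s1 ++ w :: s2) ->
  maxn (psi g (size s1) e) (psi g (size s2) e') < psi g (size (s1 ++ w :: s2)) (e + e').
Proof.
move=> mp wp sw ch us hsu mx my mc; rewrite size_cat /= => big.
rewrite gtn_max; apply/andP; split.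
  apply: psi_center => // e0; exact: evict_center ch us hsu (my e0) mc.
have es : size s1 + (size s2).+1 = size s2 + (size s1).+1 by clear; lia.
rewrite es [e + e']addnC; apply: psi_center => //; first by rewrite -es.
move=> e0; rewrite -(size_rev s1) -(size_rev s2).
apply: (evict_center mp wp sw _ _ _ (mx e0) mc).
- by have := chain_rev Tsym ch; rewrite rev_cat rev_cons cat_rcons; exact.
- by rewrite -cat_rcons -rev_cons -rev_cat rev_uniq.
by move=> v hv; apply: hsu; move: hv; rewrite -cat_rcons -rev_cons -rev_cat mem_rev.
Qed.

End EvictIII.

(** * The phases of DTO *)

Section PhaseInvariant.
Variables (V : choiceType) (G : rel V) (k : nat).
Hypothesis Gsym : symmetric G.
Notation E := (step G).
Implicit Types (st : state V) (u v w x y z : V) (s : seq V) (B : V -> {fset V}) (g : nat).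

(** Speaks of a phase after the first. [ph_link] is the edge along which the phase was entered; it
    turns the tree of the previous phase and one new page into a tree on [k + 1] pages. *)
Record phase_ok st : Prop := PhaseOk {
  ph_tree : spanning_tree (previous st) (tree st);
  ph_prev : sorted E (previous st);
  ph_cur : sorted E (current st);
  ph_start : current st != [::];
  ph_evicted : {subset evicted st <= previous st};
  ph_card : #|` fset_of (previous st)| = k;
  ph_new : k < #|` fset_of (previous st) `|` fset_of (current st)|;
  ph_link : exists a x, [/\ a \in previous st, x \notin previous st & E a x]
}.

Definition branches st := [fset v in previous st | branch st v].
(** For each vertex of degree other than 2, one eviction in Subphase I and the [g + 1] pages to
    which its set may grow in Subphase II. *)
Definition base g st := #|` branches st| * g.+2.

Lemma in_branches st v : (v \in branches st) = branch st v.
Proof. by rewrite !inE /=; apply: andb_idl => /andP[]. Qed.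

Record stage2 g st (C' : {fset V}) B : Prop := Stage2 {
  s2_stale : forall u, stale st u -> ~~ branch st u;
  s2_branch : forall v, v \in C' -> branch st v;
  s2_self : forall v, v \in C' -> v \in B v;
  s2_evicted : forall v, v \in C' -> {subset B v <= evicted st};
  s2_other : forall v w, v \in C' -> w \in B v -> w != v -> ~~ branch st w;
  s2_conn : forall v w, v \in C' -> w \in B v -> reach (tree st) (B v) v w;
  s2_hole : forall w, hole st w -> exists2 v, v \in C' & w \in B v;
  s2_card : forall v, v \in C' -> #|` B v| <= g.+1;
  s2_cover : forall u, u \in evicted st -> branch st u \/ exists2 v, v \in C' & u \in B v
}.

Definition good_gap st (c : gap V) := [/\ c.1.1 <= 1, c.2 <= 1 & exists x y,
  [/\ chain (tree st) x (seg c) y, c.1.1 = 0 -> marked st x & c.2 = 0 -> marked st y]].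

(** [K0], [L0] and [p] are fixed at the beginning of Subphase III. [s] is the walk since then, [C]
    the list of present gaps with their flags, and [e3] the number of evictions in Subphase III,
    which the potential has to pay for. *)
Record stage3_data g st (K0 : {fset V}) (L0 : seq (seq V)) (p : V) s (C : seq (gap V))
    (a b e3 : nat) : Prop := Stage3 {
  s3_init : gap_init G (tree st) K0 L0;
  s3_start : p \in K0;
  s3_path : path E p s;
  s3_last : last p s = last p (current st);
  s3_run : run g L0 s (segs C) a b;
  s3_verts : vverts K0 L0 `|` fset_of s = fset_of (previous st) `|` fset_of (current st);
  s3_new : k < #|` vverts K0 L0|;
  s3_card : #|` evicted st| <= base g st + e3;
  s3_pot : e3 + pot g (hole st) (stale st) C <=
    3 * g * levs g L0 + \sum_(s <- L0) minn (10 * g) (size s) + 12 * g * a + b;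
  s3_gaps : {in flatten (segs C), forall z, z \in previous st /\ ~~ marked st z};
  s3_stale : forall z, stale st z -> z \in flatten (segs C);
  s3_good : {in C, forall c, good_gap st c}
}.

Definition stage3 g st := exists K0 L0 p s C a b e3, stage3_data g st K0 L0 p s C a b e3.

Definition stage_inv g st (sub : subphase V) : Prop :=
  match sub with
  | SubI => forall u, u \in evicted st -> branch st u
  | SubII C' B => stage2 g st C' B
  | SubIII => stage3 g st
  end.

Definition few_holes g st := forall l : seq V, uniq l -> all (hole st) l -> size l <= g.

Lemma few_holes_count g st s : few_holes g st -> uniq s -> count (hole st) s <= g.
Proof.
move=> fh us; rewrite -size_filter; apply: fh; first exact: filter_uniq.
by apply/allP => z; rewrite mem_filter => /andP[].
Qed.

Lemma evicts_stale st sub w b : evicts st sub w b -> stale st w.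
Proof. by elim. Qed.

Definition after_evict st w : state V :=
  State (cache st) (w |` evicted st) (previous st) (current st) (tree st) (stage st).

Lemma stale_after st w z : stale (after_evict st w) z = (z != w) && stale st z.
Proof. by rewrite /stale /= in_fset1U negb_or; case: (z != w); rewrite ?andbF. Qed.

Lemma hole_after st w z : stale st w -> hole (after_evict st w) z = (z == w) || hole st z.
Proof.
rewrite /hole /= in_fset1U; case: eqP => [->|_] //= /and3P[wP wM _].
by rewrite wP wM.
Qed.

Lemma card_evicted st w : stale st w -> #|` w |` evicted st| = #|` evicted st|.+1.
Proof. by case/and3P => _ _ h; rewrite cardfsU1 h. Qed.

Lemma stage_card g st sub : (if sub is SubIII then False else True) -> stage_inv g st sub ->
  #|` evicted st| <= base g st.
Proof.
case: sub => [|C' B|] //= _.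
  move=> h; apply: leq_trans (_ : #|` branches st| <= _); last by rewrite /base leq_pmulr.
  by apply: fsubset_leq_card; apply/fsubsetP => u /h; rewrite in_branches.
move=> h.
have sub : evicted st `<=` branches st `|` \bigcup_(v <- C') B v.
  apply/fsubsetP => u /(s2_cover h)[br|[v vC uB]]; rewrite in_fsetU ?in_branches ?br //.
  by apply/orP; right; apply/bigfcupP; exists v => //; rewrite vC.
apply: leq_trans (fsubset_leq_card sub) _.
rewrite cardfsU; apply: leq_trans (leq_subr _ _) _.
have -> : base g st = #|` branches st| + #|` branches st| * g.+1 by rewrite /base mulnS.
rewrite leq_add2l.
have hC : #|` C'| <= #|` branches st|.
  by apply: fsubset_leq_card; apply/fsubsetP => v /(s2_branch h); rewrite in_branches.
apply: leq_trans (_ : #|` C'| * g.+1 <= _); last by rewrite leq_mul2r hC orbT.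
have : {subset enum_fset C' <= C'} by move=> z.
rewrite [#|` C'|]/size; elim: (enum_fset C') => [|v r IH] sr.
  by rewrite big_nil cardfs0.
rewrite big_cons cardfsU; apply: leq_trans (leq_subr _ _) _.
rewrite /= mulSn; apply: leq_add; first by apply: (s2_card h); apply: sr; rewrite inE eqxx.
by apply: IH => z zr; apply: sr; rewrite inE zr orbT.
Qed.

Definition after_mark st x : state V :=
  State (cache st) (evicted st) (previous st) (rcons (current st) x) (tree st) (stage st).

Lemma stale_mark st x z : stale (after_mark st x) z = (z != x) && stale st z.
Proof. by rewrite /stale /= mem_rcons inE negb_or; case: (z != x); rewrite ?andbF. Qed.

Lemma hole_mark st x z : hole (after_mark st x) z = (z != x) && hole st z.
Proof. by rewrite /hole /= mem_rcons inE negb_or; case: (z != x); rewrite ?andbF. Qed.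

Lemma marked_mark st x z : marked (after_mark st x) z = (z == x) || marked st z.
Proof. by rewrite /marked /= mem_rcons inE. Qed.

Lemma good_gap_mark st x c : good_gap st c -> good_gap (after_mark st x) c.
Proof.
move=> [h1 h2 [y [z [h3 h4 h5]]]]; split=> //; exists y, z; split=> // e.
- by rewrite marked_mark h4 ?orbT.
- by rewrite marked_mark h5 ?orbT.
Qed.

Lemma stage3_uniq g st K0 L0 p s C a b e3 : stage3_data g st K0 L0 p s C a b e3 ->
  uniq (flatten (segs C)).
Proof. by move=> h; have [] := run_gaps_ok (gap_init_ok (s3_init h)) (s3_run h). Qed.

Lemma gap_seg (c : gap V) C : c \in C -> {subset seg c <= flatten (segs C)}.
Proof. by move=> cC z zc; apply/flattenP; exists (seg c) => //; exact: map_f. Qed.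

Lemma in_gap (C : seq (gap V)) x : x \in flatten (segs C) ->
  exists (e : nat) (s1 s2 : seq V) (e' : nat) (C' : seq (gap V)),
  (e, s1 ++ x :: s2, e') \in C /\ perm_eq C ((e, s1 ++ x :: s2, e') :: C').
Proof.
case/flattenP => t /mapP[[[e t'] e'] cC ->]; rewrite /seg /= => xt.
have [s1 [s2 et]] : exists s1 s2 : seq V, t' = s1 ++ x :: s2.
  by case/splitPr: xt => s1 s2; exists s1, s2.
exists e, s1, s2, e', (rem (e, t', e') C); rewrite -et; split=> //; exact: perm_to_rem.
Qed.

Lemma stage3_mark g st x : 0 < g -> phase_ok st -> few_holes g st -> E (last x (current st)) x ->
  stage3 g st -> stage3 g (after_mark st x).
Proof.
move=> g0 ok fh Ex [K0 [L0 [p [s [C [a [b [e3 h]]]]]]]].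
have uC := stage3_uniq h.
have [m [M' eM]] : exists m M', current st = m :: M'.
  by case: (current st) (ph_start ok) => // m M' _; exists m, M'.
have pth : path E p (rcons s x).
  by rewrite rcons_path (s3_path h) (s3_last h) /= eM; move: Ex; rewrite eM.
have lst : last p (rcons s x) = last p (current (after_mark st x)).
  by rewrite /= !last_rcons.
have vts : vverts K0 L0 `|` fset_of (rcons s x) =
    fset_of (previous st) `|` fset_of (rcons (current st) x).
  have e t : fset_of (rcons t x) = fset_of t `|` [fset x].
    by apply/fsetP => z; rewrite !inE mem_rcons inE orbC.
  by rewrite !e !fsetUA (s3_verts h).
have crd := s3_card h.
have [xC|xC] := boolP (x \in flatten (segs C)).
  have [e [s1 [s2 [e' [C1 [cC hp]]]]]] := in_gap xC.
  have [e1 e1' [y [z [ch my mz]]]] := s3_good h cC.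
  have pf := flatten_split (perm_map (@seg V) hp).
  have inC' t : (t \in flatten (segs C)) = (t == x) || (t \in flatten (segs ((e, s1, 0) :: (0, s2, e') :: C1))).
    by rewrite (perm_mem pf) inE.
  have xC' : x \notin flatten (segs ((e, s1, 0) :: (0, s2, e') :: C1)).
    by move: uC; rewrite (perm_uniq pf) => /andP[].
  exists K0, L0, p, (rcons s x), ((e, s1, 0) :: (0, s2, e') :: C1),
    (a + incA g (minn (size s1) (size s2))),
    (b + incB g (size (s1 ++ x :: s2)) (minn (size s1) (size s2))), e3.
  split=> //.
  - exact: (s3_init h).
  - exact: (s3_start h).
  - by apply: RunSplit (s3_run h) _; exact: perm_map hp.
  - exact: (s3_new h).
  - have us : uniq (s1 ++ x :: s2).
      by move: uC; rewrite (perm_uniq (perm_flatten (perm_map (@seg V) hp))) cat_uniq => /andP[].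
    have hH t : t != x -> hole (after_mark st x) t = hole st t by move=> tx; rewrite hole_mark tx.
    have hS t : t != x -> stale (after_mark st x) t = stale st t by move=> tx; rewrite stale_mark tx.
    have hs := pot_split g0 hp uC e1 e1' hH hS (few_holes_count fh us).
    have h3 := s3_pot h; rewrite mulnDr; move: hs h3.
    move: (pot _ _ _ _) (pot _ _ _ _) (12 * g * a) (12 * g * incA _ _) (incB _ _ _).
    move: (3 * g * _) (\sum_(_ <- _) _).
    by clear; lia.
  - move=> t tC; have tC' : t \in flatten (segs C) by rewrite inC' tC orbT.
    have [h1 h2] := s3_gaps h tC'.
    split=> //; rewrite marked_mark negb_or h2 andbT.
    by apply: contraNneq xC' => <-.
  - by move=> t; rewrite stale_mark => /andP[tx /(s3_stale h)]; rewrite inC' (negbTE tx).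
  have [ch1 _ _ _ ch2] := chain_split ch.
  move=> c; rewrite !inE => /or3P[/eqP->|/eqP->|cC1].
  - split=> //; exists y, x; split=> // [/my|_]; rewrite marked_mark ?eqxx // => ->.
    by rewrite orbT.
  - split=> //; exists x, z; split=> // [_|/mz]; rewrite marked_mark ?eqxx // => ->.
    by rewrite orbT.
  by apply/good_gap_mark/(s3_good h); rewrite (perm_mem hp) inE cC1 orbT.
have nx t : t \in flatten (segs C) -> t != x by move=> tC; apply: contraNneq xC => <-.
exists K0, L0, p, (rcons s x), C, a, b, e3; split=> //.
- exact: (s3_init h).
- exact: (s3_start h).
- by apply: RunOut (s3_run h) _.
- exact: (s3_new h).
- rewrite (@eq_pot V g _ (hole st) _ (stale st)); first exact: (s3_pot h).
    by move=> t /nx; rewrite hole_mark => ->.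
  by move=> t /nx; rewrite stale_mark => ->.
- move=> t tC; have [h1 h2] := s3_gaps h tC; split=> //.
  by rewrite marked_mark negb_or h2 nx.
- by move=> t; rewrite stale_mark => /andP[_ /(s3_stale h)].
by move=> c /(s3_good h); exact: good_gap_mark.
Qed.

Lemma stage_mark g st sub x : 0 < g -> phase_ok st -> few_holes g st ->
  E (last x (current st)) x -> stage_inv g st sub -> stage_inv g (after_mark st x) sub.
Proof.
move=> g0 ok fh Ex; case: sub => [//|C' B|]; last exact: stage3_mark.
move=> h; split.
- by move=> u; rewrite stale_mark => /andP[_ /(s2_stale h)].
- exact: (s2_branch h).
- exact: (s2_self h).
- exact: (s2_evicted h).
- exact: (s2_other h).
- exact: (s2_conn h).
- by move=> u; rewrite hole_mark => /andP[_ /(s2_hole h)].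
- exact: (s2_card h).
exact: (s2_cover h).
Qed.

Lemma stage2_start g st : (forall u, stale st u -> ~~ branch st u) ->
  (forall u, u \in evicted st -> branch st u) -> stage2 g st (holes st) (fun v => [fset v]).
Proof.
move=> noI ev.
have inH z : (z \in holes st) = hole st z.
  by rewrite !inE /=; apply: andb_idl => /and3P[].
have hev z : hole st z -> z \in evicted st by case/and3P.
split=> //.
- by move=> v; rewrite inH => /hev/ev.
- by move=> v _; rewrite inE.
- by move=> v; rewrite inH => /hev ve z; rewrite inE => /eqP->.
- by move=> v w _; rewrite inE => /eqP->; rewrite eqxx.
- by move=> v w _; rewrite inE => /eqP->; apply: reach_refl; rewrite inE.
- by move=> w hw; exists w; rewrite ?inH ?inE.
- by move=> v _; rewrite cardfs1.
by move=> u /ev; left.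
Qed.

(** A set grows only while it is alive; then it consists of holes, at most [g] of them, hence the
    bound [g + 1] in [s2_card]. *)
Lemma stage2_evict g st C' B v w : few_holes g st -> stage2 g st C' B -> v \in C' ->
    alive st (B v) -> stale st w -> adjacent st (B v) w ->
  stage2 g (after_evict st w) C' (fun u => if u == v then w |` B v else B u).
Proof.
move=> fh h vC [allh _] sw [u uB Tuw].
have sub y : {subset B y <= (if y == v then w |` B v else B y)}.
  by move=> z; case: eqP => [->|//]; rewrite in_fset1U => ->; rewrite orbT.
split.
- by move=> z; rewrite stale_after => /andP[_ /(s2_stale h)].
- exact: (s2_branch h).
- by move=> y yC; apply: sub; exact: (s2_self h).
- move=> y yC z; rewrite /= in_fset1U; case: eqP => [_|_ zB]; last by rewrite (s2_evicted h yC zB) orbT.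
  by rewrite in_fset1U => /orP[->//|/(s2_evicted h vC)->]; rewrite orbT.
- move=> y z yC; case: eqP => [->|_]; last exact: (s2_other h).
  rewrite in_fset1U => /orP[/eqP-> _|]; first exact: (s2_stale h sw).
  exact: (s2_other h).
- move=> y z yC; case: eqP => [->|_]; last exact: (s2_conn h).
  have mono x : reach (tree st) (B v) v x -> reach (tree st) (w |` B v) v x.
    by case=> q [pq lq sq]; exists q; split=> // t /sq; rewrite in_fset1U => ->; rewrite orbT.
  rewrite in_fset1U => /orP[/eqP->|zB]; last exact/mono/(s2_conn h).
  apply: reach_trans (mono _ (s2_conn h vC uB)) _.
  exists [:: w]; split=> //=; first by rewrite Tuw.
  by move=> t; rewrite !inE => /orP[/eqP->|/eqP->]; rewrite ?eqxx // uB orbT.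
- move=> z; rewrite hole_after // => /orP[/eqP->|/(s2_hole h)[y yC zB]].
    by exists v => //; rewrite eqxx in_fset1U eqxx.
  by exists y => //; exact: sub.
- move=> y yC; case: eqP => [_|_]; last exact: (s2_card h).
  rewrite cardfsU1; have : size (enum_fset (B v)) <= g.
    by apply: fh; [exact: fset_uniq|apply/allP => z; exact: allh].
  rewrite -[size _]/#|` B v|; case: (_ \notin _) => /=; clear; lia.
move=> z; rewrite /= in_fset1U => /orP[/eqP->|/(s2_cover h)[br|[y yC zB]]].
- by right; exists v => //; rewrite eqxx in_fset1U eqxx.
- by left.
by right; exists y => //; exact: sub.
Qed.

Lemma stage3_start g st C' B t : 0 < g -> phase_ok st -> few_holes g st -> stage2 g st C' B ->
  (forall v, v \in C' -> ~ alive st (B v)) -> stale st t -> stage3 g st.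
Proof.
move=> g0 ok fh h dead stt.
have [L0 [gi LD SL ML]] := start_III Gsym (ph_tree ok) (ph_cur ok) (ph_start ok) (ph_evicted ok)
  (s2_stale h) dead (s2_self h) (s2_evicted h) (s2_other h) (s2_conn h) (s2_branch h) (s2_hole h) stt.
have [m [M' eM]] : exists m M', current st = m :: M'.
  by case: (current st) (ph_start ok) => // m M' _; exists m, M'.
pose p := last m M'.
have pM : p \in current st by rewrite eM mem_last.
have inL0 z : z \in flatten L0 -> z \in previous st /\ ~~ marked st z.
  by move=> /LD; rewrite !inE => /andP[-> /andP[]].
have sg : segs [seq (1, s, 1) | s <- L0] = L0 by rewrite /segs -map_comp map_id_in.
have vE : vverts ((fset_of (previous st) `|` fset_of (current st)) `\` fset_of (flatten L0)) L0 =
    fset_of (previous st) `|` fset_of (current st).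
  apply/fsetP => z; rewrite /vverts in_fsetU in_fsetD in_fsetU !in_fset_of.
  case: (boolP (z \in flatten L0)) => [/inL0[-> _]//|_] /=.
  by rewrite orbF.
have ui : uniq (flatten L0) by case: gi.
exists ((fset_of (previous st) `|` fset_of (current st)) `\` fset_of (flatten L0)), L0, p, [::],
  [seq (1, s, 1) | s <- L0], 0, 0, 0; split=> //.
- by rewrite in_fsetD in_fsetU !in_fset_of pM orbT ML.
- by rewrite eM.
- by rewrite sg; exact: RunNil.
- rewrite vE; apply/fsetP => z; rewrite in_fsetU [z \in fset_of [::]]in_fset_of.
  by rewrite in_nil orbF.
- by rewrite vE; exact: (ph_new ok).
- by rewrite addn0; exact: (stage_card (sub := SubII C' B) _ h).
- rewrite muln0 !addn0; apply: pot_init => // s sL; apply: few_holes_count => //.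
  elim: (L0) ui sL => //= r L IH; rewrite cat_uniq inE => /and3P[ur _ uL] /orP[/eqP->//|].
  exact: IH.
- by rewrite sg.
- by rewrite sg.
move=> c /mapP[s sL ->]; split=> //.
have [_ _ _ /(_ s sL)[_ [x [y [_ _ ch]]]]] := gi.
by exists x, y.
Qed.

(** [e3] increases by one, and the potential of the gaps drops by at least one. *)
Lemma stage3_evict g st p w : 0 < g -> phase_ok st -> few_holes g st ->
    few_holes g (after_evict st w) -> stage3 g st ->
    maximal_path st p -> w \in p -> stale st w ->
    (forall u, u \in p -> stale st u -> off_center p w <= off_center p u) ->
  stage3 g (after_evict st w).
Proof.
move=> g0 ok fh fh' [K0 [L0 [p0 [s [C [a [b [e3 h]]]]]]]] mp wp sw mc.
have uC := stage3_uniq h.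
have [e [s1 [s2 [e' [C1 [cC hp]]]]]] := in_gap (s3_stale h sw).
have [e1 e1' [x [y [ch mx my]]]] := s3_good h cC.
have us : uniq (s1 ++ w :: s2).
  by move: uC; rewrite (perm_uniq (perm_flatten (perm_map (@seg V) hp))) cat_uniq => /andP[].
have hs z : z \in s1 ++ w :: s2 -> z \in previous st /\ ~~ marked st z.
  by move=> zs; apply: (s3_gaps h); exact: (gap_seg cC).
have hw : ~~ hole st w by case/and3P: sw => _ _ wev; rewrite /hole (negbTE wev) andbF.
have lt := pot_evict hp uC sw hw (fun z => hole_after z sw) (@stale_after st w)
  (few_holes_count fh' us)
  (evict_psi (ph_tree ok) g0 fh mp wp sw ch us hs mx my mc).
exists K0, L0, p0, s, C, a, b, e3.+1; split=> //.
- exact: (s3_init h).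
- exact: (s3_start h).
- exact: (s3_path h).
- exact: (s3_last h).
- exact: (s3_run h).
- exact: (s3_verts h).
- exact: (s3_new h).
- by rewrite card_evicted // addnS ltnS; exact: (s3_card h).
- by apply: leq_trans (s3_pot h); rewrite addSn ltn_add2l.
- exact: (s3_gaps h).
- by move=> z; rewrite stale_after => /andP[_]; exact: (s3_stale h).
exact: (s3_good h).
Qed.

Lemma stage_evict g st sub w b : 0 < g -> phase_ok st -> few_holes g st ->
    few_holes g (after_evict st w) -> evicts st sub w b ->
  stage_inv g st sub -> stage_inv g (after_evict st w) b.
Proof.
move=> g0 ok fh fh' ev; elim: ev fh' => {sub w b}.
- by move=> w sw br _ h u; rewrite /= in_fset1U => /orP[/eqP->|/h].
- by move=> w b noI ev IH fh' h; apply: IH => //; exact: stage2_start.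
- by move=> C' B v w vC al sw ad fh' h; exact: stage2_evict.
- move=> C' B w b dead ev IH fh' h; apply: IH => //.
  exact: (stage3_start g0 ok fh h dead (evicts_stale ev)).
by move=> p w mp wp sw mc fh' h; exact: (stage3_evict g0 ok fh fh' h mp wp sw mc).
Qed.

End PhaseInvariant.

(** * Evictions in one phase *)

Section EvictedBound.
Variables (V : choiceType) (G : rel V) (k : nat).
Hypothesis Gsym : symmetric G.
Notation E := (step G).
Variables (A : online V) (q c0 : nat).
Hypothesis k0 : 0 < k.
Hypothesis Alegal : online_legal k A.
Hypothesis comp : forall s, s \in paths G -> cost k A s <= q * OPT k s + c0.
Variable st : state V.
Hypothesis ok : phase_ok G k st.

(** There are at most [q + 2] vertices of degree 0 or 1, as leaves of a tree on [k + 1] pages.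
    [count_deg] bounds those of degree at least 3 by three times as many, less 2; the sum is
    [4 * (q + 2) - 2]. *)
Lemma branch_bound : #|` branches st| <= 4 * q + 6.
Proof.
have tre := ph_tree ok.
have sub : branches st `<=` fset_of (previous st).
  by apply/fsubsetP => z; rewrite in_branches in_fset_of => /andP[].
have [small|big] := leqP #|` fset_of (previous st)| 2.
  by apply: leq_trans (fsubset_leq_card sub) _; move: small; clear; lia.
have lf := leafy_tree tre (step_sym Gsym) (tree_step tre Gsym (ph_prev ok)) big.
have [a [x [aP xP Eax]]] := ph_link ok.
have lf' : leafy E (x |` fset_of (previous st)) (ndeg (previous st) (tree st) (fun n => n <= 1)).
  by apply: (leafy_grow (step_sym Gsym) lf _ Eax); rewrite in_fset_of.
have cx : #|` x |` fset_of (previous st)| = k.+1.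
  by rewrite cardfsU1 (ph_card ok) in_fset_of xP.
have l1 := leafy_bound Gsym k0 Alegal comp cx lf'.
have P0 : previous st != [::] by case: (previous st) aP.
have l2 := count_deg tre P0.
have sub1 p1 p2 : subpred p1 p2 -> ndeg (previous st) (tree st) p1 <= ndeg (previous st) (tree st) p2.
  move=> h; apply: fsubset_leq_card; apply/fsubsetP => z; rewrite !inE /= => /andP[-> /h ->].
  by [].
have l3 := sub1 (fun n => n == 1) (fun n => n <= 1).
have l4 := sub1 (fun n => n == 0) (fun n => n <= 1).
have : #|` branches st| <= ndeg (previous st) (tree st) (fun n => n <= 1) + ndeg (previous st) (tree st) (fun n => 2 < n).
  have : branches st `<=` [fset v in previous st | deg (previous st) (tree st) v <= 1] `|`
      [fset v in previous st | 2 < deg (previous st) (tree st) v].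
    apply/fsubsetP => z; rewrite in_branches /branch => /andP[zP].
    rewrite -[degree st z]/(deg (previous st) (tree st) z) !inE /= zP /=.
    by case: (deg _ _ _) => [|[|[|n]]].
  move/fsubset_leq_card/leq_trans; apply; rewrite cardfsU; exact: leq_subr.
have h3 : ndeg (previous st) (tree st) (fun n => n == 1) <= ndeg (previous st) (tree st) (fun n => n <= 1).
  by apply: l3; case=> [|[|]].
have h4 : ndeg (previous st) (tree st) (fun n => n == 0) <= ndeg (previous st) (tree st) (fun n => n <= 1).
  by apply: l4; case=> [|[|]].
by move: l1 l2 h3 h4; clear; lia.
Qed.

(** The multiples of [g] without [q] add up to [18 + 96 + 31 + 32 = 177]: Subphases I and II, the
    levels, the initial short parts and the short sides split off later. The corresponding multiples
    of [q * g] are [12 + 96 + 10 + 10], which is less. *)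
Theorem evicted_bound g : 0 < g -> stage_inv G k g st (stage st) ->
  #|` fset_of (previous st) `|` fset_of (current st)| <= k + g ->
  #|` evicted st| <= 177 * q.+1 * g.
Proof.
move=> g0 si Xk.
have hb : base g st <= 12 * g * q + 18 * g.
  apply: leq_trans (_ : (4 * q + 6) * g.+2 <= _); first by rewrite leq_mul2r branch_bound orbT.
  by move: g0; clear; nia.
have non3 : #|` evicted st| <= base g st -> #|` evicted st| <= 177 * q.+1 * g.
  by move=> h; apply: leq_trans h (leq_trans hb _); move: g0; clear; nia.
case eS: (stage st) si => [|C' B|] si.
- by apply: non3; exact: (stage_card (sub := SubI V) _ si).
- by apply: non3; exact: (stage_card (sub := SubII C' B) _ si).
have [K0 [L0 [p [s [C [a [b [e3 h]]]]]]]] := si.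
have tre := ph_tree ok.
have Tsym : symmetric (tree st) by case: tre.
have TE := tree_step tre Gsym (ph_prev ok).
have gi := s3_init h; have pK0 := s3_start h; have pw := s3_path h.
have r := s3_run h; have X0k := s3_new h.
have Xk' : #|` vverts K0 L0 `|` fset_of s| <= k + g by rewrite (s3_verts h).
have hA := runA_bound Gsym Tsym TE k0 Alegal comp g0 gi pK0 pw r X0k Xk'.
have hB := runB_bound Gsym Tsym TE g0 k0 Alegal comp gi pK0 pw r X0k Xk'.
have X0k' : #|` vverts K0 L0| <= k + g.
  by apply: leq_trans Xk'; apply: fsubset_leq_card; exact: fsubsetUl.
have K00 : K0 != fset0 by apply/fset0Pn; exists p.
have hI := initB_bound Gsym TE g0 k0 Alegal comp gi X0k X0k' K00.
have hc := s3_card h; have hp := s3_pot h.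
have hA' : 3 * g * levs g L0 + 12 * g * a <= 12 * g * (8 * q + 8).
  apply: leq_trans (_ : 12 * g * (levs g L0 + a) <= _); last by rewrite leq_mul2l hA orbT.
  by rewrite mulnDr leq_add2r -!mulnA leq_mul2r orbT.
have e1 : 12 * g * (8 * q + 8) = 96 * (g * q) + 96 * g by clear; nia.
have e2 : 177 * q.+1 * g = 177 * (g * q) + 177 * g by clear; nia.
rewrite e1 in hA'; rewrite e2.
rewrite -mulnA in hB hI hb.
have := leq_trans (leq_addr _ _) hp.
move: hA' hB hI hb hc; rewrite -!mulnA.
move: (g * levs _ _) (g * a) (g * q) (base _ _) (\sum_(_ <- _) _) #|` _|.
by clear; lia.
Qed.

End EvictedBound.

(** * New pages against the optimum *)

Section Phases.
Variables (V : choiceType) (k : nat).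
Hypothesis k0 : 0 < k.
Implicit Types (p : seq V) (ps : seq (seq V)) (c : {fset V}) (t : seq (V * V)).

Definition newp p p' := #|` fset_of p' `\` fset_of p|.

Fixpoint news p ps := if ps is p' :: ps' then newp p p' + news p' ps' else 0.

Lemma news_rcons p ps p' : news p (rcons ps p') = news p ps + newp (last p ps) p'.
Proof. by elim: ps p => [|p1 ps IH] p /=; rewrite ?addn0 // IH addnA. Qed.

Lemma card_newp p p' : #|` fset_of p `|` fset_of p'| = #|` fset_of p| + newp p p'.
Proof.
have -> : fset_of p `|` fset_of p' = fset_of p `|` (fset_of p' `\` fset_of p).
  by apply/fsetP => z; rewrite !inE; case: (z \in p).
rewrite cardfsU; have -> : fset_of p `&` (fset_of p' `\` fset_of p) = fset0.
  by apply/fsetP => z; rewrite !inE; case: (z \in p).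
by rewrite cardfs0 subn0.
Qed.

Lemma newp_le p p' c t : #|` fset_of p| = k -> #|` c| <= k -> unzip1 t = p ++ p' ->
  newp p p' <= faults k c t.
Proof.
move=> pk ck ut; apply: leq_trans (faults_ge k c t); rewrite ut.
have -> : fset_of (p ++ p') = fset_of p `|` fset_of p' by apply/fsetP => z; rewrite in_fsetU !in_fset_of mem_cat.
have := card_newp p p'; rewrite pk cardfsD => ->.
have : #|` (fset_of p `|` fset_of p') `&` c| <= k.
  by apply: leq_trans ck; apply: fsubset_leq_card; exact: fsubsetIr.
by clear; lia.
Qed.

Lemma unzip1_catP t p p' : unzip1 t = p ++ p' -> exists t1 t2,
  [/\ t = t1 ++ t2, unzip1 t1 = p & unzip1 t2 = p'].
Proof.
move=> e; exists (take (size p) t), (drop (size p) t).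
by rewrite cat_take_drop /unzip1 map_take map_drop -/(unzip1 t) e take_size_cat // drop_size_cat.
Qed.

(** Phases are paired with their successors. Among the pairs considered here the phase [p] occurs
    once only, so its faults stay available for the pair with the phase before it. *)
Lemma news_faults ps p p' c t1 t2 : {in ps, forall p1, #|` fset_of p1| = k} ->
    #|` fset_of p| = k -> #|` c| <= k -> unzip1 t1 = p -> unzip1 t2 = flatten (rcons ps p') ->
    legal k c (t1 ++ t2) ->
  news p (rcons ps p') + faults k c t1 <= 2 * faults k c (t1 ++ t2).
Proof.
elim: ps p c t1 t2 => [|p1 ps IH] p c t1 t2 full pk ck u1 u2 lg.
  rewrite /= cats0 in u2.
  have := @newp_le p p' c (t1 ++ t2) pk ck; rewrite /unzip1 map_cat -/unzip1 -!/(unzip1 _) u1 u2.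
  by rewrite /= addn0 faults_cat => /(_ erefl); clear; lia.
have [t3 [t4 [e4 u3 u4]]] := unzip1_catP u2.
have h1 := @newp_le p p1 c (t1 ++ t3) pk ck.
rewrite /unzip1 map_cat -!/(unzip1 _) u1 u3 in h1.
move: lg; rewrite legal_cat => /andP[lg1 lg2].
have p1k : #|` fset_of p1| = k by apply: full; rewrite inE eqxx.
have full' : {in ps, forall p1, #|` fset_of p1| = k} by move=> z zp; apply: full; rewrite inE zp orbT.
rewrite e4 in lg2.
have := IH p1 (after k c t1) t3 t4 full' p1k (card_after k0 ck lg1) u3 u4 lg2.
have := h1 erefl.
by rewrite /= e4 !faults_cat; clear; lia.
Qed.

(* Each phase together with the next one costs at least as many faults as the
   latter has pages that are new. *)
Theorem news_OPT ps p : {in ps, forall p1, #|` fset_of p1| = k} ->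
  news [::] (rcons ps p) <= 2 * OPT k (flatten (rcons ps p)).
Proof.
move=> full; have [d [sd lg <- _]] := OPT_spec (flatten (rcons ps p)) k0.
have u : unzip1 (zip (flatten (rcons ps p)) d) = flatten (rcons ps p) by rewrite unzip1_zip ?sd.
have first (p1 : seq V) (t1 : seq (V * V)) : unzip1 t1 = p1 -> newp [::] p1 <= faults k fset0 t1.
  move=> u1; apply: leq_trans (faults_ge k fset0 t1); rewrite u1 /newp.
  by have -> : fset_of [::] = fset0 :> {fset V} by apply/fsetP => z; rewrite !inE.
move: (zip _ _) lg u => t lg u {d sd}; case: ps full u => [|p1 ps] full u.
  have := first p t; rewrite /= cats0 in u; move=> /(_ u) /=; clear; lia.
have [t1 [t2 [e u1 u2]]] := unzip1_catP u.
have p1k : #|` fset_of p1| = k by apply: full; rewrite inE eqxx.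
have full' : {in ps, forall p1, #|` fset_of p1| = k} by move=> z zp; apply: full; rewrite inE zp orbT.
rewrite e in lg *.
have ck : #|` (fset0 : {fset V})| <= k by rewrite cardfs0.
have := news_faults full' p1k ck u1 u2 lg; have := first _ _ u1.
by rewrite /=; clear; lia.
Qed.

End Phases.

(** * The invariant of a run of DTO *)

Section DTO.
Variables (V : choiceType) (G : rel V) (k : nat) (A : online V) (q c0 : nat).
Hypothesis Gsym : symmetric G.
Hypothesis k0 : 0 < k.
Hypothesis Alegal : online_legal k A.
Hypothesis comp : forall s, s \in paths G -> cost k A s <= q * OPT k s + c0.
Notation E := (step G).
Implicit Types (st : state V) (x w : V) (s : seq V) (ps : seq (seq V)).

Definition cache_eq st :=
  cache st = (fset_of (previous st) `\` evicted st) `|` fset_of (current st).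

Definition seen st := fset_of (previous st) `|` fset_of (current st).

(** The number of new pages is known only when the phase ends, so the invariant of the stage is kept
    for every [g] that bounds the new pages so far. *)
Definition phase_inv st := [/\ phase_ok G k st, #|` cache st| = k &
  forall g, 0 < g -> #|` seen st| <= k + g -> stage_inv G k g st (stage st)].

Record dto_inv s ps st : Prop := DtoInv {
  di_seq : s = flatten (rcons ps (current st));
  di_full : {in ps, forall p, #|` fset_of p| = k};
  di_prev : last [::] ps = previous st;
  di_cur : #|` fset_of (current st)| <= k;
  di_cache : cache_eq st;
  di_phase : if ps is [::] then evicted st = fset0 else phase_inv st
}.

(** After the first phase the cache is full, so a fault is an eviction, and no page is evicted twice
    in a phase because a victim is stale. In the first phase nothing is evicted. *)
Definition phase_faults ps st :=
  if ps is [::] then #|` fset_of (current st)| else #|` evicted st|.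

(** The cache, of [k] pages, and the holes are disjoint sets of pages seen in the two phases. *)
Lemma few_holesP g st : cache_eq st -> #|` cache st| = k -> #|` seen st| <= k + g ->
  few_holes g st.
Proof.
move=> ce ck sk l ul hl; rewrite -card_fset_of // -(leq_add2l k); apply: leq_trans sk; rewrite -ck.
have dis : cache st `&` fset_of l = fset0.
  apply/fsetP => z; rewrite in_fsetI in_fset_of in_fset0; apply/negP => /andP[zc zl].
  have /and3P[zP ze zM] := allP hl z zl; move: zc.
  by rewrite ce in_fsetU in_fsetD !in_fset_of ze (negbTE zM).
have -> : #|` cache st| + #|` fset_of l| = #|` cache st `|` fset_of l|.
  by rewrite cardfsU dis cardfs0 subn0.
apply: fsubset_leq_card; apply/fsubsetP => z; rewrite in_fsetU ce /seen !in_fsetU in_fsetD !in_fset_of.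
case/orP => [/orP[/andP[_ ->//]|->]|/(allP hl)/and3P[-> _ _] //].
by rewrite orbT.
Qed.

Lemma phase_bound st : phase_inv st -> #|` evicted st| <= 177 * q.+1 * newp (previous st) (current st).
Proof.
move=> [ok ck si].
have e := card_newp (previous st) (current st).
have g0 : 0 < newp (previous st) (current st).
  by have := ph_new ok; rewrite e (ph_card ok); clear; lia.
have le : #|` seen st| <= k + newp (previous st) (current st) by rewrite /seen e (ph_card ok).
exact: (evicted_bound Gsym k0 Alegal comp ok g0 (si _ g0 le)).
Qed.

Lemma stage_inv_ext g st sub c b : stage_inv G k g st sub ->
  stage_inv G k g (State c (evicted st) (previous st) (current st) (tree st) b) sub.
Proof.
case: sub => [//|C' B|]; first by case=> *; split.
by move=> [K0 [L0 [p [s [C [a [b' [e3 []]]]]]]]] *; exists K0, L0, p, s, C, a, b', e3; split.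
Qed.

Lemma phase_ok_ext st c b ev : phase_ok G k st -> {subset ev <= previous st} ->
  phase_ok G k (State c ev (previous st) (current st) (tree st) b).
Proof. by case=> *; split. Qed.

Lemma phase_ok_mark st x : phase_ok G k st -> E (last x (current st)) x ->
  phase_ok G k (after_mark st x).
Proof.
case=> h1 h2 h3 h4 h5 h6 h7 h8 Ex; split=> //=.
- by case: (current st) h3 Ex => //= a l; rewrite rcons_path => -> ->.
- by rewrite -size_eq0 size_rcons.
apply: leq_trans h7 _; apply: fsubset_leq_card; apply/fsubsetP => z.
by rewrite !in_fsetU !in_fset_of mem_rcons inE => /orP[]->; rewrite ?orbT.
Qed.

Lemma cache_evict st x w : cache_eq st -> #|` cache st| = k -> x \notin cache st -> stale st w ->
  let c := serve k (cache st) x w in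
  [/\ c = (fset_of (previous st) `\` (w |` evicted st)) `|` fset_of (rcons (current st) x) &
      #|` c| = k].
Proof.
move=> ce ck xc /and3P[wP wM we]; rewrite /serve (negbTE xc) ck ltnn /=.
have wc : w \in cache st by rewrite ce in_fsetU in_fsetD in_fset_of wP we.
split; last first.
  have := cardfsD1 w (cache st); rewrite wc ck cardfsU1 in_fsetD1 (negbTE xc) andbF /=.
  by clear; lia.
apply/fsetP => z; rewrite in_fset1U in_fsetD1 ce !in_fsetU !in_fsetD !in_fset_of mem_rcons in_fset1U inE.
case: (eqVneq z x) => [->|zx] /=; first by rewrite orbT.
by case: (eqVneq z w) => [->|zw] //=; rewrite (negbTE wM).
Qed.

(* In st the current request is already marked, but not yet in the cache. *)
Lemma phase_evict st M x w b c : phase_ok G k st -> current st = rcons M x ->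
    cache st = (fset_of (previous st) `\` evicted st) `|` fset_of M ->
    #|` cache st| = k -> x \notin cache st ->
    (forall g, 0 < g -> #|` seen st| <= k + g -> few_holes g st /\ stage_inv G k g st (stage st)) ->
    evicts st (stage st) w b -> c = serve k (cache st) x w ->
  let st' := State c (w |` evicted st) (previous st) (current st) (tree st) b in
  [/\ cache_eq st', phase_inv st' & #|` evicted st'| = #|` evicted st|.+1].
Proof.
move=> ok eM ce ck xc si ev -> st'.
have sw := evicts_stale ev.
pose st0 := State (cache st) (evicted st) (previous st) M (tree st) (stage st).
have sw0 : stale st0 w.
  by move: sw; rewrite /stale /= eM mem_rcons inE negb_or => /and3P[-> /andP[_ ->] ->].
have [e1 e2] := @cache_evict st0 x w ce ck xc sw0.
have ce' : cache_eq st' by rewrite /cache_eq /= e1 eM.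
split=> //; last exact: card_evicted.
split=> //.
  apply: (phase_ok_ext _ _ ok) => z; rewrite in_fset1U => /orP[/eqP->|]; first by case/and3P: sw.
  exact: (ph_evicted ok).
move=> g g0 le; have [fh sg] := si g g0 le.
have fh' : few_holes g (after_evict st w).
  move=> l ul hl; exact: (few_holesP ce' e2 le ul hl).
exact: (stage_inv_ext _ _ (stage_evict Gsym g0 ok fh fh' ev sg)).
Qed.

Lemma fset_of_rcons (t : seq V) x : fset_of (rcons t x) = x |` fset_of t.
Proof. by apply/fsetP => z; rewrite in_fset1U !in_fset_of mem_rcons inE. Qed.

Lemma phase_faults_rcons ps p st : phase_faults (rcons ps p) st = #|` evicted st|.
Proof. by case: ps. Qed.

Lemma di_first s ps st : dto_inv s ps st -> ps = [::] ->
  [/\ previous st = [::], evicted st = fset0 & cache st = fset_of (current st)].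
Proof.
case=> h1 h2 h3 h4 h5 h6 e; rewrite e in h3 h6.
have e1 : previous st = [::] by rewrite -h3.
split=> //; rewrite h5 e1; apply/fsetP => z.
by rewrite in_fsetU in_fsetD [z \in fset_of [::]]in_fset_of in_nil andbF.
Qed.

Lemma di_later s ps st : dto_inv s ps st -> ps != [::] -> phase_inv st.
Proof. by move/di_phase; case: ps. Qed.

(** The bound on evictions is called upon only when the current phase is closed, by the next phase
    or by the end of the sequence. *)
Lemma potential_next s ps st : dto_inv s ps st ->
  177 * q.+1 * news [::] ps + phase_faults ps st <= 177 * q.+1 * news [::] (rcons ps (current st)).
Proof.
move=> h; rewrite news_rcons mulnDr leq_add2l; case: (eqVneq ps [::]) => [e|ne].
  rewrite e /= /newp; have -> : fset_of [::] = fset0 :> {fset V} by apply/fsetP => z; rewrite !inE.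
  by rewrite fsetD0 leq_pmull.
have -> : phase_faults ps st = #|` evicted st| by case: (ps) ne.
by rewrite (di_prev h); apply: phase_bound; exact: (di_later h ne).
Qed.

(** At this moment the cache consists exactly of the [k] pages of the finished phase, so the first
    request of the new phase is a fault with an eviction. *)
Lemma inv_start s ps st x w st' : rcons s x \in paths G -> dto_inv s ps st ->
    starts_phase k st x -> dto_step k st x w st' ->
  [/\ dto_inv (rcons s x) (rcons ps (current st)) st', cache st' = serve k (cache st) x w,
      x \notin cache st & #|` evicted st'| = 1].
Proof.
move=> pth h sp [st0]; rewrite /mark sp => -[T tT ->] /=.
have [xM] := andP sp; rewrite -card_fseq => kM.
have {kM}kM : #|` fset_of (current st)| = k by apply/eqP; rewrite eqn_leq (di_cur h).
have ce : cache st = fset_of (current st).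
  case: (eqVneq ps [::]) => [e|ne]; first by have [] := di_first h e.
  have [_ ck _] := di_later h ne; apply/eqP.
  rewrite eq_sym eqEfcard ck kM leqnn andbT; apply/fsubsetP => z zM.
  by rewrite (di_cache h) in_fsetU zM orbT.
have xc : x \notin cache st by rewrite ce in_fset_of.
have ck : #|` cache st| = k by rewrite ce.
rewrite (negbTE xc) ck ltnn /= => -[b ev ->].
pose st1 := State (cache st) fset0 (current st) [:: x] T (SubI V).
move: pth; rewrite (di_seq h) flatten_rcons -cats1 -catA => /cat_sorted2[_ sM].
have [sc _] := cat_sorted2 sM.
have M0 : current st != [::].
  by apply/eqP => e; move: kM k0; rewrite e => <-; rewrite [fset_of _](_ : _ = fset0) ?cardfs0 //; apply/fsetP => z; rewrite !inE.
have ok1 : phase_ok G k st1.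
  split=> //=.
  - have -> : fset_of (current st) `|` fset_of [:: x] = x |` fset_of (current st).
      by apply/fsetP => z; rewrite in_fsetU in_fset1U !in_fset_of inE orbC.
    by rewrite cardfsU1 in_fset_of xM kM.
  case: (current st) M0 xM sM => // m M _ xM sM; exists (last m M), x.
  by split=> //; [exact: mem_last|move: sM; rewrite cats1 /= rcons_path => /andP[]].
have [||h1 h2 h3] := phase_evict (M := [::]) ok1 erefl _ ck xc _ ev erefl.
- by rewrite /= ce; apply/fsetP => z; rewrite in_fsetU in_fsetD !in_fset_of in_nil orbF.
- move=> g _ _; split=> // l _ hl; case: l hl => // z l /andP[/and3P[_]].
  by rewrite in_fset0.
split=> //.
split=> //.
- by rewrite /= !flatten_rcons catA.
- by move=> p; rewrite mem_rcons inE => /orP[/eqP->|/(di_full h)].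
- by rewrite last_rcons.
- by rewrite /= card_fset_of.
by case: (ps).
Qed.

Lemma inv_continue s ps st x w st' : rcons s x \in paths G -> dto_inv s ps st ->
    ~~ starts_phase k st x -> dto_step k st x w st' ->
  [/\ dto_inv (rcons s x) ps st', cache st' = serve k (cache st) x w &
      phase_faults ps st + (x \notin cache st) = phase_faults ps st'].
Proof.
move=> pth h nsp [st1]; rewrite /mark (negbTE nsp) => -> /=.
have cur : #|` fset_of (rcons (current st) x)| <= k.
  rewrite fset_of_rcons cardfsU1 in_fset_of; move: nsp; rewrite /starts_phase -card_fseq negb_and.
  rewrite negbK -ltnNge => /orP[->|lt]; first exact: (di_cur h).
  by apply: leq_trans lt; rewrite addnC -addn1 leq_add2l leq_b1.
have sq : rcons s x = flatten (rcons ps (rcons (current st) x)).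
  by rewrite (di_seq h) !flatten_rcons rcons_cat.
case: (eqVneq ps [::]) => [e|ne].
  have [e1 e2 e3] := di_first h e.
  have sh : (x \in cache st) || (#|` cache st| < k).
    rewrite e3 in_fset_of; move: nsp; rewrite /starts_phase -card_fseq negb_and negbK.
    by rewrite -ltnNge.
  rewrite sh => ->; subst ps.
  have es : serve k (cache st) x w = fset_of (rcons (current st) x).
    rewrite /serve fset_of_rcons -e3; case: ifP sh => [xc _|_ /= ->] //.
    by apply/esym/fsetUidPr; rewrite fsub1set.
  split=> //.
    split=> //.
    rewrite /cache_eq /= es e1; apply/fsetP => z.
    by rewrite in_fsetU in_fsetD [z \in fset_of [::]]in_fset_of in_nil andbF.
  by rewrite /phase_faults /= fset_of_rcons cardfsU1 -e3 addnC.
have [ok ck si] := di_later h ne.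
have pf st2 : phase_faults ps st2 = #|` evicted st2| by case: (ps) ne.
have Ex : E (last x (current st)) x.
  have M0 := ph_start ok; move: pth; rewrite sq flatten_rcons => /cat_sorted2[_].
  by case: (current st) M0 => //= m M _; rewrite rcons_path => /andP[].
have ok1 := phase_ok_mark ok Ex.
have seenS : seen st `<=` seen (after_mark st x).
  by rewrite /seen /= fset_of_rcons fsetUCA fsubsetUr.
have si1 g : 0 < g -> #|` seen (after_mark st x)| <= k + g ->
    few_holes g (after_mark st x) /\ stage_inv G k g (after_mark st x) (stage st).
  move=> g0 le; have le' := leq_trans (fsubset_leq_card seenS) le.
  have fh := few_holesP (di_cache h) ck le'.
  split; last exact: (stage_mark g0 ok fh Ex (si g g0 le')).
  move=> l ul hl; apply: fh => //; apply: sub_all hl => z.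
  by rewrite hole_mark => /andP[].
rewrite ck ltnn orbF; case: (boolP (x \in cache st)) => [xc ->|xc [b ev ->]].
  have es : serve k (cache st) x w = cache st by rewrite /serve xc.
  split=> //; last by rewrite !pf addn0.
  split=> //; [exact: (di_full h)|exact: (di_prev h)| |].
    rewrite /cache_eq /= es fset_of_rcons fsetUCA -(di_cache h).
    by apply/esym/fsetUidPr; rewrite fsub1set.
  suff : phase_inv (State (serve k (cache st) x w) (evicted st) (previous st)
      (rcons (current st) x) (tree st) (stage st)) by case: (ps) ne.
  split=> /=; [exact: (phase_ok_ext _ _ ok1 (ph_evicted ok1))|by rewrite es|].
  move=> g g0 le; have [_ sg] := si1 g g0 le.
  exact: (stage_inv_ext _ _ sg).
have [h1 h2 h3] := phase_evict ok1 erefl (di_cache h) ck xc si1 ev erefl.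
split=> //; last by rewrite !pf h3 addn1.
split=> //; [exact: (di_full h)|exact: (di_prev h)|].
by case: (ps) ne.
Qed.

End DTO.

(** [354 = 2 * 177], where the factor 2 is that of [news_OPT]. *)
Lemma dto_cost (V : choiceType) (G : rel V) k (A D : online V) q c0 :
    symmetric G -> 0 < k -> online_legal k A ->
    (forall s, s \in paths G -> cost k A s <= q * OPT k s + c0) -> is_DTO k D ->
  forall s, s \in paths G -> cost k D s <= 354 * q.+1 * OPT k s.
Proof.
move=> Gsym k0 Alegal comp [S S0 Sstep] s sG.
have [ps [h _ hc]] : exists ps, [/\ dto_inv G k s ps (S s), onlcache k D s = cache (S s) &
    cost k D s <= 177 * q.+1 * news [::] ps + phase_faults ps (S s)].
  elim/last_ind: s sG => [_|s x IH pth].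
    exists [::]; rewrite S0; split=> //; split=> //=; first by rewrite card_fset_of.
    by rewrite /cache_eq /=; apply/fsetP => z; rewrite !inE.
  have sG : s \in paths G by move: pth; rewrite -cats1 => /cat_sorted2[].
  have [ps [h hcache hc]] := IH sG.
  have er : rest D s [:: x] = [:: (x, D (rcons s x))] by rewrite /rest /= cats1.
  have ec : onlcache k D (rcons s x) = serve k (cache (S s)) x (D (rcons s x)).
    by rewrite /onlcache -cats1 schedule_cat after_cat -/(onlcache _ _ _) er hcache /= cats1.
  have ecost : cost k D (rcons s x) = cost k D s + (x \notin cache (S s)).
    by rewrite -cats1 cost_cat er hcache /= addn0.
  have [sp|sp] := boolP (starts_phase k (S s) x).
    have [h1 h2 h3 h4] := inv_start Gsym k0 pth h sp (Sstep s x).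
    exists (rcons ps (current (S s))); split=> //; first by rewrite ec h2.
    rewrite ecost h3 phase_faults_rcons h4 leq_add2r.
    exact: leq_trans hc (potential_next Gsym k0 Alegal comp h).
  have [h1 h2 h3] := inv_continue Gsym pth h sp (Sstep s x).
  exists ps; split=> //; first by rewrite ec h2.
  by rewrite ecost -h3 addnA leq_add2r.
apply: leq_trans (leq_trans hc (potential_next Gsym k0 Alegal comp h)) _.
have -> : 354 * q.+1 * OPT k s = 177 * q.+1 * (2 * OPT k s) by clear; nia.
rewrite leq_mul2l; apply/orP; right; rewrite [in OPT k s](di_seq h).
exact: (news_OPT k0 _ (di_full h)).
Qed.

(** * Passage to the ratios in the extended reals *)

Import Order.TTheory GRing.Theory Num.Theory.
Local Open Scope ring_scope.

Theorem mainTheorem2 (R : realType) :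
  exists b1 b2 : R, [/\ 0 <= b1, 0 <= b2 &
    forall (k : nat) (V : choiceType) (A : online V) (G : rel V),
      (1 <= k)%N -> symmetric G -> is_DTO k A ->
      (strict_ratio R k A G <= b1%:E * graph_ratio R k G + b2%:E)%E].
Proof.
have [B [B0 eB]] : exists B : R, 0 < B /\ B = 354%:R by exists 354%:R; rewrite ltr0n.
(* [dto_cost] has the factor [q + 1], and [q] is the integer part of the ratio [r] plus one; so the
   factor is at most [r + 2]. *)
exists B, (B * 2); split; [exact: ltW|by rewrite mulr_ge0 // ltW|].
move=> k V D G k0 Gsym dto.
have main (A : online V) (r C : R) : online_legal k A -> 0 <= r ->
    (forall s, s \in paths G -> (cost k A s)%:R <= r * (OPT k s)%:R + C) ->
    (strict_ratio R k D G <= (B * r + B * 2)%:E)%E.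
  move=> Al r0 hA; pose q := (Num.truncn r).+1; pose c0 := (Num.truncn C).+1.
  have comp s : s \in paths G -> (cost k A s <= q * OPT k s + c0)%N.
    move=> sG; rewrite -(ler_nat R) natrD natrM; apply: le_trans (hA s sG) _.
    by rewrite lerD ?ler_wpM2r // ltW // truncnS_gt.
  apply: (@le_trans _ _ (B * q.+1%:R)%:E).
    apply: ereal_inf_lbound; exists (B * q.+1%:R) => //.
    split=> [|s sG]; first by rewrite mulr_ge0 // ltW.
    by rewrite eB -!natrM ler_nat; exact: (dto_cost Gsym k0 Al comp dto).
  by rewrite lee_fin -mulrDr ler_pM2l // -[q.+1]addn2 natrD lerD2r truncn_le.
clear eB.
(* Both infima in [graph_ratio] are handled at once. This serves with [y] the finite value
   [(s - B * 2) / B], and with [+oo] if the strict ratio is infinite. *)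
have low (y : \bar R) : (forall (A : online V) (r C : R), online_legal k A -> 0 <= r ->
    (forall s, s \in paths G -> (cost k A s)%:R <= r * (OPT k s)%:R + C) -> (y <= r%:E)%E) ->
    (y <= graph_ratio R k G)%E.
  move=> h; apply: le_ereal_inf_tmp => _ [A Al <-]; apply: le_ereal_inf_tmp => _ [r [r0 [C _ hA]] <-].
  exact: h Al r0 hA.
case eS: (strict_ratio R k D G) => [s| |]; last by rewrite leNye.
  have : (((s - B * 2) / B)%:E <= graph_ratio R k G)%E.
    apply: low => A r C Al r0 hA; have := main A r C Al r0 hA.
    by rewrite eS !lee_fin ler_pdivrMr // lerBlDr mulrC.
  case: (graph_ratio R k G) => [g| |] //=.
    by rewrite -EFinM -EFinD !lee_fin ler_pdivrMr // lerBlDr mulrC.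
  by rewrite gt0_muley ?lte_fin // addye // !leey.
have : (+oo <= graph_ratio R k G)%E.
  by apply: low => A r C Al r0 hA; have := main A r C Al r0 hA; rewrite eS.
by rewrite leye_eq => /eqP ->; rewrite gt0_muley ?lte_fin // addye.
Qed.
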